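(* Suppose $0\le Z_t\le 1$ with probability 1 for all $t\in\{1,\ldots,T\}$, and that the simulation and reward-evaluation oracles with unit costs $C$ and $G$ described in the context are available. Then for any $\epsilon\in(0,1)$, Algorithm $\mathcal A'$ of the context (with input accuracy $\epsilon$) implements a randomized stopping time $\tau_\epsilon$ such that $$E[Z_{\tau_\epsilon}]\ge\mathrm{OPT}-\epsilon .$$ In addition, at each time step, the decision of whether to stop (if one has not yet stopped) requires total computational time at most $$(C+G+1)\times\exp(250\,\epsilon^{-2})\times T^{12\epsilon^{-1}} .$$
   Context: Problem. Let $T,D\ge 1$ be integers. $\mathbf Y=(Y_1,\ldots,Y_T)$ is an arbitrary (possibly non-Markovian) discrete-time stochastic process, each $Y_t$ being a random vector in $\mathbb R^D$; $Y_{[t]}=(Y_1,\ldots,Y_t)$. For a $D\times T$ matrix $M$, $M_{[t]}$ denotes its first $t$ columns. $\mathcal F$ is the natural filtration of $\mathbf Y$. For each $t$, $g_t:\mathbb R^{D\times t}\to\mathbb R$ is measurable and $Z_t=g_t(Y_{[t]})$ is the (integrable, non-negative) reward for stopping at $t$. $\mathcal T$ is the set of stopping times adapted to $\mathcal F$ with values in $\{1,\ldots,T\}$, and $\mathrm{OPT}=\sup_{\tau\in\mathcal T}E[Z_\tau]$, assumed strictly positive. A randomized stopping time is a $\{1,\ldots,T\}$-valued random time for which the decision to stop at $t$ depends only on $Y_{[t]}$ and on auxiliary randomness generated up to time $t$ which, given $Y_{[t]}$, is independent of $(Y_{t+1},\ldots,Y_T)$. Oracles. For every $t\in\{0,\ldots,T\}$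 and $\gamma\in\mathbb R^{D\times t}$, a call $\mathcal B(t,\gamma)$ returns a fresh independent sample of a $D\times T$ matrix distributed as $\mathbf Y$ conditioned on $\{Y_{[t]}=\gamma\}$, at cost $C$ units of time; evaluating any $g_t$ on any given partial trajectory costs $G$ units of time. ($C$ and $G$ are assumed to scale at most polynomially in $T$ and $D$.) Computational model. Computation is over real numbers. Each addition, subtraction, multiplication, division, maximum or minimum of two numbers, or raising of a number to a power, costs one unit; the median of $n$ numbers costs $n$ units; reading, writing, storing and passing numbers is free; sampling a standard Bernoulli, uniform on $[0,1]$ or standard normal variable costs one unit. The median of $x_1\le\cdots\le x_n$ is $\frac12(x_{\lfloor (n+1)/2\rfloor}+x_{\lfloor n/2\rfloor+1})$. Let $N(\epsilon,\eta)=\lceil\frac1{2\epsilon^2}\log(\frac2\eta)\rceil$. Algorithms $\mathcal B^k(t,\gamma,\epsilon,\delta)$, $k\ge1$ (recursively defined; all calls use independent randomness). $\mathcal B^1(t,\gamma,\epsilon,\delta)$ returns $g_t(\gamma)$. $\mathcal B^{k+1}(t,\gamma,\epsilon,\delta)$: let $N=N(\frac\epsilon4,\frac1{16})$. For each $s=1,\ldots,\lceil 8\log(2\delta^{-1})\rceil$: let $A^3$ be the output of $\mathcal B^k(t,\gamma,\frac\epsilon2,\frac18)$; for $i=1,\ldots,N$, draw $\mathbf A^1$ by a call $\mathcal B(t,\gamma)$, let $A^2_j$ be the output of $\mathcal B^k(j,\mathbf A^1_{[j]},\frac\epsilon4,\frac1{16NT})$ for $j=1,\ldots,T$, and set $A^0_i=\max_jA^2_j$;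 set $A^m_s=A^3-N^{-1}\sum_{i=1}^NA^0_i$. Return the median of $(A^m_s)_s$. Algorithm $\mathcal A'$ with accuracy $\epsilon$ (defining $\tau_\epsilon$): at each time $t=1,\ldots,T-1$ at which one has not yet stopped, after observing $Y_{[t]}$, make an independent call to $\mathcal B^{\lceil4\epsilon^{-1}\rceil+1}\big(t,Y_{[t]},\frac\epsilon4,\frac{\epsilon}{4T}\big)$ and stop at time $t$ if the returned value is at least $-\frac12\epsilon$; otherwise continue. If one has not stopped before time $T$, stop at time $T$. *)

(* Defs.v *)
From HB Require Import structures.
From mathcomp Require Import all_boot all_order all_algebra.
From mathcomp Require Import all_classical all_reals all_analysis.
From mathcomp Require Import measurable_realfun.
Set Implicit Arguments.
Unset Strict Implicit.
Unset Printing Implicit Defensive.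
Import Order.TTheory GRing.Theory Num.Theory.
Import numFieldNormedType.Exports.
Local Open Scope classical_set_scope.
Local Open Scope ring_scope.

(* Borel sigma-algebra of 'M[R]_(m, n), generated by the coordinate maps. *)
Section matrix_measurable.
Context {R : realType} {m n : nat}.

Definition matrix_cylinders : set (set 'M[R]_(m, n)) :=
  \bigcup_(ij in [set: 'I_m * 'I_n])
    preimage_set_system setT (fun M : 'M[R]_(m, n) => M ij.1 ij.2) measurable.

HB.instance Definition _ := @isMeasurable.Build (sigma_display matrix_cylinders)
  'M[R]_(m, n) <<s matrix_cylinders >>
  (@sigma_algebra0 _ setT matrix_cylinders)
  (@sigma_algebraC _ matrix_cylinders)
  (@sigma_algebra_bigcup _ setT matrix_cylinders).

End matrix_measurable.

(* E is an event; f (V w) is a version of P(E | V)(w). *)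
Definition is_cprob {R : realType} d (Omega : measurableType d)
    (P : probability Omega R) d' (X : measurableType d') (V : Omega -> X)
    (E : set Omega) (f : X -> \bar R) : Prop :=
  measurable_fun setT f /\
  forall B : set X, measurable B ->
    P (E `&` V @^-1` B) = (\int[P]_(w in V @^-1` B) f (V w))%E.

(* The set systems H and K are conditionally independent given V:
   P(E /\ F | V) = P(E | V) P(F | V) almost surely. *)
Definition cond_indep {R : realType} d (Omega : measurableType d)
    (P : probability Omega R) d' (X : measurableType d') (V : Omega -> X)
    (H K : set_system Omega) : Prop :=
  forall E F, H E -> K F -> exists f h : X -> \bar R,
    [/\ is_cprob P V E f, is_cprob P V F h
      & is_cprob P V (E `&` F) (fun x => f x * h x)%E].

(* A time t is an element of 'I_T.+1, i.e. t in {0, ..., T}; time 0 (no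
   observation yet) is excluded explicitly wherever times range over
   {1, ..., T}.  Column j of a path is the value of the process at time j + 1. *)
Section stopping.
Context {R : realType} {T D : nat}.
Implicit Types t : 'I_T.+1.

Definition first_cols t (M : 'M[R]_(D, T)) : 'M[R]_(D, t) :=
  colsub (widen_ord (leq_ord t)) M.

Fact last_cols_subproof t (j : 'I_(T - t)) : (t + j < T)%N.
Proof. by rewrite -ltn_subRL. Qed.

Definition last_cols t (M : 'M[R]_(D, T)) : 'M[R]_(D, T - t) :=
  colsub (fun j : 'I_(T - t) => Ordinal (last_cols_subproof j)) M.

Section rewards.
Variable g : forall t, 'M[R]_(D, t) -> R.

Definition reward t (y : 'M[R]_(D, T)) : R := g (first_cols t y).

Context d (Omega : measurableType d).
Variables (P : probability Omega R) (Y : Omega -> 'M[R]_(D, T)).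

Definition natural_filtration t : set_system Omega :=
  preimage_set_system setT (first_cols t \o Y) measurable.

Definition stopping_time (tau : Omega -> 'I_T.+1) : Prop :=
  (forall w, 0 < tau w)%N /\
  forall t, natural_filtration t [set w | (tau w <= t)%N].

(* H t is the auxiliary randomness generated up to time t. *)
Definition randomized_stopping_time (tau : Omega -> 'I_T.+1) : Prop :=
  (forall w, 0 < tau w)%N /\
  exists H : 'I_T.+1 -> set_system Omega,
    [/\ forall t, sigma_algebra setT (H t) /\ H t `<=` measurable,
        forall s t : 'I_T.+1, (s <= t)%N -> H s `<=` H t,
        forall t, <<s natural_filtration t `|` H t >>
                    [set w | (tau w <= t)%N]
      & forall t, cond_indep P (first_cols t \o Y) (H t)
                    (preimage_set_system setT (last_cols t \o Y) measurable)].

Definition expected_reward (tau : Omega -> 'I_T.+1) : \bar R :=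
  'E_P[fun w => reward (tau w) (Y w)].

Definition OPT : \bar R :=
  ereal_sup [set expected_reward tau | tau in stopping_time].

(* kappa is a regular version of the law of Y given its first t columns. *)
Definition conditional_law t
    (kappa : R.-pker 'M[R]_(D, t) ~> 'M[R]_(D, T)) : Prop :=
  forall A : set 'M[R]_(D, T), measurable A ->
    is_cprob P (first_cols t \o Y) (Y @^-1` A) (fun gamma => kappa gamma A).

End rewards.

(* Randomized programs with real arithmetic and access to the two oracles.
   Every constructor but Ret is one priced primitive, followed by the rest of
   the program as a function of the answer.  Only the primitives that the
   algorithms need are present.  Log, Ceil (needed for loop counts) and the
   comparison Geq are charged one unit each, like the arithmetic operations;
   a Median of n numbers is charged n units, see time_le. *)
Inductive arith_op := Add | Sub | Mul | Div | Max.

Inductive prog (A : Type) : Type :=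
| Ret of A
| Arith of arith_op & R & R & (R -> prog A)
| Log of R & (R -> prog A)
| Ceil of R & (nat -> prog A)
| Geq of R & R & (bool -> prog A)
| Median of seq R & (R -> prog A)
| Simulate (t : 'I_T.+1) of 'M[R]_(D, t) & ('M[R]_(D, T) -> prog A)
| Evaluate (t : 'I_T.+1) of 'M[R]_(D, t) & (R -> prog A).

Definition arith_val (o : arith_op) (x y : R) : R :=
  match o with
  | Add => x + y | Sub => x - y | Mul => x * y | Div => x / y
  | Max => Num.max x y
  end.

Definition ceil_val (x : R) : nat :=
  if Num.ceil x is Posz n then n else 0%N.

(* 1-based: the mean of the entries of ranks floor((n + 1) / 2) and
   floor(n / 2) + 1 of the sorted list. *)
Definition median_val (s : seq R) : R :=
  let x := sort <=%R s in
  (x`_((size s).+1./2.-1) + x`_((size s)./2)) / 2.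

Section semantics.
Variables (g : forall t, 'M[R]_(D, t) -> R)
  (kappa : forall t : 'I_T.+1, R.-pker 'M[R]_(D, t) ~> 'M[R]_(D, T)).

(* Expectation of h applied to the output of p, for h >= 0.  Each call of the
   simulator is integrated out on its own, given everything that was drawn
   before: its answer is a fresh sample of kappa t gamma.  For the algorithms
   below every integrand is measurable, because g t (0 < t) and the kernels
   are. *)
Fixpoint expect {A : Type} (p : prog A) (h : A -> \bar R) : \bar R :=
  match p with
  | Ret a => h a
  | Arith o x y k => expect (k (arith_val o x y)) h
  | Log x k => expect (k (ln x)) h
  | Ceil x k => expect (k (ceil_val x)) h
  | Geq x y k => expect (k (y <= x)) h
  | Median s k => expect (k (median_val s)) h
  | Simulate t gamma k => (\int[kappa t gamma]_M expect (k M) h)%E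
  | Evaluate t gamma k => expect (k (g gamma)) h
  end.

(* Probability that p outputs a. *)
Definition out_prob {A : eqType} (p : prog A) (a : A) : \bar R :=
  expect p (fun b => (b == a)%:R%:E).

(* The running time of p is at most b, whatever the simulator answers. *)
Fixpoint time_le (C G : R) {A : Type} (p : prog A) (b : R) : Prop :=
  match p with
  | Ret a => 0 <= b
  | Arith o x y k => time_le C G (k (arith_val o x y)) (b - 1)
  | Log x k => time_le C G (k (ln x)) (b - 1)
  | Ceil x k => time_le C G (k (ceil_val x)) (b - 1)
  | Geq x y k => time_le C G (k (y <= x)) (b - 1)
  | Median s k => time_le C G (k (median_val s)) (b - (size s)%:R)
  | Simulate t gamma k => forall M, time_le C G (k M) (b - C)
  | Evaluate t gamma k => time_le C G (k (g gamma)) (b - G)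
  end.

End semantics.

Fixpoint bind {A B : Type} (p : prog A) (f : A -> prog B) : prog B :=
  match p with
  | Ret a => f a
  | Arith o x y k => Arith o x y (fun z => bind (k z) f)
  | Log x k => Log x (fun z => bind (k z) f)
  | Ceil x k => Ceil x (fun n => bind (k n) f)
  | Geq x y k => Geq x y (fun b => bind (k b) f)
  | Median s k => Median s (fun z => bind (k z) f)
  | Simulate t gamma k => Simulate gamma (fun M => bind (k M) f)
  | Evaluate t gamma k => Evaluate gamma (fun z => bind (k z) f)
  end.

Local Notation "x <- p ;; q" := (bind p (fun x => q))
  (at level 100, p at next level, q at level 200, right associativity).

Definition arith o x y : prog R := Arith o x y (@Ret R).
Definition logp x : prog R := Log x (@Ret R).
Definition ceilp x : prog nat := Ceil x (@Ret nat).
Definition geqp x y : prog bool := Geq x y (@Ret bool).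
Definition medianp s : prog R := Median s (@Ret R).
Definition simulate t (gamma : 'M[R]_(D, t)) : prog 'M[R]_(D, T) :=
  Simulate gamma (@Ret _).
Definition evaluate t (gamma : 'M[R]_(D, t)) : prog R :=
  Evaluate gamma (@Ret R).

Fixpoint foreach {I A : Type} (s : seq I) (f : I -> prog A) : prog (seq A) :=
  if s is i :: s' then
    a <- f i ;; l <- foreach s' f ;; Ret (a :: l)
  else Ret [::].

Definition repeat {A : Type} (n : nat) (p : prog A) : prog (seq A) :=
  foreach (iota 0 n) (fun=> p).

Fixpoint fold_arith o (x : R) (s : seq R) : prog R :=
  if s is y :: s' then z <- arith o x y ;; fold_arith o z s' else Ret x.

Definition sump (s : seq R) : prog R := fold_arith Add (head 0 s) (behead s).
Definition maxp (s : seq R) : prog R := fold_arith Max (head 0 s) (behead s).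

(* N(e, eta) = ceil (1 / (2 e^2) * ln (2 / eta)) *)
Definition sample_size (e eta : R) : prog nat :=
  e2 <- arith Mul e e ;;
  den <- arith Mul 2 e2 ;;
  inv <- arith Div 1 den ;;
  r <- arith Div 2 eta ;;
  l <- logp r ;;
  x <- arith Mul inv l ;;
  ceilp x.

(* ceil (8 ln (2 / delta)) *)
Definition repetitions (delta : R) : prog nat :=
  r <- arith Div 2 delta ;;
  l <- logp r ;;
  x <- arith Mul 8 l ;;
  ceilp x.

(* 1, ..., T in increasing order *)
Definition times : seq 'I_T.+1 :=
  seq.filter (fun t : 'I_T.+1 => (0 < t)%N) (enum 'I_T.+1).

(* Balg k is the algorithm B^(k + 1) *)
Fixpoint Balg (k : nat) {t : 'I_T.+1} (gamma : 'M[R]_(D, t)) (e delta : R)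
    {struct k} : prog R :=
  match k with
  | 0 => evaluate gamma
  | k'.+1 =>
    e2 <- arith Div e 2 ;;
    e4 <- arith Div e 4 ;;
    N <- sample_size e4 (1 / 16) ;;
    NT <- arith Mul N%:R T%:R ;;
    NT16 <- arith Mul 16 NT ;;
    delta' <- arith Div 1 NT16 ;;
    S <- repetitions delta ;;
    Am <- repeat S (
      A3 <- Balg k' gamma e2 (1 / 8) ;;
      A0 <- repeat N (
        A1 <- simulate gamma ;;
        A2 <- foreach times (fun j => Balg k' (first_cols j A1) e4 delta') ;;
        maxp A2) ;;
      sum <- sump A0 ;;
      mean <- arith Div sum N%:R ;;
      arith Sub A3 mean) ;;
    medianp Am
  end.

(* What algorithm A' does at time t, having observed gamma and not yet stopped;
   the answer true means stop. *)
Definition decision (eps : R) (t : 'I_T.+1) (gamma : 'M[R]_(D, t)) :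
    prog bool :=
  if t == ord_max then Ret true else
  x <- arith Div 4 eps ;;
  K <- ceilp x ;;
  e4 <- arith Div eps 4 ;;
  T4 <- arith Mul 4 T%:R ;;
  delta <- arith Div eps T4 ;;
  v <- Balg K gamma e4 delta ;;
  threshold <- arith Mul (- (1 / 2)) eps ;;
  geqp v threshold.

(* Algorithm A' along the path y.  The path is only read through first_cols t
   at time t; for 0 < T the second branch is never reached from times, since
   decision stops at time T. *)
Fixpoint run (eps : R) (ts : seq 'I_T.+1) (y : 'M[R]_(D, T)) : prog 'I_T.+1 :=
  if ts is t :: ts' then
    stop <- decision eps (first_cols t y) ;;
    if stop then Ret t else run eps ts' y
  else Ret ord_max.

Definition stop_alg (eps : R) (y : 'M[R]_(D, T)) : prog 'I_T.+1 :=
  run eps times y.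

(* (Omega', P', pi) is an extension of (Omega, P) and tau is the time at which
   algorithm A' stops when fed with the path of Y: the conditional law of tau
   given the sample point of Omega is the output law of A' along Y.  This
   determines the joint law of the sample point and tau. *)
Definition implements (g : forall t, 'M[R]_(D, t) -> R)
    (kappa : forall t : 'I_T.+1, R.-pker 'M[R]_(D, t) ~> 'M[R]_(D, T))
    (eps : R)
    d (Omega : measurableType d) (P : probability Omega R)
    (Y : Omega -> 'M[R]_(D, T))
    d' (Omega' : measurableType d') (P' : probability Omega' R)
    (pi : Omega' -> Omega) (tau : Omega' -> 'I_T.+1) : Prop :=
  [/\ measurable_fun setT pi,
      forall w, (0 < tau w)%N,
      forall s, measurable [set w | tau w = s],
      forall A, measurable A -> P' (pi @^-1` A) = P A
    & forall A s, measurable A ->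
        P' (pi @^-1` A `&` [set w | tau w = s]) =
        (\int[P]_(w in A) out_prob g kappa (stop_alg eps (Y w)) s)%E].

End stopping.

(* Main.v *)
Require Import Defs.
From HB Require Import structures.
From mathcomp Require Import all_boot all_order all_algebra.
From mathcomp Require Import all_classical all_reals all_analysis.
From mathcomp Require Import measurable_realfun.
From mathcomp Require Import lra ring zify.
Set Implicit Arguments.
Unset Strict Implicit.
Unset Printing Implicit Defensive.
Import Order.TTheory GRing.Theory Num.Theory.
Import numFieldNormedType.Exports.
Local Open Scope classical_set_scope.
Local Open Scope ring_scope.

(** The value of stopping late is measured by a recursion on depth rather than on
    time.  Put [Z_1 = Z] and, for every [k], let [Z_(k+1) t] be [Z_k t] minus the
    conditional expectation, given the first [t] observations, of the pathwise
    maximum of [Z_k].  Three facts make this recursion solve optimal stopping.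

    Each step subtracts from the reward a conditional expectation of a random
    variable that does not depend on [t].  Its mean at a random time does not
    depend on the time, provided that the time does not look into the future.
    Hence two stopping rules have mean rewards that differ exactly as their means
    of [Z_k] do ([gap_mean_invariant], [nearly_optimal]).

    From the second step on, the values lie between -1 and 0.  At the last
    observation time the path is known, and the value increases in each step by
    minus the pathwise maximum; since it stays below 0 and the maxima are
    nondecreasing, the maximum after [K] steps is at least [- 1 / K]
    ([best_near0]).  Along every path there is therefore a time at which the value
    for [K >= 4 / eps] is at least [- eps / 4].

    So a rule that stops at a time of value at least [- 3 eps / 4], except with
    probability [eps / 4], loses at most [eps] against every stopping time.  The
    algorithm is such a rule, because its estimates of the values are accurate
    with high probability: Hoeffding's inequality controls the empirical means
    ([likely_sample_mean]), the median of repeated trials amplifies the confidence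
    ([likely_majority]), and the two combine along the recursion
    ([Balg_accurate], [expected_loss_le]).

    The comparison takes place on the space of paths.  A stopping rule enters
    through the weights [o t y] with which it stops at [t] along the path [y]; they
    depend on the first [t] columns of [y] only.  For a stopping time they are
    indicators, for the algorithm they are its output probabilities, and in both
    cases they determine the expected reward ([expected_reward_weights]) and make
    the time a randomized stopping time ([randomized_of_weights]).  The kernels are
    only known to disintegrate the law of the path, so that whatever is said about
    sampled paths holds almost surely; clipping the values to the intervals where
    they should lie makes them bounded and measurable functions everywhere.

    Expectations of program answers are integrals of functions whose
    measurability is not evident.  The accuracy analysis works with them as lower
    expectations, which are monotone and superadditive for arbitrary integrands
    ([expect_super], [expect_addc]).  Measurability matters only for the output
    law of the whole algorithm, which has to be integrated and to have mass 1
    ([regular], [sum_law]).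

    For the running time, one level of the recursion costs a constant times
    [T ^ 2 / e ^ 4] calls to the previous level at accuracy [e / 4]
    ([time_le_Balg]); multiplying over at most [4 / eps + 1] levels gives
    [time_le_decision]. *)

(** * Lower integrals *)

Section lower_integral.
Context {R : realType} {d : measure_display} {X : measurableType d}.
Variable mu : {measure set X -> \bar R}.
Local Open Scope ereal_scope.
Import HBNNSimple.

(** The integral of a nonnegative function, measurable or not, is the supremum of
    the integrals of the simple functions below it.  The rules of this section
    hold for that supremum; they are all that the accuracy analysis uses, which
    therefore never asks whether an event about a program is measurable. *)
Lemma lower_integral_mono (f1 f2 : X -> \bar R) :
  (forall x, 0 <= f1 x) -> (forall x, f1 x <= f2 x) ->
  \int[mu]_x f1 x <= \int[mu]_x f2 x.
Proof.
move=> f10 f12.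
have f20 x : 0 <= f2 x by exact: le_trans (f12 x).
rewrite !ge0_integralTE//; apply: ereal_sup_le => _ [h /= hf <-].
by exists h => //= x; exact: le_trans (f12 x).
Qed.

(** The sum of simple functions below [f1] and [f2] lies below [f1 + f2].  The
    converse inequality fails without measurability, but for constants it
    survives in [lower_integral_addc]. *)
Lemma lower_integral_super (f1 f2 : X -> \bar R) :
  (forall x, 0 <= f1 x) -> (forall x, 0 <= f2 x) ->
  \int[mu]_x f1 x + \int[mu]_x f2 x <= \int[mu]_x (f1 x + f2 x).
Proof.
move=> f10 f20.
have f120 x : 0 <= f1 x + f2 x by exact: adde_ge0.
set c := \int[mu]_x (f1 x + f2 x).
have [->|coo] := eqVneq c +oo; first by rewrite leey.
have c0 : 0 <= c by exact: integral_ge0.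
have cfin : c \is a fin_num by rewrite ge0_fin_numE// lt_neqAle coo leey.
have H (h1 h2 : {nnsfun X >-> R}) : (forall x, (h1 x)%:E <= f1 x) ->
    (forall x, (h2 x)%:E <= f2 x) ->
    sintegral mu h1 + sintegral mu h2 <= c.
  move=> hf1 hf2; rewrite -sintegralD /c ge0_integralTE//.
  apply: ereal_sup_ubound; exists (add_nnsfun h1 h2) => //= x.
  by rewrite EFinD leeD.
have afin : \int[mu]_x f1 x \is a fin_num.
  rewrite ge0_fin_numE ?integral_ge0//; apply: (@le_lt_trans _ _ c).
    by apply: lower_integral_mono => // x; rewrite leeDl.
  by rewrite -ge0_fin_numE.
rewrite addeC -leeBrDr// ge0_integralTE//.
apply: ge_ereal_sup => _ [h2 /= hf2 <-].
have h2fin : sintegral mu h2 \is a fin_num.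
  rewrite ge0_fin_numE ?sintegral_ge0//.
  apply: (@le_lt_trans _ _ c); last by rewrite -ge0_fin_numE.
  have /(_ f10) := H nnsfun0 h2 ^~ hf2.
  by apply: le_trans; rewrite leeDr ?sintegral_ge0.
rewrite leeBrDr// addeC -leeBrDr// (ge0_integralTE _ f10).
apply: ge_ereal_sup => _ [h1 /= hf1 <-].
by rewrite leeBrDr// H.
Qed.

(** A simple function [h] below [f + c] is at most [c] plus the simple function
    [max (h - c) 0], which lies below [f]. *)
Lemma lower_integral_addc (f : X -> \bar R) (c : R) :
  mu setT = 1 -> (0 <= c)%R -> (forall x, 0 <= f x) ->
  \int[mu]_x (f x + c%:E) <= \int[mu]_x f x + c%:E.
Proof.
move=> mu1 c0 f0.
have fc0 x : 0 <= f x + c%:E by rewrite adde_ge0.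
rewrite [leLHS]ge0_integralTE//; apply: ge_ereal_sup => _ [h /= hf <-].
pose phi x := (Num.max (h x - c) 0)%R.
have mphi : measurable_fun setT (EFin \o phi).
  apply/measurable_EFinP; apply: measurable_maxr => //.
  by apply: measurable_funB.
have phi0 x : 0 <= (phi x)%:E by rewrite lee_fin le_max lexx orbT.
have phif x : (phi x)%:E <= f x.
  rewrite /phi; case: (lerP (h x - c) 0) => [?|]; first by [].
  by move=> _; rewrite EFinB leeBlDr.
apply: (@le_trans _ _ (\int[mu]_x (phi x)%:E + c%:E)); last first.
  by apply: leeD => //; exact: lower_integral_mono.
have -> : c%:E = \int[mu]_(x in setT) (cst c%:E) x.
  by rewrite integral_cst//= mu1 mule1.
rewrite -ge0_integralD//= -integralT_nnsfun.
apply: lower_integral_mono => [x|x]; first by rewrite lee_fin.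
by rewrite -EFinD lee_fin -lerBlDr /phi le_max lexx.
Qed.

Lemma lower_integralZl (f : X -> \bar R) (c : R) :
  (0 <= c)%R -> (forall x, 0 <= f x) ->
  c%:E * \int[mu]_x f x <= \int[mu]_x (c%:E * f x).
Proof.
move=> c0 f0.
have cf0 x : 0 <= c%:E * f x by rewrite mule_ge0.
rewrite (ge0_integralTE _ f0) -ereal_supZl//; last first.
  apply/set0P; exists 0; exists nnsfun0 => //=.
  exact: sintegral0.
apply: ge_ereal_sup => _ [_ [h /= hf <-] <-].
rewrite ge0_integralTE// -sintegralrM.
apply: ereal_sup_ubound; exists (scale_nnsfun h c0) => //= x.
by rewrite EFinM; apply: lee_wpmul2l; [rewrite lee_fin|exact: hf].
Qed.

(** An almost sure bound only has to hold off a measurable null set [N], and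
    [c * 1_(~` N)] is a simple function below [f] of integral [c]. *)
Lemma lower_integral_ae_ge (f : X -> \bar R) (c : R) :
  mu setT = 1 -> (forall x, 0 <= f x) -> {ae mu, forall x, c%:E <= f x} ->
  c%:E <= \int[mu]_x f x.
Proof.
move=> mu1 f0 [N [mN N0 fN]].
have [c0|c0] := leP c 0%R.
  by apply: (@le_trans _ _ 0); [rewrite lee_fin|exact: integral_ge0].
have mNC : measurable (~` N) by exact: measurableC.
have muNC : mu (~` N) = 1.
  rewrite -setTD measureD//; last by rewrite [X in X < _]mu1 ltry.
  by rewrite setTI [X in _ - X]N0 sube0.
apply: (@le_trans _ _ (\int[mu]_x (c%:E * (\1_(~` N) x)%:E))).
  rewrite ge0_integralZl_EFin ?(ltW c0)//; last first.
    by apply/measurable_EFinP; exact: measurable_indic.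
  by rewrite integral_indic// setIT muNC mule1.
apply: lower_integral_mono => x; rewrite indicE.
  by rewrite mule_ge0// lee_fin ltW.
have [|_] := boolP (x \in ~` N); last by rewrite mule0.
rewrite inE mule1 => Nx; have [//|nl] := pselect (c%:E <= f x).
by exfalso; apply: Nx; exact: fN.
Qed.

End lower_integral.

(** * Lower expectations of programs *)

Section lower_expectation.
Context {R : realType} {T D : nat}.
Variables (g : forall t : 'I_T.+1, 'M[R]_(D, t) -> R)
  (kappa : forall t : 'I_T.+1, R.-pker 'M[R]_(D, t) ~> 'M[R]_(D, T)).
Local Open Scope ereal_scope.
Local Notation prog A := (@prog R T D A).
Local Notation expect := (expect g kappa).

Lemma expect_bind A B (p : prog A) (f : A -> prog B) h :
  expect (bind p f) h = expect p (fun a => expect (f a) h).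
Proof.
elim: p => //= t gamma k IH.
by apply: eq_integral => M _; exact: IH.
Qed.

Lemma expect_ge0 A (p : prog A) h : (forall a, 0 <= h a) -> 0 <= expect p h.
Proof.
move=> h0; elim: p => //= t gamma k IH.
by apply: integral_ge0 => M _; exact: IH.
Qed.

Lemma expect_mono A (p : prog A) h1 h2 :
  (forall a, 0 <= h1 a) -> (forall a, h1 a <= h2 a) ->
  expect p h1 <= expect p h2.
Proof.
move=> h10 h12; elim: p => //= t gamma k IH.
by apply: lower_integral_mono => [M|//]; exact: expect_ge0.
Qed.

(** Superadditivity stands in for linearity: an upper bound for the expectation of
    a sum, together with a lower bound for one term, bounds the other term. *)
Lemma expect_super A (p : prog A) h1 h2 :
  (forall a, 0 <= h1 a) -> (forall a, 0 <= h2 a) ->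
  expect p h1 + expect p h2 <= expect p (fun a => h1 a + h2 a).
Proof.
move=> h10 h20; elim: p => //= t gamma k IH.
apply: le_trans (lower_integral_super _ _ _) _ => [M|M|].
- exact: expect_ge0.
- exact: expect_ge0.
by apply: lower_integral_mono => // M; rewrite adde_ge0// expect_ge0.
Qed.

Lemma expect_addc A (p : prog A) h (c : R) : (0 <= c)%R ->
  (forall a, 0 <= h a) -> expect p (fun a => h a + c%:E) <= expect p h + c%:E.
Proof.
move=> c0 h0; elim: p => //= t gamma k IH.
apply: le_trans; last first.
  apply: lower_integral_addc => // [|M]; last exact: expect_ge0.
  exact: prob_kernel.
by apply: lower_integral_mono => // M; apply: expect_ge0 => a; rewrite adde_ge0.
Qed.

Lemma expectZl A (p : prog A) h (c : R) : (0 <= c)%R ->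
  (forall a, 0 <= h a) -> c%:E * expect p h <= expect p (fun a => c%:E * h a).
Proof.
move=> c0 h0; elim: p => //= t gamma k IH.
apply: le_trans (lower_integralZl _ _ _) _ => // [M|]; first exact: expect_ge0.
by apply: lower_integral_mono => // M; rewrite mule_ge0// expect_ge0.
Qed.

Lemma expect_cst A (p : prog A) (c : R) : expect p (fun=> c%:E) = c%:E.
Proof.
elim: p => //= t gamma k IH.
rewrite (eq_integral (cst c%:E)) => [|M _]; last by rewrite IH.
by rewrite integral_cst//= prob_kernel mule1.
Qed.

Lemma eq_expect A (p : prog A) h1 h2 : (forall a, h1 a = h2 a) ->
  expect p h1 = expect p h2.
Proof. by move=> h12; congr expect; exact/funext. Qed.

End lower_expectation.

(** * Confidence statements about programs *)

Section likely.
Context {R : realType} {T D : nat}.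
Variables (g : forall t : 'I_T.+1, 'M[R]_(D, t) -> R)
  (kappa : forall t : 'I_T.+1, R.-pker 'M[R]_(D, t) ~> 'M[R]_(D, T)).
Local Open Scope ereal_scope.
Local Notation prog A := (@prog R T D A).
Local Notation expect := (expect g kappa).

(** A lower bound on the lower probability of [S]; it makes sense for every set
    of answers. *)
Definition likely A (p : prog A) (S : set A) (eta : R) : Prop :=
  (1 - eta)%:E <= expect p (fun a => (\1_S a)%:E).

Lemma indic_EFin_ge0 A (S : set A) a : 0 <= ((\1_S a : R)%:E).
Proof. by rewrite lee_fin indicE. Qed.
Local Hint Resolve indic_EFin_ge0 : core.

Lemma likely_weaken A (p : prog A) (S S' : set A) (eta eta' : R) :
  likely p S eta -> S `<=` S' -> (eta <= eta')%R -> likely p S' eta'.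
Proof.
move=> pS SS' le_eta; apply: le_trans (le_trans pS _).
  by rewrite lee_fin lerB.
apply: expect_mono => // a; rewrite lee_fin !indicE ler_nat.
by case: (boolP (a \in S)) => //; rewrite inE => /SS' Sa; rewrite mem_set.
Qed.

Lemma likely_ret A (a : A) (S : set A) : S a -> likely (Ret a) S 0.
Proof. by move=> Sa; rewrite /likely/= indicE mem_set// subr0. Qed.

(** The union bound.  Its proof moves the constant [eta'] out of the expectation,
    the one kind of sum for which lower expectations are subadditive. *)
Lemma likely_bind A B (p : prog A) (f : A -> prog B) S S' (eta eta' : R) :
  (0 <= eta')%R -> likely p S eta -> (forall a, S a -> likely (f a) S' eta') ->
  likely (bind p f) S' (eta + eta').
Proof.
move=> eta'0 pS fS; rewrite /likely expect_bind opprD addrA EFinB leeBlDr//.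
apply: le_trans pS _; apply: le_trans (expect_addc _ _ _ eta'0 _).
  apply: expect_mono => // a; rewrite indicE.
  have [|_] := boolP (a \in S); last by rewrite adde_ge0 ?expect_ge0.
  by rewrite inE => /fS; rewrite /likely EFinB leeBlDr.
by move=> a; exact: expect_ge0.
Qed.

Lemma likely_foreach I A (s : seq I) (f : I -> prog A) (S : I -> A -> Prop)
    (eta : R) : (0 <= eta)%R -> (forall i, List.In i s -> likely (f i) (S i) eta) ->
  likely (foreach s f) [set l | List.Forall2 S s l] ((size s)%:R * eta).
Proof.
move=> eta0; elim: s => [|i s IH] fS.
  by rewrite mul0r; apply: likely_ret; constructor.
rewrite /= -natr1 mulrDl mul1r addrC.
apply: likely_bind (fS _ _) _ => [||a Sa]; [by rewrite mulr_ge0|by left|].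
rewrite -[X in likely _ _ X]addr0.
apply: likely_bind (IH _) _ => // [j sj|l Sl]; first by apply: fS; right.
by apply: likely_ret; constructor.
Qed.

(** A nonnegative weight [w] whose upper expectation under [p] is at most [W].
    Lower expectations are not additive, so the bound is stated in the only
    form in which it can be used afterwards, next to an arbitrary [h]. *)
Definition weight_le A (p : prog A) (w : A -> R) (W : R) : Prop :=
  forall (h : A -> \bar R) (c : R), (0 <= c)%R -> (forall a, 0 <= h a) ->
  expect p (fun a => h a + (c * w a)%:E) <= expect p h + (c * W)%:E.

(** The upper expectation of [w] is dual to the lower expectation of its
    complement [b - w]. *)
Lemma weight_le_dual A (p : prog A) (w : A -> R) (b W : R) :
  (0 <= b)%R -> (forall a, 0 <= w a <= b)%R ->
  (b - W)%:E <= expect p (fun a => (b - w a)%:E) -> weight_le p w W.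
Proof.
move=> b0 wb bW h c c0 h0.
have w0 a : (0 <= w a)%R by have /andP[] := wb a.
have bw0 a : (0 <= b - w a)%R by rewrite subr_ge0; have /andP[] := wb a.
have cw0 a : 0 <= h a + (c * w a)%:E by rewrite adde_ge0// lee_fin mulr_ge0.
have : expect p (fun a => h a + (c * w a)%:E) + (c * (b - W))%:E
    <= expect p h + (c * b)%:E.
  apply: le_trans (expect_addc _ _ _ (mulr_ge0 c0 b0) h0).
  apply: (@le_trans _ _ (expect p (fun a => h a + (c * w a)%:E) +
     expect p (fun a => c%:E * (b - w a)%:E))).
    have bwE a : 0 <= (b - w a)%:E by rewrite lee_fin.
    apply: leeD => //; apply: le_trans (expectZl g kappa p c0 bwE).
    by rewrite EFinM lee_wpmul2l// lee_fin.
  have cbw0 a : 0 <= c%:E * (b - w a)%:E by rewrite -EFinM lee_fin mulr_ge0.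
  apply: le_trans (expect_super g kappa p cw0 cbw0) _.
  apply: expect_mono => [a|a].
    by rewrite adde_ge0// -EFinM lee_fin mulr_ge0.
  by rewrite -addeA -EFinM -EFinD -mulrDr [(w a + _)%R]addrC subrK.
rewrite -leeBrDr// => /le_trans; apply.
by rewrite -addeA -EFinB -mulrBr opprB [(b + _)%R]addrC subrK.
Qed.

(** Independence of the rounds of a loop: weights multiply.  Applied to
    exponential weights, this is the product formula for moment generating
    functions. *)
Lemma weight_le_foreach I A (s : seq I) (p : prog A) (w : A -> R) (W : R) :
  (0 <= W)%R -> (forall a, 0 <= w a)%R -> weight_le p w W ->
  weight_le (foreach s (fun=> p)) (fun l => \prod_(a <- l) w a)%R
    (W ^+ size s).
Proof.
move=> W0 w0 pw; elim: s => [|i s IH] h c c0 h0.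
  by rewrite /= big_nil expr0.
rewrite /= !expect_bind.
under eq_expect do rewrite expect_bind/=.
under [in leRHS]eq_expect do rewrite expect_bind/=.
apply: (@le_trans _ _ (expect p (fun a =>
   expect (foreach s (fun=> p)) (fun l => h (a :: l)) +
     (c * W ^+ size s * w a)%:E))).
  apply: expect_mono => a.
    apply: expect_ge0 => l; rewrite adde_ge0// lee_fin mulr_ge0// prodr_ge0//.
  have cwa : (0 <= c * w a)%R by rewrite mulr_ge0.
  rewrite [(c * _ * _)%R]mulrAC; apply: le_trans (IH _ _ cwa _) => //.
  by under eq_expect => l do rewrite big_cons mulrA.
apply: le_trans (pw _ _ _ _) _ => [|a|].
- by rewrite mulr_ge0// exprn_ge0.
- exact: expect_ge0.
by rewrite -mulrA -exprSr.
Qed.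

(** A law-preserving change of the loop body; with [phi] forgetting a
    component it lets the analysis keep quantities that the program drops. *)
Lemma expect_foreach_map I A B (s : seq I) (p : I -> prog A) (q : I -> prog B)
    (phi : B -> A) h :
  (forall i h, expect (p i) h = expect (q i) (fun b => h (phi b))) ->
  expect (foreach s p) h = expect (foreach s q) (fun l => h (map phi l)).
Proof.
move=> pq; elim: s h => [//|i s IH] h /=.
rewrite !expect_bind pq; apply: eq_expect => b.
by rewrite !expect_bind IH.
Qed.

(** Chernoff's bound for the number of failures among independent trials that
    each fail with probability at most 1/4, for the threshold one half. *)
Lemma likely_majority I A (s : seq I) (p : prog A) (S : set A) :
  likely p S (1 / 4) ->
  likely (foreach s (fun=> p))
    [set l | ((count (fun a => a \notin S) l).*2 < size s)%N /\ size l = size s]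
    ((97 / 112) ^+ size s).
Proof.
move=> pS.
(* The weight is 1 on success and lambda ^ 2 on failure, with lambda = 7/4 close
   to the optimal sqrt 3; its mean is at most 1 + (lambda ^ 2 - 1) / 4 = 97/64.
   With at least half of the rounds failing, the product of the weights is at
   least lambda ^ size s, and (97/64) / (7/4) = 97/112. *)
pose w a : R := (if a \in S then 1 else (7 / 4) ^+ 2)%R.
have w0 a : (0 <= w a)%R by rewrite /w; case: ifP => _; lra.
have wW : weight_le p w (97 / 64).
  apply: (@weight_le_dual _ _ _ ((7 / 4) ^+ 2)); first by lra.
    by move=> a; rewrite w0 /w; case: ifP => _; lra.
  apply: (@le_trans _ _ (((7 / 4) ^+ 2 - 1)%:E * (1 - 1 / 4)%:E)).
    by rewrite -EFinM lee_fin; lra.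
  apply: (@le_trans _ _ (((7 / 4) ^+ 2 - 1)%:E
      * expect p (fun a => (\1_S a)%:E))).
    by rewrite lee_wpmul2l// lee_fin; lra.
  have r0 : (0 <= (7 / 4) ^+ 2 - 1 :> R)%R by lra.
  apply: le_trans (expectZl g kappa p r0 (indic_EFin_ge0 S)) _.
  apply: expect_mono => a; first by rewrite mule_ge0// lee_fin.
  by rewrite -EFinM lee_fin indicE /w; case: ifP => _ /=; lra.
rewrite /likely; set Q := [set l | _].
pose c : R := ((7 / 4) ^- size s)%R.
have c0 : (0 <= c)%R by rewrite invr_ge0 exprn_ge0//; lra.
have W0 : (0 <= 97 / 64 :> R)%R by lra.
rewrite EFinB leeBlDr//.
have := weight_le_foreach s W0 w0 wW (h := fun l => (\1_Q l)%:E) c0.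
have -> : (c * (97 / 64) ^+ size s = (97 / 112) ^+ size s)%R.
  rewrite /c -exprVn -exprMn; congr (_ ^+ _)%R; lra.
move=> H; apply: le_trans (H _) => //.
(* The loop produces lists of the size of s, so that h' has to dominate h on
   these lists only. *)
have sz (h h' : seq A -> \bar R) : (forall l, 0 <= h l) ->
    (forall l, size l = size s -> h l <= h' l) -> (forall l, 0 <= h' l) ->
    expect (foreach s (fun=> p)) h <= expect (foreach s (fun=> p)) h'.
  clear; elim: s h h' => [|i s IH] h h' h0 hh' h'0 /=; first exact: hh'.
  rewrite !expect_bind; apply: expect_mono => [a|a]; first exact: expect_ge0.
  rewrite !expect_bind; apply: IH => //= l sl.
  by apply: hh'; rewrite /= sl.
rewrite -(expect_cst g kappa (foreach s (fun=> p)) 1%R).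
apply: sz => // l.
  move=> sl; have [Ql|nQl] := pselect (Q l).
    rewrite indicE mem_set// leeDl// lee_fin mulr_ge0//.
    by rewrite prodr_ge0.
  rewrite indicE memNset// add0e lee_fin.
  have -> : (\prod_(a <- l) w a = (7 / 4) ^+ ((count (fun a => a \notin S) l).*2))%R.
    elim: l {sl nQl} => [|a l IH]; first by rewrite big_nil.
    rewrite big_cons IH /w /= doubleD exprD.
    by case: (a \in S).
  rewrite /c -[leLHS](@mulVf _ ((7 / 4) ^+ size s)%R) ?expf_neq0//.
  rewrite ler_wpM2l// ler_weXn2l//; first by lra.
  by rewrite leqNgt; apply: contra_notN nQl.
by rewrite adde_ge0// lee_fin mulr_ge0// prodr_ge0.
Qed.

End likely.

(** * Deterministic steps of the programs *)

Section deterministic.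
Context {R : realType}.

Definition maxl (s : seq R) : R := foldl Num.max (head 0 s) (behead s).

Lemma foldl_max_ge (x : R) s y : (y == x) || (y \in s) ->
  y <= foldl Num.max x s.
Proof.
elim: s x y => [|z s IH] x y /=; first by rewrite orbF => /eqP ->.
have xz : Num.max x z <= foldl Num.max (Num.max x z) s by rewrite IH// eqxx.
rewrite inE => /or3P[/eqP ->|/eqP ->|ys].
- by apply: le_trans xz; rewrite le_max lexx.
- by apply: le_trans xz; rewrite le_max lexx orbT.
- by apply: IH; rewrite ys orbT.
Qed.

Lemma foldl_max_mem (x : R) s : foldl Num.max x s \in x :: s.
Proof.
elim: s x => [|z s IH] x /=; first by rewrite inE.
have := IH (Num.max x z); rewrite !inE => /orP[/eqP ->|->]; last by rewrite !orbT.
by rewrite /Num.max; case: ifP; rewrite eqxx ?orbT.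
Qed.

Lemma maxl_ge s y : y \in s -> y <= maxl s.
Proof. by case: s => //= x s; rewrite inE => ys; exact: foldl_max_ge. Qed.

Lemma maxl_mem s : (0 < size s)%N -> maxl s \in s.
Proof. by case: s => //= x s _; exact: foldl_max_mem. Qed.

Lemma maxl_map_ge (I : eqType) (f : I -> R) s i : i \in s ->
  f i <= maxl (map f s).
Proof. by move=> si; apply: maxl_ge; exact: map_f. Qed.

Lemma maxl_map_ex (I : eqType) (f : I -> R) s : (0 < size s)%N ->
  exists2 i, i \in s & maxl (map f s) = f i.
Proof. by move=> s0; apply/mapP/maxl_mem; rewrite size_map. Qed.

Lemma Forall2_size A B (P : A -> B -> Prop) s l :
  List.Forall2 P s l -> size s = size l.
Proof. by elim=> //= a b s' l' _ _ ->. Qed.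

Lemma In_mem (I : eqType) (i : I) s : List.In i s -> i \in s.
Proof.
by elim: s => //= j s IH [->|/IH si]; rewrite inE ?eqxx// si orbT.
Qed.

Lemma maxl_close I (f : I -> R) (e : R) s l : (0 < size s)%N ->
  List.Forall2 (fun i a => `|a - f i| <= e) s l ->
  `|maxl l - maxl (map f s)| <= e.
Proof.
move=> + sl; case: {s l}sl => // i a s l ia sl _; rewrite /maxl/=.
move: ia; set x := f i; move: {i} x a.
elim: sl => [//|j b s' l' jb _ IH] x a ia /=; apply: IH.
move: ia jb; rewrite /Num.max !ler_norml.
by case: ifP => ?; case: ifP => ? /andP[? ?] /andP[? ?]; apply/andP; split; lra.
Qed.

(** If the entry of rank n/2 were above [z + e], then so would be the whole upper
    half of the list, and half of the entries would be far from [z]; likewise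
    below. *)
Lemma median_close (l : seq R) (z e : R) :
  ((count (fun a => ~~ (`|a - z| <= e)%R) l).*2 < size l)%N ->
  `|median_val l - z| <= e.
Proof.
set bad := (X in count X); rewrite /median_val; set x := sort _ _ => cl.
have sx : size x = size l by rewrite size_sort.
have cx : count bad x = count bad l by apply/permP; rewrite /x perm_sort.
have ltx := sort_le_sorted l; rewrite -/x in ltx.
have mono i j : (i <= j < size x)%N -> x`_i <= x`_j.
  move=> /andP[ij jx].
  apply: (sorted_leq_nth le_trans le_refl 0 ltx) => //; rewrite inE//.
  exact: leq_ltn_trans jx.
have n0 : (0 < size l)%N by exact: leq_ltn_trans cl.
set n := size l in sx cl n0 *.
have oddn := odd_double_half n.
have up : x`_(n./2) <= z + e.
  rewrite leNgt; apply/negP => xz.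
  have : (size (drop n./2 x) <= count bad x)%N.
    rewrite -[x in count _ x](cat_take_drop n./2) count_cat.
    apply: leq_trans (leq_addl _ _).
    suff /eqP -> : count bad (drop n./2 x) == size (drop n./2 x) by [].
    rewrite -all_count; apply/(all_nthP 0) => k.
    rewrite size_drop => kn; rewrite nth_drop /bad.
    have /mono : (n./2 <= n./2 + k < size x)%N by rewrite leq_addr -ltn_subRL.
    by rewrite ler_norml => xk; apply/negP => /andP[_ ak]; clear -xz xk ak; lra.
  by rewrite cx size_drop sx; lia.
have low : z - e <= x`_((n.+1)./2.-1).
  rewrite leNgt; apply/negP => xz.
  have : (size (take (n.+1)./2 x) <= count bad x)%N.
    rewrite -[x in count _ x](cat_take_drop (n.+1)./2) count_cat.
    apply: leq_trans (leq_addr _ _).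
    suff /eqP -> : count bad (take n.+1./2 x) == size (take n.+1./2 x) by [].
    rewrite -all_count; apply/(all_nthP 0) => k.
    rewrite size_take_min => kn; rewrite nth_take; last by lia.
    have /mono : (k <= (n.+1)./2.-1 < size x)%N by lia.
    by rewrite /bad ler_norml => xk; apply/negP => /andP[ak _]; clear -xz xk ak; lra.
  by rewrite cx size_take_min sx; lia.
have mid : x`_((n.+1)./2.-1) <= x`_(n./2) by apply: mono; lia.
by rewrite ler_norml; clear -up low mid; apply/andP; split; lra.
Qed.

Lemma ceil_val_ge (x : R) : x <= (ceil_val x)%:R.
Proof.
rewrite /ceil_val; have := ceil_ge x; case: (Num.ceil x) => n //=.
by rewrite NegzE => /le_trans; apply; rewrite mulrNz oppr_le0.
Qed.

Lemma ceil_val_lt (x : R) : 0 <= x -> (ceil_val x)%:R < x + 1.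
Proof.
move=> x0; rewrite /ceil_val; have := ceilB1_lt x.
have : 0 <= Num.ceil x by rewrite ceil_ge0// (lt_le_trans _ x0) ?ltrN10.
by case: (Num.ceil x) => n //= _; rewrite intrB ltrBlDr.
Qed.

Lemma ceil_val_gt0 (x : R) : 0 < x -> (0 < ceil_val x)%N.
Proof. by move=> x0; rewrite -(ltr_nat R) (lt_le_trans x0)// ceil_val_ge. Qed.

End deterministic.

Section deterministic_programs.
Context {R : realType} {T D : nat}.
Variables (g : forall t : 'I_T.+1, 'M[R]_(D, t) -> R)
  (kappa : forall t : 'I_T.+1, R.-pker 'M[R]_(D, t) ~> 'M[R]_(D, T)).

Lemma expect_fold_arith o x (s : seq R) h :
  expect g kappa (fold_arith o x s) h = h (foldl (arith_val o) x s).
Proof. by elim: s x => //= y s IH x; rewrite expect_bind IH. Qed.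

Lemma expect_maxp (s : seq R) h : expect g kappa (maxp s) h = h (maxl s).
Proof. exact: expect_fold_arith. Qed.

Lemma expect_sump (s : seq R) h :
  expect g kappa (sump s) h = h (\sum_(x <- s) x).
Proof.
rewrite expect_fold_arith; case: s => [|x s]; first by rewrite big_nil.
congr h; rewrite big_cons /=; elim: s x => [|y s IH] x /=.
  by rewrite big_nil addr0.
by rewrite IH big_cons addrA.
Qed.

End deterministic_programs.

(** * Hoeffding's lemma *)

Section hoeffding.
Context {R : realType}.

Lemma le0_of_derive (f df : R -> R) :
  (forall x : R, is_derive x 1 f (df x)) -> (forall x, 0 <= x -> 0 <= df x) ->
  forall x, 0 <= x -> f 0 <= f x.
Proof.
move=> fdf df0 x; rewrite le_eqVlt => /predU1P[<-//|x0].
have cf : {within `[0, x], continuous f}.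
  apply: continuous_subspaceT => y.
  apply/differentiable_continuous/derivable1_diffP.
  exact: (@ex_derive _ _ _ _ _ _ _ (fdf y)).
have [c] := @MVT R f df 0 x x0 (fun y _ => fdf y) cf.
rewrite in_itv/= => /andP[c0 _] fE.
by rewrite -subr_ge0 fE subr0 mulr_ge0 ?df0// ltW.
Qed.

(** The difference of the logarithms of the two sides vanishes to second order
    at 0, and its second derivative is [1/4 - u (1 - u)] for
    [u = p e^s / (1 - p + p e^s)]. *)
Lemma bernoulli_mgf_le (p s : R) : 0 <= p <= 1 -> 0 <= s ->
  1 - p + p * expR s <= expR (p * s + s ^+ 2 / 8).
Proof.
move=> /andP[p0 p1] s0; pose phi x : R := 1 - p + p * expR x.
have phi_gt0 x : 0 < phi x.
  have ex := expR_gt0 x; rewrite /phi; have [->|pn0] := eqVneq p 0; first lra.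
  have : 0 < p * expR x by rewrite mulr_gt0// lt0r pn0.
  lra.
have phi_neq0 x : phi x != 0 by rewrite gt_eqF.
have dphi (x : R) : is_derive x 1 phi (p * expR x).
  have -> : phi = cst (1 - p) + p \*: expR by apply/funext => y.
  by apply: is_derive_eq; rewrite add0r.
pose f1 x : R := p + x / 4 - 1 + (1 - p) / phi x.
pose f1' x : R := 4^-1 - (1 - p) * (p * expR x) / phi x ^+ 2.
have df1 (x : R) : is_derive x 1 f1 (f1' x).
  pose h y : R := (phi y)^-1.
  have dh : is_derive x 1 h (- (phi x) ^- 2 *: (p * expR x)) by exact: is_deriveV.
  have -> : f1 = (cst (p - 1) + 4^-1 \*: id) + (1 - p) \*: h.
    by apply/funext => y; rewrite /f1 /h !fctE /= /GRing.scale/=; ring.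
  apply: is_derive_eq.
  by rewrite /f1' add0r /GRing.scale/=; field.
have f1'0 x : 0 <= f1' x.
  rewrite /f1' subr_ge0 ler_pdivrMr ?exprn_gt0// /phi.
  rewrite -subr_ge0; set e := expR x.
  have -> : 4^-1 * (1 - p + p * e) ^+ 2 - (1 - p) * (p * e)
    = 4^-1 * (1 - p - p * e) ^+ 2 by field.
  by rewrite mulr_ge0 ?sqr_ge0.
have f10 x : 0 <= x -> 0 <= f1 x.
  move=> x0; have := le0_of_derive df1 (fun y _ => f1'0 y) x0.
  rewrite {1}/f1 /phi expR0 mulr1 subrK divr1 mul0r addr0 => H.
  by apply: le_trans H; lra.
pose f x : R := p * x + x ^+ 2 / 8 - ln (phi x).
have df (x : R) : is_derive x 1 f (f1 x).
  have dln : is_derive x 1 (@ln R \o phi) ((phi x)^-1 * (p * expR x)).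
    by apply: is_derive1_comp; exact: is_derive1_ln.
  have -> : f = (p \*: id + 8^-1 \*: id ^+ 2) - (@ln R \o phi).
    by apply/funext => y; rewrite /f !fctE /= /GRing.scale/= mulrC; ring.
  have eE : p * expR x = phi x - (1 - p) by rewrite /phi; ring.
  apply: is_derive_eq; rewrite /f1 /GRing.scale/= eE.
  by have phix := phi_neq0 x; field.
have := le0_of_derive df f10 s0.
rewrite {1}/f /phi expR0 mulr1 subrK ln1 expr0n/= mulr0 mul0r addr0 subr0.
by rewrite /f subr_ge0 -ler_expR lnK ?posrE ?phi_gt0.
Qed.

Context {d : measure_display} {X : measurableType d}.
Variable nu : {measure set X -> \bar R}.
Hypothesis nu1 : nu setT = 1%E.

Lemma mean_bounds (f : X -> R) (a m : R) : (forall x, a <= f x <= a + 1) ->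
  (\int[nu]_x (f x - a)%:E = (m - a)%:E)%E -> a <= m <= a + 1.
Proof.
move=> fa fm; have fa0 x : (0 <= (f x - a)%:E)%E.
  by rewrite lee_fin subr_ge0; have /andP[] := fa x.
have a0 : 0 <= m - a by rewrite -lee_fin -fm; exact: integral_ge0.
have : m - a <= 1.
  rewrite -lee_fin -fm -nu1 -[leRHS]mul1e -(integral_cst nu measurableT 1%E).
  apply: lower_integral_mono => // x; rewrite lee_fin.
  by have /andP[? ?] := fa x; lra.
by move=> ?; apply/andP; split; lra.
Qed.

(** A value in [[a, a + 1]] is a convex combination of the two end points, and
    the exponential is convex: the worst case is a Bernoulli variable. *)
Lemma hoeffding_mgf_le (f : X -> R) (a m s : R) :
  measurable_fun setT f -> (forall x, a <= f x <= a + 1) ->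
  (\int[nu]_x (f x - a)%:E = (m - a)%:E)%E -> 0 <= s ->
  (\int[nu]_x (expR (s * (f x - m)))%:E <= (expR (s ^+ 2 / 8))%:E)%E.
Proof.
move=> mf fa fm s0; pose u x := f x - a.
have u01 x : 0 <= u x <= 1.
  by have /andP[? ?] := fa x; rewrite /u; apply/andP; split; lra.
have mu : measurable_fun setT u by exact: measurable_funB.
pose p := m - a.
have /andP[am ma] := mean_bounds fa fm.
have p01 : 0 <= p <= 1 by rewrite /p; apply/andP; split; lra.
have es : 0 <= expR s - 1 by rewrite subr_ge0 -expR0 ler_expR.
have chord x : expR (s * (f x - m)) <=
    expR (- (s * p)) * ((expR s - 1) * u x + 1).
  have -> : s * (f x - m) = - (s * p) + u x * s by rewrite /p /u; ring.
  rewrite expRD ler_wpM2l ?expR_ge0//.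
  have /andP[ux0 ux1] := u01 x.
  have := @convex_expR R (Itv01 ux0 ux1) s 0.
  rewrite !convRE/= expR0 mulr0 addr0 => /le_trans; apply.
  by rewrite /= ?mulr1 /unstable.onem; lra.
have -> : s ^+ 2 / 8 = - (s * p) + (p * s + s ^+ 2 / 8) by ring.
have cu0 x : 0 <= (expR s - 1) * u x.
  by rewrite mulr_ge0//; have /andP[] := u01 x.
have mcu : measurable_fun setT (fun x => (((expR s - 1) * u x)%:E)%E).
  by apply/measurable_EFinP; exact: measurable_funM.
apply: (@le_trans _ _ (\int[nu]_x
    ((expR (- (s * p)))%:E * ((expR s - 1) * u x + 1)%:E))%E).
  by apply: lower_integral_mono => x;
    rewrite -?EFinM lee_fin ?expR_ge0//; exact: chord.
rewrite ge0_integralZl_EFin ?expR_ge0//; last 2 first.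
  by move=> x _; rewrite lee_fin addr_ge0.
  by apply/measurable_EFinP; apply: measurable_funD => //; exact: measurable_funM.
rewrite expRD EFinM lee_wpmul2l ?lee_fin ?expR_ge0//.
under eq_integral => x _ do rewrite EFinD.
have cu0E x : (0 <= ((expR s - 1) * u x)%:E)%E by rewrite lee_fin.
apply: le_trans (lower_integral_addc nu1 ler01 cu0E) _.
under eq_integral => x _ do rewrite EFinM.
rewrite ge0_integralZl_EFin//; last 2 first.
  by move=> x _; rewrite lee_fin; have /andP[] := u01 x.
  exact/measurable_EFinP.
rewrite fm -EFinM -EFinD lee_fin.
by apply: le_trans (bernoulli_mgf_le p01 s0); rewrite -/p; lra.
Qed.

(** The lower tail is the upper tail of [- f], whose values lie in the unit
    interval that starts at [- (a + 1)]. *)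
Lemma hoeffding_mgfN_le (f : X -> R) (a m s : R) :
  measurable_fun setT f -> (forall x, a <= f x <= a + 1) ->
  (\int[nu]_x (f x - a)%:E = (m - a)%:E)%E -> 0 <= s ->
  (\int[nu]_x (expR (- s * (f x - m)))%:E <= (expR (s ^+ 2 / 8))%:E)%E.
Proof.
move=> mf fa fm s0.
under eq_integral => x _.
  have -> : - s * (f x - m) = s * (- f x - - m) by ring.
  over.
apply: (@hoeffding_mgf_le (fun x => - f x) (- (a + 1))) => //.
- exact: measurableT_comp.
- by move=> x; have /andP[? ?] := fa x; apply/andP; split; lra.
have: (\int[nu]_x (f x - a)%:E + \int[nu]_x (- f x - - (a + 1))%:E = 1)%E.
  rewrite -ge0_integralD//=; last 4 first.
  - by move=> x _; rewrite lee_fin; have /andP[? ?] := fa x; lra.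
  - by apply/measurable_EFinP; exact: measurable_funB.
  - by move=> x _; rewrite lee_fin; have /andP[? ?] := fa x; lra.
  - by apply/measurable_EFinP; apply: measurable_funB => //;
      exact: measurableT_comp.
  rewrite (eq_integral (cst 1%E)) => [|x _]; last first.
    by rewrite -EFinD; congr EFin => /=; ring.
  by rewrite integral_cst//= mul1e nu1.
rewrite fm; set I := (\int[nu]_x _)%E.
case: I => [r| |] //=.
by rewrite -EFinD => -[rE]; congr EFin; lra.
Qed.

End hoeffding.

(** * Measurability of matrix-valued functions *)

Section matrix_measurability.
Context {R : realType}.

Lemma measurable_mxcoord m n (i : 'I_m) (j : 'I_n) :
  measurable_fun setT (fun M : 'M[R]_(m, n) => M i j).
Proof.
move=> _ B mB; rewrite setTI; apply: sub_sigma_algebra.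
by exists (i, j) => //; exists B => //; rewrite setTI.
Qed.

Lemma measurable_mxP d (X : measurableType d) m n (f : X -> 'M[R]_(m, n)) :
  (forall i j, measurable_fun setT (fun x => f x i j)) -> measurable_fun setT f.
Proof.
move=> mf; apply: measurability => // _ [_ [[i j] _ [B mB <-]] <-].
by rewrite !setTI; have := mf i j measurableT B mB; rewrite setTI.
Qed.

Lemma measurable_colsub m n p (s : 'I_p -> 'I_n) :
  measurable_fun setT (fun M : 'M[R]_(m, n) => colsub s M).
Proof.
apply: measurable_mxP => i j; under eq_fun do rewrite mxE.
exact: measurable_mxcoord.
Qed.

Lemma measurable_first_cols T D (t : 'I_T.+1) :
  measurable_fun setT (@first_cols R T D t).
Proof. exact: measurable_colsub. Qed.

Lemma measurable_last_cols T D (t : 'I_T.+1) :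
  measurable_fun setT (@last_cols R T D t).
Proof. exact: measurable_colsub. Qed.

Lemma first_cols_le T D (r t : 'I_T.+1) (y y' : 'M[R]_(D, T)) : (r <= t)%N ->
  first_cols t y = first_cols t y' -> first_cols r y = first_cols r y'.
Proof.
move=> rt yy'; apply/matrixP => i j; have := congr1 (fun M : 'M[R]_(D, t) =>
  M i (widen_ord rt j)) yy'; rewrite !mxE.
by have -> : widen_ord (leq_ord t) (widen_ord rt j) = widen_ord (leq_ord r) j
  by exact: val_inj.
Qed.

(** A measurable section of [first_cols t]: it turns a function of the path that
    only depends on the first [t] columns into a function of these columns. *)
Definition pad T D (t : 'I_T.+1) (gamma : 'M[R]_(D, t)) : 'M[R]_(D, T) :=
  \matrix_(i, j) if insub (j : nat) is Some k then gamma i k else 0.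

Lemma first_cols_pad T D (t : 'I_T.+1) (gamma : 'M[R]_(D, t)) :
  first_cols t (pad gamma) = gamma.
Proof.
apply/matrixP => i j; rewrite !mxE /=.
by case: insubP => [k _ kj|]; [congr (gamma i _); exact: val_inj|rewrite ltn_ord].
Qed.

Lemma measurable_pad T D (t : 'I_T.+1) :
  measurable_fun setT (@pad T D t).
Proof.
apply: measurable_mxP => i j; under eq_fun do rewrite mxE.
by case: insubP => [k _ _|_]; [exact: measurable_mxcoord|exact: measurable_cst].
Qed.

Lemma measurable_maxl d (X : measurableType d) (I : eqType) (s : seq I)
    (f : I -> X -> R) : (forall i, i \in s -> measurable_fun setT (f i)) ->
  measurable_fun setT (fun x => maxl [seq f i x | i <- s]).
Proof.
case: s => [_|i s mf]; first by rewrite /maxl/=; exact: measurable_cst.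
rewrite /maxl/=.
have : measurable_fun setT (f i) by apply: mf; rewrite inE eqxx.
have {mf} : forall j, j \in s -> measurable_fun setT (f j).
  by move=> j sj; apply: mf; rewrite inE sj orbT.
move: (f i); elim: s => [//|j s IH] h mf mh /=.
apply: (IH (fun x => Num.max (h x) (f j x))) => [k ks|].
  by apply: mf; rewrite inE ks orbT.
by apply: measurable_maxr => //; apply: mf; rewrite inE eqxx.
Qed.

End matrix_measurability.

(** * Clipped values *)

Section values.
Context {R : realType} {T D : nat}.
Hypothesis T_gt0 : (0 < T)%N.
Variables (g : forall t : 'I_T.+1, 'M[R]_(D, t) -> R)
  (kappa : forall t : 'I_T.+1, R.-pker 'M[R]_(D, t) ~> 'M[R]_(D, T)).
Hypothesis g_meas : forall t : 'I_T.+1, (0 < t)%N -> measurable_fun setT (@g t).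

Definition clip (a b x : R) : R := Num.max a (Num.min b x).

Lemma clip_id a b x : a <= x <= b -> clip a b x = x.
Proof. by case/andP=> ax xb; rewrite /clip min_r// max_r. Qed.

Lemma clip_bounds a b x : a <= b -> a <= clip a b x <= b.
Proof.
by move=> ab; rewrite /clip le_max lexx ge_max ab/= ge_min lexx.
Qed.

(** [value k t gamma] is the quantity that the [k]-th recursive algorithm
    estimates: the reward for [k = 0], and after that the previous value minus
    the conditional expectation of its pathwise maximum.  Clipping changes it
    only on a null set of [gamma] and makes it bounded, hence integrable,
    everywhere; adding 1 keeps the integrand nonnegative. *)
Fixpoint value (k : nat) (t : 'I_T.+1) (gamma : 'M[R]_(D, t)) : R :=
  match k with
  | 0 => clip 0 1 (g gamma)
  | k'.+1 => clip (-1) 0 (value k' gamma - (fine (\int[kappa t gamma]_M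
      (maxl [seq value k' (first_cols j M) | j <- @times T] + 1)%:E) - 1))
  end.

Definition best k (M : 'M[R]_(D, T)) : R :=
  maxl [seq value k (first_cols j M) | j <- @times T].

Definition mean_best k (t : 'I_T.+1) (gamma : 'M[R]_(D, t)) : R :=
  fine (\int[kappa t gamma]_M (best k M + 1)%:E) - 1.

Lemma mem_times (t : 'I_T.+1) : (t \in @times T) = (0 < t)%N.
Proof. by rewrite mem_filter mem_enum andbT. Qed.

Lemma timesE : @times T = [seq lift ord0 i | i <- enum 'I_T].
Proof.
rewrite /times enum_ordSl /= filter_map; congr map.
by apply/all_filterP/allP.
Qed.

Lemma size_times : size (@times T) = T.
Proof. by rewrite timesE size_map size_enum_ord. Qed.

Definition floor_value (k : nat) : R := if k is 0 then 0 else -1.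

Lemma value_bounds k (t : 'I_T.+1) (gamma : 'M[R]_(D, t)) :
  floor_value k <= value k gamma <= floor_value k + 1.
Proof.
case: k => [|k] /=; first by rewrite add0r clip_bounds.
by rewrite addNr clip_bounds// lerN10.
Qed.

Lemma best_bounds k M : floor_value k <= best k M <= floor_value k + 1.
Proof.
have [|j _] := @maxl_map_ex _ _ (fun j => value k (first_cols j M)) (@times T).
  by rewrite size_times.
by rewrite -/(best k M) => ->; exact: value_bounds.
Qed.

Lemma best_ge k (t : 'I_T.+1) M : (0 < t)%N ->
  value k (first_cols t M) <= best k M.
Proof.
by move=> t0; apply: (maxl_map_ge (fun j => value k (first_cols j M)));
  rewrite mem_times.
Qed.

Lemma best_ex k M : exists2 t : 'I_T.+1, (0 < t)%N &
  best k M = value k (first_cols t M).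
Proof.
have [|j] := @maxl_map_ex _ _ (fun j => value k (first_cols j M)) (@times T).
  by rewrite size_times.
by rewrite mem_times => j0 bE; exists j.
Qed.

Lemma measurable_clip d (X : measurableType d) a b (f : X -> R) :
  measurable_fun setT f -> measurable_fun setT (fun x => clip a b (f x)).
Proof.
by move=> mf; apply: measurable_maxr => //; apply: measurable_minr.
Qed.

Lemma measurable_best_of k :
  (forall t : 'I_T.+1, (0 < t)%N -> measurable_fun setT (@value k t)) ->
  measurable_fun setT (best k).
Proof.
move=> mv; apply: (measurable_maxl (f := fun j M => value k (first_cols j M))).
move=> j; rewrite mem_times => /mv mvj.
by have := measurableT_comp mvj (@measurable_first_cols R T D j); apply.
Qed.

Lemma best1_ge0 k M : 0 <= best k M + 1.
Proof.
have /andP[+ _] := best_bounds k M; rewrite -lerBlDr sub0r; apply: le_trans.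
by case: k => //=; rewrite lerN10.
Qed.

Lemma measurable_mean_best_of k (t : 'I_T.+1) :
  measurable_fun setT (best k) -> measurable_fun setT (@mean_best k t).
Proof.
move=> mb; apply: measurable_funB => //.
apply: (measurableT_comp (fine_measurable measurableT)).
apply: (measurable_fun_integral_kernel (measurable_kernel (kappa t))).
  by move=> M; rewrite lee_fin best1_ge0.
by apply/measurable_EFinP; apply: measurable_funD.
Qed.

Lemma measurable_value k (t : 'I_T.+1) : (0 < t)%N ->
  measurable_fun setT (@value k t).
Proof.
elim: k t => [|k IH] t t0 /=; first by apply: measurable_clip; exact: g_meas.
apply: measurable_clip; apply: measurable_funB; first exact: IH.
by apply: measurable_mean_best_of; exact: measurable_best_of.
Qed.

Lemma measurable_best k : measurable_fun setT (best k).
Proof. by apply: measurable_best_of => t; exact: measurable_value. Qed.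

Lemma measurable_mean_best k (t : 'I_T.+1) : measurable_fun setT (@mean_best k t).
Proof. by apply: measurable_mean_best_of; exact: measurable_best. Qed.

Lemma valueS k (t : 'I_T.+1) (gamma : 'M[R]_(D, t)) :
  value k.+1 gamma = clip (-1) 0 (value k gamma - mean_best k gamma).
Proof. by []. Qed.

Lemma mean_bestE k (t : 'I_T.+1) (gamma : 'M[R]_(D, t)) :
  (\int[kappa t gamma]_M (best k M + 1)%:E = (mean_best k gamma + 1)%:E)%E.
Proof.
rewrite /mean_best subrK fineK// ge0_fin_numE; last first.
  by apply: integral_ge0 => M _; rewrite lee_fin best1_ge0.
apply: (@le_lt_trans _ _ (\int[kappa t gamma]_M (cst 2%:E M))%E).
  apply: lower_integral_mono => M; rewrite lee_fin ?best1_ge0//=.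
  have /andP[_] := best_bounds k M; case: k => [|k] /=; lra.
by rewrite integral_cst//= prob_kernel mule1 ltry.
Qed.

Lemma mean_best_floorE k (t : 'I_T.+1) (gamma : 'M[R]_(D, t)) :
  (\int[kappa t gamma]_M (best k M - floor_value k)%:E =
   (mean_best k gamma - floor_value k)%:E)%E.
Proof.
have := mean_bestE k gamma; case: k => [|k]; rewrite /floor_value ?opprK//.
have b0 M : [set: 'M[R]_(D, T)] M -> (0 <= (best 0 M)%:E)%E.
  by move=> _; rewrite lee_fin; have /andP[] := best_bounds 0 M.
have mb : measurable_fun setT (fun M => (best 0 M)%:E).
  by apply/measurable_EFinP; exact: measurable_best.
under eq_integral => M _ do rewrite EFinD.
rewrite (ge0_integralD (f2 := cst 1%E) _ measurableT b0 mb)//.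
rewrite integral_cst//= prob_kernel mule1.
under [in X in _ -> X]eq_integral => M _ do rewrite subr0.
rewrite subr0; case: (integral _ _ _) => [r| |]//=.
by rewrite -EFinD => -[rE]; congr EFin; lra.
Qed.

Lemma mean_best_bounds k (t : 'I_T.+1) (gamma : 'M[R]_(D, t)) :
  floor_value k <= mean_best k gamma <= floor_value k + 1.
Proof.
have intc (c : R) : (\int[kappa t gamma]_M (c + 1)%:E = (c + 1)%:E)%E.
  by rewrite integral_cst//= prob_kernel mule1.
have k0 : 0 <= floor_value k + 1 by case: k => //=; lra.
apply/andP; split; rewrite -(lerD2r 1) -lee_fin -mean_bestE.
  rewrite -intc; apply: lower_integral_mono => M; rewrite lee_fin ?lerD2r//.
  by have /andP[] := best_bounds k M.
rewrite -[leRHS]intc; apply: lower_integral_mono => M; rewrite lee_fin ?lerD2r//.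
  exact: best1_ge0.
by have /andP[] := best_bounds k M.
Qed.

End values.

(** * Accuracy of the recursive algorithms *)

Section accuracy.
Context {R : realType} {T D : nat}.
Hypothesis T_gt0 : (0 < T)%N.
Variables (g : forall t : 'I_T.+1, 'M[R]_(D, t) -> R)
  (kappa : forall t : 'I_T.+1, R.-pker 'M[R]_(D, t) ~> 'M[R]_(D, T)).
Hypothesis g_meas : forall t : 'I_T.+1, (0 < t)%N -> measurable_fun setT (@g t).
Local Notation prog A := (@prog R T D A).
Local Notation expect := (expect g kappa).
Local Notation likely := (likely g kappa).
Local Notation value := (value g kappa).
Local Notation best := (best g kappa).
Local Notation mean_best := (mean_best g kappa).
Local Notation "x <- p ;; q" := (bind p (fun x => q))
  (at level 100, p at next level, q at level 200, right associativity).

Lemma likely_simulate A (t : 'I_T.+1) (gamma : 'M[R]_(D, t))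
    (k : 'M[R]_(D, T) -> prog A) S (eta : R) :
  {ae kappa t gamma, forall M, likely (k M) S eta} ->
  likely (M <- simulate gamma ;; k M) S eta.
Proof.
move=> kS; apply: lower_integral_ae_ge => //; first exact: prob_kernel.
by move=> M; apply: expect_ge0 => a; exact: indic_EFin_ge0.
Qed.

(** Empirical mean of noisy evaluations of [f] at independent samples: up to
    [theta] for the noise, by a union bound, and up to [theta] for the
    sampling error, by Hoeffding's inequality. *)
Lemma likely_sample_mean (s : seq nat) (t : 'I_T.+1) (gamma : 'M[R]_(D, t))
    (q : 'M[R]_(D, T) -> prog R) (f : 'M[R]_(D, T) -> R) (a m theta : R) :
  (0 < size s)%N -> 0 < theta ->
  1 / (2 * theta ^+ 2) * ln 32 <= (size s)%:R ->
  measurable_fun setT f -> (forall M, a <= f M <= a + 1) ->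
  (\int[kappa t gamma]_M (f M - a)%:E = (m - a)%:E)%E ->
  {ae kappa t gamma, forall M,
    likely (q M) [set v | `|v - f M| <= theta] (1 / (16 * (size s)%:R))} ->
  likely (foreach s (fun=> M <- simulate gamma ;; q M))
    [set l | `|(\sum_(x <- l) x) / (size s)%:R - m| <= 2 * theta] (1 / 8).
Proof.
move=> s0 th0 sN mf fa fm qf; set n : R := (size s)%:R.
have n0 : 0 < n by rewrite ltr0n.
(* The program forgets its samples; q' keeps them for the analysis. *)
pose q' : prog (R * 'M[R]_(D, T)) :=
  M <- simulate gamma ;; v <- q M ;; Ret (v, M).
have qq' (i : nat) h : expect (M <- simulate gamma ;; q M) h =
    expect q' (fun b => h b.1).
  by rewrite /q' !expect_bind/=; apply: eq_integral => M _; rewrite expect_bind.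
pose close (b : R * 'M[R]_(D, T)) := `|b.1 - f b.2| <= theta.
have close_q' : likely q' [set b | close b] (1 / (16 * n)).
  apply: likely_simulate; case: qf => N [mN N0 qN]; exists N; split => // M /=.
  move=> nl; apply: qN => /= lq; apply: nl.
  rewrite -[X in likely _ _ X]addr0; apply: likely_bind lq _ => // v vf.
  exact: likely_ret.
have all_close : likely (foreach s (fun=> q'))
    [set l | List.Forall2 (fun (_ : nat) b => close b) s l] (1 / 16).
  have eta0 : 0 <= 1 / (16 * n) by rewrite divr_ge0// mulr_ge0// ltW.
  have := likely_foreach eta0 (fun (i : nat) (_ : List.In i s) => close_q').
  by have -> : n * (1 / (16 * n)) = 1 / 16 by field; rewrite gt_eqF.
(* 4 theta minimizes lam ^ 2 / 8 - lam * theta. *)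
pose lam := 4 * theta; have lam0 : 0 <= lam by rewrite mulr_ge0// ltW.
pose wp (b : R * 'M[R]_(D, T)) := expR (lam * (f b.2 - m)).
pose wm (b : R * 'M[R]_(D, T)) := expR (- lam * (f b.2 - m)).
have m01 := mean_bounds (prob_kernel _) fa fm.
have weight (sg : R) : `|sg| <= lam ->
    (\int[kappa t gamma]_M (expR (sg * (f M - m)))%:E <=
      (expR (lam ^+ 2 / 8))%:E)%E ->
    weight_le g kappa q' (fun b => expR (sg * (f b.2 - m))) (expR (lam ^+ 2 / 8)).
  move=> sglam sgW.
  have bnd M : expR (sg * (f M - m)) <= expR lam.
    rewrite ler_expR; apply: le_trans (ler_norm _) _; rewrite normrM.
    rewrite -[leRHS]mulr1; apply: ler_pM => //.
    have /andP[? ?] := fa M; have /andP[? ?] := m01.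
    by rewrite ler_norml; apply/andP; split; lra.
  apply: (@weight_le_dual _ _ _ _ _ _ _ _ (expR lam)).
  - exact: expR_ge0.
  - by move=> b; rewrite expR_ge0 bnd.
  rewrite /q' /=.
  under eq_integral => M _ do rewrite expect_bind/= expect_cst.
  have mw : measurable_fun setT (fun M => expR (sg * (f M - m))).
    apply: (measurableT_comp (@measurable_expR R)).
    by apply: measurable_funM => //; exact: measurable_funB.
  rewrite EFinB leeBlDr//.
  apply: (@le_trans _ _ (\int[kappa t gamma]_M
      ((expR lam - expR (sg * (f M - m)))%:E + (expR (sg * (f M - m)))%:E))%E).
    under eq_integral => M _ do rewrite -EFinD subrK.
    by rewrite integral_cst//= prob_kernel mule1.
  have w0 M : [set: 'M[R]_(D, T)] M -> (0 <= (expR (sg * (f M - m)))%:E)%E.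
    by move=> _; rewrite lee_fin expR_ge0.
  have bw0 M : [set: 'M[R]_(D, T)] M ->
    (0 <= (expR lam - expR (sg * (f M - m)))%:E)%E.
    by move=> _; rewrite lee_fin subr_ge0.
  have mbw : measurable_fun setT (fun M => (expR lam - expR (sg * (f M - m)))%:E).
    by apply/measurable_EFinP; exact: measurable_funB.
  have mwE : measurable_fun setT (fun M => (expR (sg * (f M - m)))%:E).
    exact/measurable_EFinP.
  by rewrite (ge0_integralD _ measurableT bw0 mbw w0 mwE) leeD.
have mgfp := hoeffding_mgf_le (prob_kernel gamma) mf fa fm lam0.
have mgfm := hoeffding_mgfN_le (prob_kernel gamma) mf fa fm lam0.
have wpW : weight_le g kappa q' wp (expR (lam ^+ 2 / 8)).
  by apply: weight; [rewrite ger0_norm|exact: mgfp].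
have wmW : weight_le g kappa q' wm (expR (lam ^+ 2 / 8)).
  by apply: weight; [rewrite normrN ger0_norm|exact: mgfm].
pose Q := [set l | `|(\sum_(x <- l) x) / n - m| <= 2 * theta].
rewrite /likely (expect_foreach_map _ _ qq') -/Q.
pose c := expR (- (lam * (n * theta))).
have c0 : 0 <= c by exact: expR_ge0.
have ltail : c * expR (lam ^+ 2 / 8) ^+ size s <= 1 / 32.
  rewrite -expRM_natr -expRD -/n.
  have -> : - (lam * (n * theta)) + lam ^+ 2 / 8 * n = - (2 * theta ^+ 2 * n).
    by rewrite /lam; field.
  rewrite expRN div1r lef_pV2 ?posrE ?expR_gt0//.
  rewrite -[leLHS](@lnK R) ?posrE// ler_expR.
  by rewrite -ler_pdivrMl ?mulr_gt0 ?exprn_gt0// -div1r.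
pose H1 (l : seq (R * 'M[R]_(D, T))) : \bar R := (\1_Q (map fst l) : R)%:E.
have H10 l : (0 <= H1 l)%E by exact: indic_EFin_ge0.
have prodw (w : R * 'M[R]_(D, T) -> R) (l : seq (R * 'M[R]_(D, T))) : (forall b, 0 <= w b) ->
    0 <= \prod_(b <- l) w b :> R by move=> w0; exact: prodr_ge0.
pose H2 l := (H1 l + (c * \prod_(b <- l) wp b)%:E)%E.
have wp0 b : 0 <= wp b by exact: expR_ge0.
have wm0 b : 0 <= wm b by exact: expR_ge0.
have H20 l : (0 <= H2 l)%E by rewrite adde_ge0// lee_fin mulr_ge0// prodw.
have E2 := weight_le_foreach s (expR_ge0 _) wp0 wpW c0 H10.
have E3 := weight_le_foreach s (expR_ge0 _) wm0 wmW c0 H20.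
have key : ((1 - 1 / 16)%:E <=
    expect (foreach s (fun=> q')) H1 + (1 / 32 + 1 / 32)%:E)%E.
  apply: le_trans all_close _.
  apply: (@le_trans _ _ (expect (foreach s (fun=> q'))
      (fun l => H2 l + (c * \prod_(b <- l) wm b)%:E)%E)).
    apply: expect_mono => l; first exact: indic_EFin_ge0.
    rewrite indicE; have [|_] := boolP (l \in _); last first.
      by rewrite adde_ge0// lee_fin mulr_ge0// prodw.
    rewrite inE => sl; have ssl := Forall2_size sl.
    have prodE sg : \prod_(b <- l) expR (sg * (f b.2 - m)) =
        expR (sg * (\sum_(b <- l) f b.2 - n * m)).
      rewrite /n ssl; elim: (l) => [|b l' IH].
        by rewrite !big_nil mul0r subr0 mulr0 expR0.
      by rewrite !big_cons IH -expRD /= -natr1; congr expR; ring.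
    set F := \sum_(b <- l) f b.2 in prodE.
    have Fclose : `|\sum_(x <- map fst l) x - F| <= n * theta.
      rewrite /F /n ssl big_map; elim: sl => [|i b s' l' ib _ IH].
        by rewrite !big_nil subr0 normr0 mul0r.
      rewrite !big_cons opprD addrACA; apply: le_trans (ler_normD _ _) _.
      by rewrite /= -natr1 mulrDl mul1r [leRHS]addrC lerD.
    have one x : 1 <= c * expR x <-> lam * (n * theta) <= x.
      by rewrite /c -expRD -[X in X <= _](@expR0 R) ler_expR addrC subr_ge0.
    have [Fp|Fp] := leP (n * theta) (F - n * m).
      apply: (@le_trans _ _ (c * \prod_(b <- l) wp b)%:E).
        by rewrite lee_fin prodE; apply/one; rewrite ler_wpM2l.
      rewrite /H2 addeAC leeDr// adde_ge0// lee_fin mulr_ge0// prodw//.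
    have [Fm|Fm] := leP (n * theta) (- (F - n * m)).
      apply: (@le_trans _ _ (c * \prod_(b <- l) wm b)%:E).
        by rewrite lee_fin prodE; apply/one; rewrite mulNr -mulrN ler_wpM2l.
      by rewrite leeDr.
    have Ql : Q (map fst l).
      rewrite /Q /=; have -> : (\sum_(x <- map fst l) x) / n - m =
          ((\sum_(x <- map fst l) x - F) + (F - n * m)) / n.
        by field; rewrite gt_eqF.
      rewrite normrM normfV (gtr0_norm n0) ler_pdivrMr//.
      apply: le_trans (ler_normD _ _) _.
      have : `|F - n * m| <= n * theta by rewrite ler_norml; apply/andP; split; lra.
      by move: Fclose; lra.
    rewrite /H2 /H1 indicE mem_set// -addeA leeDl// adde_ge0// lee_fin mulr_ge0// prodw//.
  apply: le_trans E3 _; rewrite EFinD addeA; apply: leeD; last by rewrite lee_fin.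
  by apply: le_trans E2 _; rewrite leeD2l// lee_fin.
rewrite -/H1; move: key; rewrite -leeBlDr// -EFinB; apply: le_trans.
by rewrite lee_fin; lra.
Qed.

(** The observations [gamma] from which the first [k] levels of the recursion
    behave as intended: the rewards that they read lie in the unit interval, and
    the simulator extends the path that it is given. *)
Fixpoint good (k : nat) (t : 'I_T.+1) (gamma : 'M[R]_(D, t)) : Prop :=
  match k with
  | 0 => 0 <= g gamma <= 1
  | k'.+1 => good k' gamma /\
    {ae kappa t gamma, forall M, first_cols t M = gamma /\
      forall j : 'I_T.+1, (0 < j)%N -> good k' (first_cols j M)}
  end.

(** The upper bound is where sampled paths have to extend [gamma]: [t] is then
    one of the times over which the maximum is taken.  The lower bound holds
    because both terms lie in the same unit interval. *)
Lemma value_mean_best_bounds k (t : 'I_T.+1) (gamma : 'M[R]_(D, t)) :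
  (0 < t)%N -> {ae kappa t gamma, forall M, first_cols t M = gamma} ->
  -1 <= value k gamma - mean_best k gamma <= 0.
Proof.
move=> t0 gam; apply/andP; split.
  have /andP[? _] := value_bounds g kappa k gamma.
  by have /andP[_ ?] := mean_best_bounds T_gt0 g kappa k gamma; lra.
rewrite subr_le0 -(lerD2r 1) -lee_fin -mean_bestE//.
apply: lower_integral_ae_ge; first exact: prob_kernel.
  by move=> M; rewrite lee_fin best1_ge0.
case: gam => N [mN N0 gN]; exists N; split => // M /= nle; apply: gN => /= gM.
by apply: nle; rewrite lee_fin lerD2r -gM best_ge.
Qed.

(** The loop counts that [sample_size] and [repetitions] compute in a call of
    accuracy [e] and confidence [delta]. *)
Definition samples (e : R) : nat :=
  ceil_val (1 / (2 * (e / 4 * (e / 4))) * ln (2 / (1 / 16))).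

Definition trials (delta : R) : nat := ceil_val (8 * ln (2 / delta)).

Definition estimate_best k (t : 'I_T.+1) (gamma : 'M[R]_(D, t)) (e : R) :
    prog R :=
  A1 <- simulate gamma ;;
  A2 <- foreach (@times T) (fun j => Balg k (first_cols j A1) (e / 4)
    (1 / (16 * ((samples e)%:R * T%:R)))) ;;
  maxp A2.

Definition trial k (t : 'I_T.+1) (gamma : 'M[R]_(D, t)) (e : R) : prog R :=
  A3 <- Balg k gamma (e / 2) (1 / 8) ;;
  A0 <- repeat (samples e) (estimate_best k gamma e) ;;
  sum <- sump A0 ;;
  mean <- arith Div sum (samples e)%:R ;;
  arith Defs.Sub A3 mean.

Lemma expect_BalgS k (t : 'I_T.+1) (gamma : 'M[R]_(D, t)) e delta h :
  expect (Balg k.+1 gamma e delta) h =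
  expect (foreach (iota 0 (trials delta)) (fun=> trial k gamma e))
    (fun l => h (median_val l)).
Proof. by rewrite /= expect_bind. Qed.

Lemma ln32_gt0 : 0 < ln 32 :> R.
Proof. by rewrite ln_gt0//; lra. Qed.

Lemma samples_ge e : 0 < e ->
  1 / (2 * (e / 4) ^+ 2) * ln 32 <= (samples e)%:R.
Proof.
move=> e0; have -> : 32 = 2 / (1 / 16) :> R by field.
by rewrite expr2; exact: ceil_val_ge.
Qed.

Lemma samples_gt0 e : 0 < e -> (0 < samples e)%N.
Proof.
move=> e0; rewrite -(ltr_nat R); apply: lt_le_trans (samples_ge e0).
by rewrite mulr_gt0 ?ln32_gt0// divr_gt0// mulr_gt0// exprn_gt0// divr_gt0.
Qed.

(** The error budget is [e / 2] for the first call and twice [e / 4] for the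
    empirical mean, and the two parts fail with probability 1/8 each. *)
Lemma trial_accurate k (t : 'I_T.+1) (gamma : 'M[R]_(D, t)) e :
  (forall (t : 'I_T.+1) (gamma : 'M[R]_(D, t)) e delta, (0 < t)%N ->
    good k gamma -> 0 < e -> 0 < delta <= 1 ->
    likely (Balg k gamma e delta) [set v | `|v - value k gamma| <= e] delta) ->
  (0 < t)%N -> good k.+1 gamma -> 0 < e ->
  likely (trial k gamma e) [set v | `|v - value k.+1 gamma| <= e] (1 / 4).
Proof.
move=> IH t0 [gk gae] e0.
have N0 := samples_gt0 e0; set N := samples e in N0.
have valE : value k.+1 gamma = value k gamma - mean_best k gamma.
  rewrite valueS clip_id// value_mean_best_bounds//.
  by case: gae => A [mA A0 sA]; exists A; split => // M /= nM;
    apply: sA => /= -[].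
rewrite {}valE.
have e2 : 0 < e / 2 by rewrite divr_gt0.
have e4 : 0 < e / 4 by rewrite divr_gt0.
have -> : 1 / 4 = 1 / 8 + 1 / 8 :> R by lra.
apply: (@likely_bind _ _ _ _ _ _ _ _ _
  [set v | `|v - value k gamma| <= e / 2]); first by lra.
  by apply: IH => //; lra.
move=> A3 A3close; rewrite -[X in likely _ _ X]addr0.
apply: (@likely_bind _ _ _ _ _ _ _ _ _
  [set l | `|(\sum_(x <- l) x) / N%:R - mean_best k gamma| <= 2 * (e / 4)]) => //.
  have := @likely_sample_mean (iota 0 N) t gamma
    (fun M => A2 <- foreach (@times T) (fun j => Balg k (first_cols j M) (e / 4)
       (1 / (16 * (N%:R * T%:R)))) ;; maxp A2)
    (best k) (floor_value k) (mean_best k gamma) (e / 4).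
  rewrite size_iota; apply => //.
  - exact: samples_ge.
  - exact: measurable_best.
  - by move=> M; exact: best_bounds.
  - exact: mean_best_floorE.
  case: gae => A [mA A0 sA]; exists A; split => // M /= nM.
  apply: sA => /= -[_ gj]; apply: nM.
  have NT0 : 0 < 16 * (N%:R * T%:R) :> R by rewrite !mulr_gt0 ?ltr0n.
  rewrite -[X in likely _ _ X]addr0.
  apply: (@likely_bind _ _ _ _ _ _ _ _ _
    [set l | List.Forall2 (fun (j : 'I_T.+1) a =>
      `|a - value k (first_cols j M)| <= e / 4) (@times T) l]) => //.
    have -> : 1 / (16 * N%:R) = (size (@times T))%:R * (1 / (16 * (N%:R * T%:R))) :> R.
      rewrite size_times; field.
      by rewrite !pnatr_eq0 -!lt0n N0 T_gt0.
    apply: likely_foreach; first by rewrite divr_ge0// ltW.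
    move=> j /In_mem; rewrite mem_times => j0.
    apply: IH => //; first exact: gj.
    rewrite divr_gt0//= ler_pdivrMr// mul1r.
    by rewrite !mulr_ege1 ?ler1n// ; lra.
  move=> l ljM; rewrite /likely expect_maxp subr0 indicE mem_set//=.
  by apply: maxl_close ljM; rewrite size_times.
move=> l lmean; rewrite /likely expect_bind expect_sump/= indicE mem_set ?subr0//=.
move: A3close lmean => /=; rewrite !ler_norml.
by move=> /andP[? ?] /andP[? ?]; apply/andP; split; lra.
Qed.

(** The median amplifies the confidence 3/4 of a trial to [1 - delta], as
    [97 / 112 <= exp (- 1 / 8)] and [delta / 2 <= delta]. *)
Theorem Balg_accurate k (t : 'I_T.+1) (gamma : 'M[R]_(D, t)) e delta :
  (0 < t)%N -> good k gamma -> 0 < e -> 0 < delta <= 1 ->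
  likely (Balg k gamma e delta) [set v | `|v - value k gamma| <= e] delta.
Proof.
elim: k t gamma e delta => [|k IH] t gamma e delta t0 gk e0 /andP[d0 d1].
  rewrite /likely/= indicE mem_set /=; first by rewrite lee_fin gerBl ltW.
  by rewrite clip_id// subrr normr0; exact: ltW.
have tr := likely_majority (iota 0 (trials delta)) (trial_accurate IH t0 gk e0).
rewrite /likely expect_BalgS.
apply: (@likely_weaken _ _ _ _ _ _ _ _ [set l | `|median_val l - value k.+1 gamma| <= e]
  _ delta tr) => [l /= [cl sl]|].
  apply: median_close; move: cl; rewrite sl.
  congr (_ < _)%N; congr double; apply: eq_count => v.
  by congr (~~ _); apply/idP/idP; rewrite inE.
rewrite size_iota; set n := trials delta.
have nge : 8 * ln (2 / delta) <= n%:R by exact: ceil_val_ge.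
apply: (@le_trans _ _ (expR (- (1 / 8)) ^+ n)).
  have le_e : 97 / 112 <= expR (- (1 / 8)) :> R.
    by apply: le_trans (expR_ge1Dx _); lra.
  by rewrite lerXn2r// nnegrE ?expR_ge0//; lra.
rewrite -expRM_natr.
apply: (@le_trans _ _ (expR (- ln (2 / delta)))).
  by rewrite ler_expR; lra.
by rewrite expRN lnK ?posrE ?divr_gt0// invf_div; lra.
Qed.

End accuracy.

(** * Disintegration along the observed columns *)

Section kernel_comp_fun.
Context {R : realType} d1 d2 d3 (X : measurableType d1) (Y : measurableType d2)
  (Z : measurableType d3).
Variables (k : R.-pker Y ~> Z) (u : X -> Y).

(** The pullback of a kernel along a measurable map; along [first_cols t] it turns
    [kappa t] into a kernel on whole paths. *)
Definition kernel_comp_fun (mu : measurable_fun setT u) (x : X) :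
  {measure set Z -> \bar R} := k (u x).

Hypothesis mu : measurable_fun setT u.

Let measurable_kernel_comp_fun U : measurable U ->
  measurable_fun setT (kernel_comp_fun mu ^~ U).
Proof.
move=> mU; exact: (measurableT_comp (measurable_kernel k U mU) mu).
Qed.

HB.instance Definition _ := isKernel.Build _ _ _ _ _ (kernel_comp_fun mu)
  measurable_kernel_comp_fun.

Let kernel_comp_fun_prob x : kernel_comp_fun mu x setT = 1%E.
Proof. exact: prob_kernel. Qed.

HB.instance Definition _ := Kernel_isProbability.Build _ _ _ _ _
  (kernel_comp_fun mu) kernel_comp_fun_prob.

End kernel_comp_fun.

Section almost_everywhere.
Context {R : realType} {d : measure_display} {X : measurableType d}.
Variable mu : {measure set X -> \bar R}.

Lemma ae_forall_count (I : countType) (P : I -> X -> Prop) :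
  (forall i, {ae mu, forall x, P i x}) -> {ae mu, forall x, forall i, P i x}.
Proof.
move=> aeP; pose Q n x := if unpickle n is Some i then P i x else True.
have : mu.-negligible (\bigcup_n ~` [set x | Q n x]).
  apply: negligible_bigcup => n; rewrite /Q.
  case: (unpickle n) => [i|]; first exact: aeP.
  by rewrite setCT; exact: negligible_set0.
apply: negligibleS => x /= nP; apply: contrapT => nQ; apply: nP => i.
apply: contrapT => nPi; apply: nQ; exists (pickle i) => //=.
by rewrite /Q pickleK.
Qed.

Lemma ae_imply (P Q : X -> Prop) : (forall x, P x -> Q x) ->
  {ae mu, forall x, P x} -> {ae mu, forall x, Q x}.
Proof. by move=> PQ; apply: negligibleS => x /= nQ Px; exact/nQ/PQ. Qed.

Lemma ae_and (P Q : X -> Prop) : {ae mu, forall x, P x} ->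
  {ae mu, forall x, Q x} -> {ae mu, forall x, P x /\ Q x}.
Proof.
move=> aeP aeQ; have := negligibleU aeP aeQ.
apply: negligibleS => x /= nPQ; have [Px|] := pselect (P x); last by left.
by right=> Qx; apply: nPQ.
Qed.

Lemma integral_eq0_ae (f : X -> \bar R) : measurable_fun setT f ->
  (forall x, 0 <= f x)%E -> (\int[mu]_x f x = 0)%E ->
  {ae mu, forall x, f x = 0%E}.
Proof.
move=> mf f0 If; have /(ae_eq_integral_abs mu measurableT mf) : 
    (\int[mu]_x `|f x| = 0)%E.
  by rewrite -[RHS]If; apply: eq_integral => x _; rewrite gee0_abs.
by apply: ae_imply => x /= ->.
Qed.

End almost_everywhere.

Section disintegration.
Context {R : realType} {T D : nat}.
Hypothesis T_gt0 : (0 < T)%N.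
Variable nu : probability 'M[R]_(D, T) R.
Variable kappa : forall t : 'I_T.+1, R.-pker 'M[R]_(D, t) ~> 'M[R]_(D, T).
Hypothesis nu_kappa : forall t A B, measurable A -> measurable B ->
  nu (A `&` first_cols t @^-1` B) =
  (\int[nu]_(y in first_cols t @^-1` B) kappa t (first_cols t y) A)%E.

Local Notation V := first_cols.

Lemma measurable_preimage_first_cols (t : 'I_T.+1) (B : set 'M[R]_(D, t)) :
  measurable B -> measurable (V t @^-1` B : set 'M[R]_(D, T)).
Proof.
by move=> mB; rewrite -[X in measurable X]setTI; exact: measurable_first_cols.
Qed.

Lemma measurable_kappa_first_cols (t : 'I_T.+1) A : measurable A ->
  measurable_fun setT (fun y => kappa t (V t y) A).
Proof.
move=> mA.
by have := measurableT_comp (measurable_kernel (kappa t) A mA)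
  (@measurable_first_cols R T D t); apply.
Qed.

Lemma kappa_null (t : 'I_T.+1) (A : set 'M[R]_(D, T)) (B : set 'M[R]_(D, t)) :
  measurable A -> measurable B -> nu (A `&` V t @^-1` B) = 0%E ->
  {ae nu, forall y, B (V t y) -> kappa t (V t y) A = 0%E}.
Proof.
move=> mA mB; rewrite nu_kappa// integral_mkcond => I0.
have mVB := measurable_preimage_first_cols mB.
have := integral_eq0_ae _ _ I0.
move=> H; have {}H := H _ _; apply: ae_imply (H _ _).
- move=> y /= + By; rewrite patchE mem_set//.
- apply: (measurable_restrictT _ mVB).1.
  by have mk := measurable_kappa_first_cols t mA; exact: measurable_funTS.
- by move=> y; rewrite patchE; case: ifP.
Qed.

Lemma kappa_ae (t : 'I_T.+1) (Q : 'M[R]_(D, T) -> Prop) :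
  {ae nu, forall y, Q y} ->
  {ae nu, forall y, {ae kappa t (V t y), forall M, Q M}}.
Proof.
case=> N [mN N0 QN].
have : nu (N `&` V t @^-1` setT) = 0%E by rewrite preimage_setT setIT.
move=> /(kappa_null mN measurableT); apply: ae_imply => y /(_ I) N0y.
by exists N.
Qed.

(** A sample of [kappa t gamma] extends [gamma]: testing the countably many
    half-lines with rational end points on each coordinate is enough. *)
Lemma kappa_extends (t : 'I_T.+1) :
  {ae nu, forall y, {ae kappa t (V t y), forall M, V t M = V t y}}.
Proof.
pose B (c : 'I_D * 'I_t * rat * bool) : set 'M[R]_(D, t) :=
  [set G | (G c.1.1.1 c.1.1.2 <= ratr c.1.2) = c.2].
have mB c : measurable (B c).
  have mle : measurable_fun setT
      (fun G : 'M[R]_(D, t) => G c.1.1.1 c.1.1.2 <= ratr c.1.2).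
    by apply: measurable_fun_ler => //; exact: measurable_mxcoord.
  by have := mle measurableT [set c.2] I; rewrite setTI.
have mBC c : measurable (V t @^-1` (~` B c) : set 'M[R]_(D, T)).
  by apply: measurable_preimage_first_cols; exact: measurableC.
have : {ae nu, forall y, forall c, B c (V t y) ->
    kappa t (V t y) (V t @^-1` (~` B c)) = 0%E}.
  apply: ae_forall_count => c; apply: kappa_null => //.
  by rewrite -preimage_setI setICl preimage_set0 measure0.
apply: ae_imply => y yB.
have : {ae kappa t (V t y), forall M, forall c, B c (V t y) -> B c (V t M)}.
  apply: ae_forall_count => c; have [Bc|nBc] := pselect (B c (V t y)).
    exists (V t @^-1` (~` B c)); split => //; first exact: yB.
    by move=> M /= nB Bc'; exact: nB.
  by apply: negligibleS (negligible_set0 _) => M /= nB; apply: nB.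
apply: ae_imply => M MB; apply/matrixP => i j.
have le_rat q : (V t M i j <= ratr q) = (V t y i j <= ratr q).
  exact: (MB (i, j, q, V t y i j <= ratr q)).
apply/eqP; rewrite eq_le; apply/andP; split; rewrite leNgt; apply/negP.
  move=> /rat_in_itvoo[q]; rewrite in_itv/= => /andP[yq qM].
  by have := le_rat q; rewrite (ltW yq) leNgt qM.
move=> /rat_in_itvoo[q]; rewrite in_itv/= => /andP[Mq qy].
by have := le_rat q; rewrite (ltW Mq) leNgt qy.
Qed.

(** Integrating against [nu] and then [kappa t] is integrating against [nu]: the
    kernel composition agrees with [nu] on events, hence on integrals. *)
Lemma integral_kappa (t : 'I_T.+1) (F : 'M[R]_(D, T) -> \bar R) :
  measurable_fun setT F -> (forall M, 0 <= F M)%E ->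
  (\int[nu]_y F y = \int[nu]_y \int[kappa t (V t y)]_M F M)%E.
Proof.
move=> mF F0.
pose l : R.-pker unit ~> 'M[R]_(D, T) :=
  kprobability (measurable_cst (nu : pprobability _ R)).
have mu2 : measurable_fun setT (V t \o (snd : unit * 'M[R]_(D, T) -> _)).
  exact: (measurableT_comp (@measurable_first_cols R T D t) measurable_snd).
pose k := kernel_comp_fun (kappa t) mu2.
have := @integral_kcomp _ _ _ _ _ _ _ l k tt F F0 mF.
move=> <-; apply: eq_measure_integral => A mA _.
rewrite /kcomp/=.
have := @nu_kappa t _ _ mA measurableT; rewrite preimage_setT setIT => ->.
by [].
Qed.

(** The tower property with a factor that is known at time [t], which the kernel
    lets through because its samples extend the first [t] columns. *)
Lemma integral_tower (t : 'I_T.+1) (q : 'M[R]_(D, t) -> R)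
    (F : 'M[R]_(D, T) -> R) :
  measurable_fun setT q -> (forall G, 0 <= q G) ->
  measurable_fun setT F -> (forall M, 0 <= F M) ->
  (\int[nu]_y (q (V t y) * F y)%:E =
   \int[nu]_y ((q (V t y))%:E * \int[kappa t (V t y)]_M (F M)%:E))%E.
Proof.
move=> mq q0 mF F0.
have mqV : measurable_fun setT (fun y : 'M[R]_(D, T) => q (V t y)).
  by have := measurableT_comp mq (@measurable_first_cols R T D t); apply.
have mqF : measurable_fun setT (fun y => (q (V t y) * F y)%:E).
  by apply/measurable_EFinP; exact: measurable_funM.
rewrite (integral_kappa t mqF); last by move=> M; rewrite lee_fin mulr_ge0.
have mIF (H : 'M[R]_(D, T) -> \bar R) : measurable_fun setT H ->
    (forall M, 0 <= H M)%E ->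
    measurable_fun setT (fun y => \int[kappa t (V t y)]_M H M)%E.
  move=> mH H0; have := measurable_fun_integral_kernel
    (measurable_kernel (kappa t)) H0 mH.
  move=> mI; have := measurableT_comp mI (@measurable_first_cols R T D t).
  by apply.
have mFE : measurable_fun setT (fun y => (F y)%:E) by exact/measurable_EFinP.
have qF0 M : (0 <= (q (V t M) * F M)%:E)%E by rewrite lee_fin mulr_ge0.
have IF0 y : (0 <= \int[kappa t (V t y)]_M (F M)%:E)%E.
  by apply: integral_ge0 => M _; rewrite lee_fin.
apply: ge0_ae_eq_integral => //.
- exact: mIF.
- by apply: emeasurable_funM; [exact/measurable_EFinP|apply: mIF].
- by move=> y _; apply: integral_ge0.
- by move=> y _; rewrite mule_ge0// lee_fin.
apply: ae_imply (kappa_extends t) => y yM _.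
rewrite -ge0_integralZl_EFin//; last by move=> M _; rewrite lee_fin.
apply: ge0_ae_eq_integral => //.
- by apply: measurable_funeM.
- by move=> M _; rewrite mule_ge0// lee_fin.
by apply: ae_imply yM => M -> _; rewrite EFinM.
Qed.

End disintegration.

(** * The values along a path *)

Section path.
Context {R : realType} {T D : nat}.
Hypothesis T_gt0 : (0 < T)%N.
Variable nu : probability 'M[R]_(D, T) R.
Variables (g : forall t : 'I_T.+1, 'M[R]_(D, t) -> R)
  (kappa : forall t : 'I_T.+1, R.-pker 'M[R]_(D, t) ~> 'M[R]_(D, T)).
Hypothesis g_meas : forall t : 'I_T.+1, (0 < t)%N -> measurable_fun setT (@g t).
Hypothesis nu_kappa : forall t A B, measurable A -> measurable B ->
  nu (A `&` first_cols t @^-1` B) =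
  (\int[nu]_(y in first_cols t @^-1` B) kappa t (first_cols t y) A)%E.
Hypothesis g01 : forall t : 'I_T.+1, (0 < t)%N ->
  {ae nu, forall y, 0 <= g (first_cols t y) <= 1}.

Local Notation V := first_cols.
Local Notation value := (value g kappa).
Local Notation best := (best g kappa).
Local Notation mean_best := (mean_best g kappa).
Local Notation good := (good g kappa).

(** Goodness is passed to sampled paths by [kappa_ae]: what holds for almost every
    path holds for almost every continuation of almost every path. *)
Lemma good_ae k (t : 'I_T.+1) : (0 < t)%N ->
  {ae nu, forall y, good k (V t y)}.
Proof.
elim: k t => [|k IH] t t0 /=; first exact: g01.
apply: ae_and; first exact: IH.
have all_good : {ae nu, forall y, forall j : 'I_T.+1, (0 < j)%N -> good k (V j y)}.
  apply: ae_forall_count => j; have [j0|j0] := boolP (0 < j)%N.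
    by apply: ae_imply (IH j j0).
  exact: aeW.
have := ae_and (kappa_extends nu_kappa t) (kappa_ae nu_kappa t all_good).
by apply: ae_imply => y [yt yg]; exact: ae_and.
Qed.

Lemma good_path_ae k :
  {ae nu, forall y, forall t : 'I_T.+1, (0 < t)%N -> good k (V t y)}.
Proof.
apply: ae_forall_count => j; have [j0|j0] := boolP (0 < j)%N.
  by apply: ae_imply (good_ae k j0).
exact: aeW.
Qed.

Definition extends_along (y : 'M[R]_(D, T)) : Prop :=
  forall t : 'I_T.+1, {ae kappa t (V t y), forall M, V t M = V t y}.

Lemma extends_along_ae : {ae nu, forall y, extends_along y}.
Proof. by apply: ae_forall_count => t; exact: kappa_extends. Qed.

Lemma value_step k (t : 'I_T.+1) y : (0 < t)%N -> extends_along y ->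
  value k.+1 (V t y) = value k (V t y) - mean_best k (V t y).
Proof. by move=> t0 ey; rewrite valueS clip_id// value_mean_best_bounds. Qed.

Lemma first_cols_max_inj (M y : 'M[R]_(D, T)) :
  V ord_max M = V ord_max y -> M = y.
Proof.
move=> /matrixP MV; apply/matrixP => i j; have := MV i j.
have wj : widen_ord (leq_ord (@ord_max T)) j = j by exact: val_inj.
by rewrite !mxE wj.
Qed.

(** The whole path is known at the last time, so that the conditional
    expectation there is the pathwise maximum itself. *)
Lemma mean_best_last k y : extends_along y ->
  mean_best k (V ord_max y) = best k y.
Proof.
move=> ey; apply/(addIr 1)/EFin_inj; rewrite -(mean_bestE T_gt0)//.
rewrite -[RHS]mul1e -[in RHS](prob_kernel (s := kappa ord_max) (V ord_max y)).
rewrite muleC -integral_cst//; apply: ge0_ae_eq_integral => //.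
- by apply/measurable_EFinP; apply: measurable_funD => //; exact: measurable_best.
- by move=> M _; rewrite lee_fin best1_ge0.
- by move=> M _ /=; rewrite lee_fin best1_ge0.
by apply: ae_imply (ey ord_max) => M /first_cols_max_inj ->.
Qed.

Lemma best_nondecreasing k y : extends_along y -> best k.+1 y <= best k.+2 y.
Proof.
move=> ey; have [t t0 ->] := best_ex T_gt0 g kappa k.+1 y.
apply: le_trans (best_ge g kappa k.+2 y t0).
rewrite [leRHS]value_step// lerDl oppr_ge0.
by have /andP[_] := mean_best_bounds T_gt0 g kappa k.+1 (V t y); rewrite addNr.
Qed.

(** At the last time the values increase by [- best i] in step [i]; they start
    above -1, never exceed 0, and the increments are nonincreasing. *)
Lemma value_last_ge k y : extends_along y ->
  -1 - k%:R * best k y <= value k.+1 (V ord_max y).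
Proof.
move=> ey; elim: k => [|k IH].
  by rewrite mul0r subr0; have /andP[] := value_bounds g kappa 1 (V ord_max y).
rewrite value_step// mean_best_last//.
have : -1 - k%:R * best k.+1 y <= value k.+1 (V ord_max y).
  apply: le_trans IH; rewrite lerB// ; case: k => [|k]; first by rewrite !mul0r.
  by rewrite ler_wpM2l// best_nondecreasing.
by rewrite -natr1; lra.
Qed.

(** Since the value at the last time is at most 0, the nondecreasing sequence of
    the [best j y] cannot stay far below 0: after [k] levels the largest value
    along the path is at least [- 1 / k]. *)
Lemma best_near0 k y : extends_along y -> - (k.+1%:R * best k.+1 y) <= 1.
Proof.
move=> ey; have := value_last_ge k.+1 ey.
by have /andP[_] := value_bounds g kappa k.+2 (V ord_max y); rewrite addNr; lra.
Qed.

(** * Expected values under a choice of stopping probabilities *)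

Definition time (i : 'I_T) : 'I_T.+1 := lift ord0 i.

(** [o t y] is the probability of stopping at [t] along the path [y].  Both the
    stopping times of the filtration and the randomized times produced by the
    algorithm are compared through such weights, on the space of paths. *)
Record stopping_weights (o : 'I_T.+1 -> 'M[R]_(D, T) -> R) : Prop :=
  StoppingWeights {
  weights_meas : forall t, measurable_fun setT (o t);
  weights_ge0 : forall t y, 0 <= o t y;
  weights_sum1 : {ae nu, forall y, \sum_(i < T) o (time i) y = 1};
  weights_adapted : forall t y y', V t y = V t y' -> o t y = o t y' }.

(** What the first [k] levels have subtracted from the reward. *)
Definition gap k (t : 'I_T.+1) (gamma : 'M[R]_(D, t)) : R :=
  value 0 gamma - value k gamma.

Lemma gap_ge0 k (t : 'I_T.+1) (gamma : 'M[R]_(D, t)) : 0 <= gap k gamma.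
Proof.
rewrite /gap; case: k => [|k]; first by rewrite subrr.
have /andP[? _] := value_bounds g kappa 0 gamma.
have /andP[_ +] := value_bounds g kappa k.+1 gamma; rewrite addNr => ?.
by rewrite subr_ge0; apply: (@le_trans _ _ 0).
Qed.

Lemma measurable_gap k i : measurable_fun setT (@gap k (time i)).
Proof. by apply: measurable_funB; exact: measurable_value. Qed.

Lemma measurable_path_term (t : 'I_T.+1) (o : 'M[R]_(D, T) -> R) (F : 'M[R]_(D, t) -> R) :
  measurable_fun setT o -> measurable_fun setT F ->
  measurable_fun setT (fun y : 'M[R]_(D, T) => (o y * F (V t y))%:E).
Proof.
move=> mo mF; apply/measurable_EFinP; apply: measurable_funM => //.
by have := measurableT_comp mF (@measurable_first_cols R T D t); apply.
Qed.

(** In passing from [k] to [k + 1] the gap grows by a conditional expectation,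
    whose mean does not depend on when one looks at it. *)
Lemma gap_mean_invariant k : exists c : R, forall o, stopping_weights o ->
  (\int[nu]_y (\sum_(i < T) (o (time i) y *
     gap k (V (time i) y))%:E) = c%:E)%E.
Proof.
elim: k => [|k [c IH]].
  exists 0 => o _; apply: integral0_eq => y _; apply: big1 => i _.
  by rewrite /gap subrr mulr0.
pose b : R := fine (\int[nu]_y (best k y + 1)%:E)%E.
have bE : (\int[nu]_y (best k y + 1)%:E = b%:E)%E.
  rewrite fineK// ge0_fin_numE; last first.
    by apply: integral_ge0 => M _; rewrite lee_fin best1_ge0.
  apply: (@le_lt_trans _ _ (\int[nu]_M (cst 2%:E M))%E).
    apply: lower_integral_mono => M; rewrite lee_fin ?best1_ge0//=.
    have /andP[_] := best_bounds T_gt0 g kappa k M; case: (k) => [|k'] /=; lra.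
  by rewrite integral_cst//= probability_setT mule1 ltry.
exists (c + b - 1) => o wo; have [mo o0 o1 oV] := wo.
have mono1 : measurable_fun setT (best k).
  exact: measurable_best.
have step_ae : {ae nu, forall y, (setT y ->
    \sum_(i < T) (o (time i) y * gap k.+1 (V (time i) y))%:E + 1 =
    \sum_(i < T) (o (time i) y * gap k (V (time i) y))%:E +
    \sum_(i < T) (o (time i) y *
      (mean_best k (V (time i) y) + 1))%:E)%E}.
  apply: ae_imply (ae_and extends_along_ae o1) => y [ey o1y] _.
  rewrite !sumEFin -!EFinD -[X in (_ + X)%:E = _]o1y -!big_split/=.
  congr EFin.
  apply: eq_bigr => i _; rewrite /gap value_step//; ring.
pose Fmb (t : 'I_T.+1) (gamma : 'M[R]_(D, t)) := mean_best k gamma + 1.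
have mterm (F : forall t : 'I_T.+1, 'M[R]_(D, t) -> R) i :
    (forall j, measurable_fun setT (F (time j))) ->
    measurable_fun setT (fun y : 'M[R]_(D, T) =>
      (o (time i) y * F (time i) (V (time i) y))%:E).
  by move=> mF; exact: measurable_path_term.
have mb1 i : measurable_fun setT
    (@Fmb (time i)).
  by apply: measurable_funD => //; exact: measurable_mean_best.
have sum0 (F : forall t : 'I_T.+1, 'M[R]_(D, t) -> R) y :
    (forall i gamma, 0 <= F (time i) gamma) -> (0 <= \sum_(i < T)
     (o (time i) y * F (time i) (V (time i) y))%:E)%E.
  by move=> F0; apply: sume_ge0 => i _; rewrite lee_fin mulr_ge0.
have gap0 j i (gamma : 'M[R]_(D, time i)) : 0 <= gap j gamma by exact: gap_ge0.
have mb10 i (gamma : 'M[R]_(D, time i)) : 0 <= mean_best k gamma + 1.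
  have /andP[+ _] := mean_best_bounds T_gt0 g kappa k gamma.
  by case: (k) => [|k'] /=; lra.
have Imb : (\int[nu]_y \sum_(i < T) (o (time i) y *
      (mean_best k (V (time i) y) + 1))%:E = b%:E)%E.
  rewrite ge0_integral_sum//; last 2 first.
  - by move=> i; exact: (mterm Fmb).
  - by move=> i y _; rewrite lee_fin mulr_ge0.
  rewrite -bE; transitivity (\sum_(i < T) \int[nu]_y
      (o (time i) y * (best k y + 1))%:E)%E.
    apply: eq_bigr => i _.
    have oE y : o (time i) y = o (time i) (pad (V (time i) y)).
      by apply: oV; rewrite first_cols_pad.
    pose q (gamma : 'M[R]_(D, time i)) := o (time i) (pad gamma).
    have mq : measurable_fun setT q.
      by have := measurableT_comp (mo (time i)) (@measurable_pad R T D (time i));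
        apply.
    have mb : measurable_fun setT (fun M => best k M + 1).
      exact: measurable_funD.
    have := integral_tower nu_kappa mq (fun G => o0 _ _) mb (best1_ge0 T_gt0 g kappa k).
    rewrite /q => tower; transitivity (\int[nu]_y
        ((o (time i) (pad (V (time i) y)))%:E *
           \int[kappa (time i) (V (time i) y)]_M (best k M + 1)%:E))%E.
      by apply: eq_integral => y _; rewrite mean_bestE// EFinM -oE.
    by rewrite -tower; apply: eq_integral => y _; rewrite -oE.
  rewrite -ge0_integral_sum//; last 2 first.
  - move=> i; apply/measurable_EFinP; apply: measurable_funM => //.
    exact: measurable_funD.
  - by move=> i y _; rewrite lee_fin mulr_ge0// best1_ge0.
  apply: ge0_ae_eq_integral => //.
  - apply: emeasurable_sum => i; apply/measurable_EFinP.
    by apply: measurable_funM => //; exact: measurable_funD.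
  - by apply/measurable_EFinP; exact: measurable_funD.
  - by move=> y _; apply: sume_ge0 => i _; rewrite lee_fin mulr_ge0// best1_ge0.
  - by move=> y _; rewrite lee_fin best1_ge0.
  by apply: ae_imply o1 => y o1y _; rewrite sumEFin -mulr_suml o1y mul1r.
have S0 j y := sum0 (@gap j) y (gap0 j).
have Smb0 y := sum0 Fmb y mb10.
have mS j : measurable_fun setT (fun y : 'M[R]_(D, T) => \sum_(i < T)
    (o (time i) y * gap j (V (time i) y))%:E)%E.
  by apply: emeasurable_sum => i; apply: mterm; exact: measurable_gap.
have mSmb : measurable_fun setT (fun y : 'M[R]_(D, T) => \sum_(i < T)
    (o (time i) y * (mean_best k (V (time i) y) + 1))%:E)%E.
  apply: emeasurable_sum => i.
  exact: (mterm Fmb).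
have := ge0_ae_eq_integral measurableT _ _ _ _ step_ae.
rewrite (ge0_integralD (f2 := cst 1%E) nu measurableT (fun y _ => S0 _ y))//.
rewrite (ge0_integralD nu measurableT (fun y _ => S0 _ y) (mS k)
  (fun y _ => Smb0 y) mSmb).
rewrite integral_cst//= probability_setT mul1e (IH o wo) Imb.
move=> H; have {}H := H _ _ _ _; move: H.
set I := integral _ _ _; move=> H.
have : (I + 1 = (c + b)%:E)%E.
  apply: H.
  - by apply: emeasurable_funD.
  - by apply: emeasurable_funD.
  - by move=> y _; rewrite adde_ge0.
  - by move=> y _; rewrite adde_ge0.
by case: I {H} => [r| |]//=; rewrite -EFinD => -[rE]; congr EFin; lra.
Qed.

End path.

(** * Small losses are nearly optimal *)

Lemma times_rcons (T : nat) : (0 < T)%N -> exists2 l : seq 'I_T.+1,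
  @times T = rcons l ord_max &
  size l = T.-1 /\ forall t, t \in l -> (0 < t)%N /\ t != ord_max.
Proof.
case: T => // n _; exists [seq lift ord0 (widen_ord (leqnSn n) i) | i <- enum 'I_n].
  rewrite timesE enum_ordSr map_rcons -map_comp; congr rcons.
  by apply: val_inj.
split=> [|t /mapP[i _ ->]]; first by rewrite size_map size_enum_ord.
split=> //; rewrite -(inj_eq val_inj)/= /bump/= add1n eqSS.
by rewrite neq_ltn ltn_ord.
Qed.

Section near_optimality.
Context {R : realType} {T D : nat}.
Hypothesis T_gt0 : (0 < T)%N.
Variable nu : probability 'M[R]_(D, T) R.
Variables (g : forall t : 'I_T.+1, 'M[R]_(D, t) -> R)
  (kappa : forall t : 'I_T.+1, R.-pker 'M[R]_(D, t) ~> 'M[R]_(D, T)).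
Hypothesis g_meas : forall t : 'I_T.+1, (0 < t)%N -> measurable_fun setT (@g t).
Hypothesis nu_kappa : forall t A B, measurable A -> measurable B ->
  nu (A `&` first_cols t @^-1` B) =
  (\int[nu]_(y in first_cols t @^-1` B) kappa t (first_cols t y) A)%E.
Hypothesis g01 : forall t : 'I_T.+1, (0 < t)%N ->
  {ae nu, forall y, 0 <= g (first_cols t y) <= 1}.

Local Notation V := first_cols.
Local Notation value := (value g kappa).
Local Notation best := (best g kappa).
Local Notation good := (good g kappa).
Local Notation likely := (likely g kappa).
Local Notation expect := (expect g kappa).

Definition mean_reward (o : 'I_T.+1 -> 'M[R]_(D, T) -> R) : \bar R :=
  (\int[nu]_y \sum_(i < T) (o (time i) y *
    value 0 (V (time i) y))%:E)%E.

(** By [gap_mean_invariant] the mean gap is one constant [c] for all weights.  The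
    reward is the gap plus a nonpositive value, so [c] bounds every mean reward
    from above, and it is within [eps] of the mean reward of weights that lose at
    most [eps] in value. *)
Lemma nearly_optimal k (eps : R) o o' : stopping_weights nu o ->
  stopping_weights nu o' -> 0 <= eps ->
  {ae nu, forall y, \sum_(i < T) o' (time i) y *
    - value k.+1 (V (time i) y) <= eps} ->
  (mean_reward o <= mean_reward o' + eps%:E)%E.
Proof.
move=> wo wo' eps0 loss; have [mo o0 _ _] := wo; have [mo' o'0 _ _] := wo'.
have [c gapE] := gap_mean_invariant T_gt0 g_meas nu_kappa k.+1.
have v0 i y : 0 <= value 0 (V (time i) y).
  by have /andP[] := value_bounds g kappa 0 (V (time i) y).
have vk i y : 0 <= - value k.+1 (V (time i) y).
  have /andP[_] := value_bounds g kappa k.+1 (V (time i) y).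
  by rewrite addNr oppr_ge0.
have mv j i : measurable_fun setT (fun G => value j (G : 'M[R]_(D, time i))).
  exact: measurable_value.
have msum (F : forall t : 'I_T.+1, 'M[R]_(D, t) -> R) :
    (forall i, measurable_fun setT (F (time i))) ->
    measurable_fun setT (fun y : 'M[R]_(D, T) => (\sum_(i < T)
      (o' (time i) y * F (time i) (V (time i) y))%:E)%E).
  by move=> mF; apply: emeasurable_sum => i; exact: measurable_path_term.
apply: (@le_trans _ _ c%:E).
  rewrite -(gapE o wo); apply: lower_integral_mono => y.
    by apply: sume_ge0 => i _; rewrite lee_fin mulr_ge0.
  apply: lee_sum => i _; rewrite lee_fin ler_wpM2l// /gap.
  by have := vk i y; lra.
have mN i : measurable_fun setT
    ((fun (t : 'I_T.+1) (G : 'M[R]_(D, t)) => - value k.+1 G) (time i)).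
  exact: measurableT_comp (mv _ _).
rewrite -(gapE o' wo').
under eq_integral => y _.
  rewrite (_ : \sum_(i < T) _ = \sum_(i < T) (o' (time i) y *
      value 0 (V (time i) y))%:E + \sum_(i < T) (o' (time i) y *
      - value k.+1 (V (time i) y))%:E)%E; last first.
    rewrite -big_split/=; apply: eq_bigr => i _.
    by rewrite -EFinD -mulrDr.
  over.
rewrite ge0_integralD//; last 4 first.
- by move=> y _; apply: sume_ge0 => i _; rewrite lee_fin mulr_ge0.
- exact: (msum (fun t G => value 0 G)).
- by move=> y _; apply: sume_ge0 => i _; rewrite lee_fin mulr_ge0.
- exact: (msum (fun t G => - value k.+1 G)).
apply: leeD => //.
apply: (@le_trans _ _ (\int[nu]_y (cst eps%:E y))%E); last first.
  by rewrite integral_cst//= probability_setT mule1.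
apply: ae_ge0_le_integral => //.
- by move=> y _; apply: sume_ge0 => i _; rewrite lee_fin mulr_ge0.
- exact: (msum (fun t G => - value k.+1 G)).
by apply: ae_imply loss => y ly _; rewrite sumEFin lee_fin.
Qed.

(** * Running the stopping algorithm *)

Section run.
Variable eps : R.
Hypothesis eps_gt0 : 0 < eps.
Hypothesis eps_lt1 : eps < 1.

Definition depth : nat := ceil_val (4 / eps).

Lemma depth_gt0 : (0 < depth)%N.
Proof. by apply: ceil_val_gt0; rewrite divr_gt0. Qed.

Lemma expect_decision (t : 'I_T.+1) (gamma : 'M[R]_(D, t)) h : t != ord_max ->
  expect (decision eps gamma) h =
  expect (Balg depth gamma (eps / 4) (eps / (4 * T%:R)))
    (fun v => h (- (1 / 2) * eps <= v)).
Proof. by move=> tT; rewrite /decision (negbTE tT) /= expect_bind. Qed.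

(** An estimate with error [eps / 4] separates the values above [- eps / 4] from
    those below [- 3 eps / 4] when it is compared with [- eps / 2]. *)
Lemma likely_decision (t : 'I_T.+1) (gamma : 'M[R]_(D, t)) : t != ord_max ->
  (0 < t)%N -> good depth gamma ->
  likely (decision eps gamma)
    [set b | if b then - (3 / 4 * eps) <= value depth gamma
             else value depth gamma < - (eps / 4)]
    (eps / (4 * T%:R)).
Proof.
move=> tT t0 gd; rewrite /likely expect_decision//.
have T1 : 1 <= T%:R :> R by rewrite ler1n.
have d01 : 0 < eps / (4 * T%:R) <= 1.
  have T4 : 0 < 4 * T%:R :> R by rewrite mulr_gt0 ?ltr0n.
  rewrite divr_gt0//= ler_pdivrMr// mul1r.
  apply: le_trans (ltW eps_lt1) (le_trans T1 _).
  by rewrite ler_peMl// ler1n.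
have e4 : 0 < eps / 4 by rewrite divr_gt0.
have := Balg_accurate T_gt0 g_meas t0 gd e4 d01.
move=> /le_trans; apply; apply: expect_mono => v; first exact: indic_EFin_ge0.
rewrite lee_fin !indicE ler_nat.
have [|//] := boolP (v \in _); rewrite inE /= ler_norml => /andP[v1 v2].
rewrite mem_set//=.
by have := eps_gt0; have [?|?] := lerP (- (1 / 2) * eps) v; lra.
Qed.

(** With correct decisions the run stops only where the value is at least
    [- 3 eps / 4], and it does not pass a time whose value is at least
    [- eps / 4]; without such a time it could be forced to stop at a bad [T]. *)
Lemma likely_run y (l : seq 'I_T.+1) :
  (forall t, t \in l -> [/\ (0 < t)%N, t != ord_max & good depth (V t y)]) ->
  (exists2 t, t \in rcons l ord_max & - (eps / 4) <= value depth (V t y)) ->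
  likely (run eps (rcons l ord_max) y)
    [set t | - (3 / 4 * eps) <= value depth (V t y)]
    ((size l)%:R * (eps / (4 * T%:R))).
Proof.
elim: l => [_ [t]|t l IH gl [s sl vs]] /=.
  rewrite inE => /eqP -> vT; rewrite mul0r /decision eqxx /=.
  apply: likely_ret => /=; apply: le_trans vT; have := eps_gt0; lra.
have [t0 tT gt] : [/\ (0 < t)%N, t != ord_max & good depth (V t y)].
  by apply: gl; rewrite inE eqxx.
have e0 : 0 <= eps / (4 * T%:R) by rewrite divr_ge0 ?mulr_ge0// ltW.
have -> : (size l).+1%:R * (eps / (4 * T%:R)) =
    eps / (4 * T%:R) + (size l)%:R * (eps / (4 * T%:R)).
  by rewrite -natr1 mulrDl mul1r addrC.
have le0 : 0 <= (size l)%:R * (eps / (4 * T%:R)) by rewrite mulr_ge0.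
apply: (likely_bind le0 (likely_decision tT t0 gt)) => -[vt|vt].
  have := @likely_ret R T D g kappa _ t
    [set t | - (3 / 4 * eps) <= value depth (V t y)] vt.
  by move/likely_weaken; apply.
apply: IH => [s' s'l|]; first by apply: gl; rewrite inE s'l orbT.
exists s => //; move: sl; rewrite inE => /predU1P[st|//].
by move: vt vs; rewrite -st => /lt_le_trans/[apply]; rewrite ltxx.
Qed.

(** The loss is at most [3 eps / 4] with probability [1 - eps / 4], and at most 1
    otherwise. *)
Lemma expected_loss_le y : extends_along kappa y ->
  (forall t : 'I_T.+1, (0 < t)%N -> good depth (V t y)) ->
  (expect (stop_alg eps y) (fun t => (- value depth (V t y))%:E) <= eps%:E)%E.
Proof.
move=> ey gy; have [k Kd] : exists k, depth = k.+1.
  by exists depth.-1; rewrite prednK// depth_gt0.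
have [l tl [sl lP]] := times_rcons T_gt0; have e0 := eps_gt0.
have v0 (t : 'I_T.+1) : 0 <= - value depth (V t y).
  by rewrite Kd; have /andP[_] := value_bounds g kappa k.+1 (V t y);
    rewrite addNr oppr_ge0.
have v1 (t : 'I_T.+1) : - value depth (V t y) <= 1.
  by rewrite Kd lerNl; have /andP[] := value_bounds g kappa k.+1 (V t y).
have near0 : exists2 t, t \in rcons l ord_max &
    - (eps / 4) <= value depth (V t y).
  have [t t0 bt] := best_ex T_gt0 g kappa depth y.
  exists t; first by rewrite -tl mem_times.
  rewrite -bt Kd; have := best_near0 T_gt0 g_meas k ey.
  have kge : 4 / eps <= k.+1%:R by rewrite -Kd; exact: ceil_val_ge.
  have : 0 <= - best k.+1 y.
    by have /andP[_] := best_bounds T_gt0 g kappa k.+1 y; rewrite addNr oppr_ge0.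
  move=> b0 kb.
  have : 4 / eps * - best k.+1 y <= 1.
    by apply: le_trans (ler_wpM2r b0 kge) _; rewrite mulrN.
  by rewrite mulrAC ler_pdivrMr// mul1r; lra.
have := likely_run (fun t tl' => And3 (lP t tl').1 (lP t tl').2 (gy t (lP t tl').1)) near0.
rewrite -tl -/(stop_alg eps y) sl.
set S := [set t | _]; set eta := (_ * _ : R) => lS.
have etale : eta <= eps / 4.
  rewrite /eta mulrA ler_pdivrMr ?mulr_gt0 ?ltr0n//.
  have : T.-1%:R <= T%:R :> R by rewrite ler_nat leq_pred.
  have : 0 <= eps by exact: ltW.
  by move=> ? ?; nra.
have W0 t : (0 <= (- value depth (V t y))%:E)%E by rewrite lee_fin.
have := expect_super g kappa (stop_alg eps y) W0 (indic_EFin_ge0 S).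
have : (expect (stop_alg eps y) (fun a : 'I_T.+1 =>
    (- value depth (V a y))%:E + (\1_S a)%:E) <= (1 + 3 / 4 * eps)%:E)%E.
  rewrite -(expect_cst g kappa (stop_alg eps y)).
  apply: expect_mono => t; first by rewrite adde_ge0// indic_EFin_ge0.
  rewrite -EFinD lee_fin indicE; have [|_] := boolP (t \in S).
    by rewrite inE /S/=; lra.
  by have := v1 t; rewrite addr0; lra.
move=> /[swap] /le_trans/[apply].
have : ((1 - eps / 4)%:E <= expect (stop_alg eps y) (fun a => (\1_S a)%:E))%E.
  by apply: le_trans lS; rewrite lee_fin; lra.
have E0 : (0 <= expect (stop_alg eps y) (fun a => (\1_S a)%:E))%E.
  by apply: expect_ge0; exact: indic_EFin_ge0.
have EW0 := expect_ge0 g kappa (stop_alg eps y) W0.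
move: E0 EW0; case: (expect _ (fun a => (\1_S a)%:E)) => [r| |]//;
  case: (expect _ (fun t => (- value depth (V t y))%:E)) => [r'| |]//=.
by rewrite -?EFinD !lee_fin; lra.
Qed.

End run.
End near_optimality.

(** * Programs with a measurable output law *)

Section median_measurability.
Context {R : realType}.

(** This turns order statistics into sums of indicators, whose measurability is
    immediate. *)
Lemma nth_sorted_le (x : seq R) i a : sorted <=%R x -> (i < size x)%N ->
  (x`_i <= a) = (i < count (fun v => (v <= a)%R) x)%N.
Proof.
move=> sx ix; have mono k j : (k <= j < size x)%N -> x`_k <= x`_j.
  move=> /andP[kj jx].
  apply: (sorted_leq_nth le_trans le_refl 0 sx) => //; rewrite inE//.
  exact: leq_ltn_trans jx.
apply/idP/idP => [xa|].
  rewrite -[x in count _ x](cat_take_drop i.+1) count_cat.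
  apply: leq_trans (leq_addr _ _).
  suff /eqP -> : count (fun v => v <= a) (take i.+1 x) == size (take i.+1 x).
    by rewrite size_take_min leq_min leqnn.
  rewrite -all_count; apply/(all_nthP 0) => k.
  rewrite size_take_min leq_min => /andP[ki _]; rewrite nth_take//.
  by apply: le_trans xa; apply: mono; rewrite -ltnS ki.
apply: contraTT; rewrite -ltNge -leqNgt => xa.
rewrite -[x in count _ x](cat_take_drop i) count_cat.
have -> : count (fun v => v <= a) (drop i x) = 0%N.
  apply/eqP; rewrite -leqn0 leqNgt -has_count -all_predC.
  apply/(all_nthP 0) => k; rewrite size_drop => kx; rewrite nth_drop/= -ltNge.
  by apply: lt_le_trans xa _; apply: mono; rewrite leq_addr -ltn_subRL.
by rewrite addn0; apply: leq_trans (count_size _ _) _; rewrite size_take_min geq_minl.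
Qed.

Lemma measurable_nth_sort n i :
  measurable_fun setT (fun l : n.-tuple R => (sort <=%R l)`_i).
Proof.
have [ni|i_n] := leqP n i.
  under eq_fun => l do rewrite nth_default ?size_sort ?size_tuple//.
  exact: measurable_cst.
apply: (measurability _ (RGenOInfty.measurableE R)).
move=> _ [_ [a ->] <-]; rewrite setTI.
pose c (l : n.-tuple R) : R := \sum_(j < n) ((tnth l j <= a)%R)%:R.
have mc : measurable_fun setT c.
  apply: measurable_sum => j.
  have mj : measurable_fun setT (fun l : n.-tuple R => tnth l j <= a).
    by apply: measurable_fun_ler => //; exact: measurable_tnth.
  have mb : measurable_fun setT (fun b : bool => b%:R : R) by [].
  exact: (measurableT_comp mb mj).
have -> : (fun l : n.-tuple R => (sort <=%R l)`_i) @^-1` `]a, +oo[%classic =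
    ~` (c @^-1` `]i%:R, +oo[%classic).
  have cE l : c l = (count (fun v => (v <= a)%R) l)%:R.
    rewrite -sum1_count natr_sum big_mkcond big_tuple; apply: eq_bigr => j _.
    by case: ifP.
  have lE (l : n.-tuple R) :
      ((sort <=%R l)`_i <= a) = (i < count (fun v => (v <= a)%R) l)%N.
    rewrite nth_sorted_le ?size_sort ?size_tuple// ?sort_le_sorted//.
    by congr (_ < _)%N; apply/permP; rewrite perm_sort.
  by apply/seteqP; split=> l /=; rewrite !in_itv/= !andbT cE ltr_nat -lE ltNge => /negP.
apply: measurableC; rewrite -[X in measurable X]setTI.
by apply: mc => //; exact: measurable_itv.
Qed.

Lemma measurable_median n :
  measurable_fun setT (fun l : n.-tuple R => median_val l).
Proof.
rewrite (_ : (fun l : n.-tuple R => median_val l) = fun l =>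
    ((sort <=%R l)`_(n.+1./2.-1) + (sort <=%R l)`_(n./2)) / 2); last first.
  by apply/funext => l; rewrite /median_val size_tuple.
by apply: measurable_funM => //; apply: measurable_funD;
  exact: measurable_nth_sort.
Qed.

Lemma measurable_maxl_tuple n :
  measurable_fun setT (fun l : n.-tuple R => maxl l).
Proof.
under eq_fun => l do rewrite -{1}(map_tnth_enum l).
apply: (measurable_maxl (f := fun i (l : n.-tuple R) => tnth l i)) => i _.
exact: measurable_tnth.
Qed.

Lemma measurable_sum_tuple n :
  measurable_fun setT (fun l : n.-tuple R => \sum_(x <- l) x).
Proof.
under eq_fun => l do rewrite big_tuple.
by apply: measurable_sum => i; exact: measurable_tnth.
Qed.

End median_measurability.

Section regular.
Context {R : realType} {T D : nat}.
Hypothesis T_gt0 : (0 < T)%N.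
Variables (g : forall t : 'I_T.+1, 'M[R]_(D, t) -> R)
  (kappa : forall t : 'I_T.+1, R.-pker 'M[R]_(D, t) ~> 'M[R]_(D, T)).
Hypothesis g_meas : forall t : 'I_T.+1, (0 < t)%N -> measurable_fun setT (@g t).
Local Notation prog A := (@prog R T D A).
Local Notation expect := (expect g kappa).
Local Notation "x <- p ;; q" := (bind p (fun x => q))
  (at level 100, p at next level, q at level 200, right associativity).

(** The answer type [A] of a program carries no measurable structure; [emb] lends
    it the one of [B] (lists are tuples of a known size, times are naturals).
    The integrand [h] in [regular_meas] may depend on further parameters [Z],
    since in a sequence of two programs the second one sees, and integrates over,
    the answer of the first.  Additivity is stated separately because the integral
    is additive for measurable integrands only. *)
Record regular dX (X : measurableType dX) dB (B : measurableType dB) A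
    (emb : B -> A) (p : X -> prog A) : Prop := Regular {
  regular_meas : forall dZ (Z : measurableType dZ) (u : Z -> X)
      (h : Z -> A -> \bar R),
    measurable_fun setT u -> (forall z a, 0 <= h z a)%E ->
    measurable_fun setT (fun zb : Z * B => h zb.1 (emb zb.2)) ->
    measurable_fun setT (fun z => expect (p (u z)) (h z));
  regular_add : forall x (h1 h2 : A -> \bar R),
    (forall a, 0 <= h1 a)%E -> (forall a, 0 <= h2 a)%E ->
    measurable_fun setT (h1 \o emb) -> measurable_fun setT (h2 \o emb) ->
    (expect (p x) (fun a => h1 a + h2 a) = expect (p x) h1 + expect (p x) h2)%E;
  regular_ext : forall x (h1 h2 : A -> \bar R),
    (forall b, h1 (emb b) = h2 (emb b)) -> expect (p x) h1 = expect (p x) h2 }.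

Lemma regular_eq dX (X : measurableType dX) dB (B : measurableType dB) A
    (emb : B -> A) (p q : X -> prog A) :
  (forall x h, expect (p x) h = expect (q x) h) -> regular emb q ->
  regular emb p.
Proof.
move=> pq [mq aq eq_]; split.
- move=> dZ Z u h mu h0 mh; under eq_fun do rewrite pq; exact: mq.
- by move=> x h1 h2 *; rewrite !pq; exact: aq.
- by move=> x h1 h2 h12; rewrite !pq; exact: eq_.
Qed.

Lemma regular_comp dX (X : measurableType dX) dY (Y : measurableType dY)
    dB (B : measurableType dB) A (emb : B -> A) (p : X -> prog A) (v : Y -> X) :
  measurable_fun setT v -> regular emb p -> regular emb (fun y => p (v y)).
Proof.
move=> mv [mp ap ep]; split.
- move=> dZ Z u h mu h0 mh; apply: (mp _ _ (v \o u)) => //.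
  exact: measurableT_comp.
- by move=> x; exact: ap.
- by move=> x; exact: ep.
Qed.

Lemma regular_ret dX (X : measurableType dX) dB (B : measurableType dB) A
    (emb : B -> A) (f : X -> B) : measurable_fun setT f ->
  regular emb (fun x => Ret (emb (f x))).
Proof.
move=> mf; split => //= dZ Z u h mu h0 mh.
have mzf : measurable_fun setT (fun z => (z, f (u z))).
  by apply: measurable_fun_pair => //; exact: (measurableT_comp mf mu).
exact: (measurableT_comp mh mzf).
Qed.

Lemma regular_bind dX (X : measurableType dX) dB (B : measurableType dB) A
    (emb : B -> A) dB' (B' : measurableType dB') A' (emb' : B' -> A')
    (p : X -> prog A) (f : X -> A -> prog A') :
  regular emb p -> regular emb' (fun xb : X * B => f xb.1 (emb xb.2)) ->
  regular emb' (fun x => bind (p x) (f x)).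
Proof.
move=> [mp ap ep] [mf af ef].
have mfh x h : (forall a, 0 <= h a)%E -> measurable_fun setT (h \o emb') ->
    measurable_fun setT ((fun a => expect (f x a) h) \o emb).
  move=> h0 mh; apply: (mf _ _ (fun b => (x, b)) (fun=> h)) => //.
    exact: measurable_fun_pair.
  by apply: (measurableT_comp mh).
split.
- move=> dZ Z u h mu h0 mh; under eq_fun do rewrite expect_bind.
  apply: (mp _ _ u (fun z a => expect (f (u z) a) (h z))) => //.
    by move=> z a; exact: expect_ge0.
  apply: (mf _ _ (fun zb => (u zb.1, zb.2)) (fun zb => h zb.1)) => //.
    by apply: measurable_fun_pair => //; exact: (measurableT_comp mu).
  have mz : measurable_fun setT (fun zbb : (Z * B) * B' => (zbb.1.1, zbb.2)).
    apply: measurable_fun_pair => //.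
    exact: (measurableT_comp measurable_fst measurable_fst).
  exact: (measurableT_comp mh mz).
- move=> x h1 h2 h10 h20 mh1 mh2; rewrite !expect_bind -ap//.
  + by apply: ep => b; apply: (af (x, b)).
  + by move=> a; exact: expect_ge0.
  + by move=> a; exact: expect_ge0.
  + exact: mfh.
  + exact: mfh.
- move=> x h1 h2 h12; rewrite !expect_bind; apply: ep => b.
  exact: (ef (x, b)).
Qed.

Lemma regular_map dX (X : measurableType dX) dB (B : measurableType dB) A
    (emb : B -> A) dB' (B' : measurableType dB') A' (emb' : B' -> A')
    (p : X -> prog A) (phi : X -> A -> A') (psi : X * B -> B') :
  regular emb p -> measurable_fun setT psi ->
  (forall x b, phi x (emb b) = emb' (psi (x, b))) ->
  regular emb' (fun x => a <- p x ;; Ret (phi x a)).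
Proof.
move=> rp mpsi phiE; apply: regular_bind rp _.
by apply: (regular_eq _ (regular_ret _ mpsi)) => -[x b] h /=; rewrite phiE.
Qed.

Lemma regular_simulate dX (X : measurableType dX) (t : 'I_T.+1)
    (f : X -> 'M[R]_(D, t)) : measurable_fun setT f ->
  regular id (fun x => simulate (f x)).
Proof.
move=> mf; split => /=.
- move=> dZ Z u h mu h0 mh.
  have mfu : measurable_fun setT (f \o u) by exact: measurableT_comp.
  exact: (measurable_fun_integral_sfinite_kernel
    (fun zM => h zM.1 zM.2) (kernel_comp_fun (kappa t) mfu)).
- by move=> x h1 h2 h10 h20 mh1 mh2; rewrite ge0_integralD.
- by move=> x h1 h2 h12; apply: eq_integral => M _.
Qed.

Lemma regular_foreach dX (X : measurableType dX) I (s : seq I)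
    (p : I -> X -> prog R) : (forall i, List.In i s -> regular id (p i)) ->
  regular (fun l : (size s).-tuple R => tval l)
    (fun x => foreach s (fun i => p i x)).
Proof.
elim: s dX X p => [|i s IH] dX X p rp.
  exact: (@regular_ret _ X _ (0.-tuple R) _ (fun l => tval l)
    (cst [tuple]) (measurable_cst _)).
apply: (regular_bind (rp i (or_introl erefl))).
have {IH}IH := IH _ (X * R)%type (fun j xb => p j xb.1)
  (fun j sj => regular_comp (measurable_fst) (rp j (or_intror sj))).
apply: (regular_map (psi := fun xbl : (X * R) * (size s).-tuple R =>
    [the (size s).+1.-tuple R of xbl.1.2 :: xbl.2]) IH) => //.
by apply: measurable_cons => //; exact: measurableT_comp.
Qed.

Lemma regular_if dX (X : measurableType dX) dB (B : measurableType dB) A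
    (emb : B -> A) (p q : X -> prog A) : regular emb p -> regular emb q ->
  regular emb (fun xb : X * bool => if xb.2 then p xb.1 else q xb.1).
Proof.
move=> [mp ap ep] [mq aq eq_]; split.
- move=> dZ Z u h mu h0 mh.
  have mu1 : measurable_fun setT (fun z => (u z).1) by exact: measurableT_comp.
  have mu2 : measurable_fun setT (fun z => (u z).2) by exact: measurableT_comp.
  have mP := mp _ _ _ h mu1 h0 mh; have mQ := mq _ _ _ h mu1 h0 mh.
  have := measurable_fun_ifT mu2 mP mQ.
  by apply: eq_measurable_fun => z _; case: (u z).2.
- by move=> [x []] h1 h2 *; [exact: ap|exact: aq].
- by move=> [x []] h1 h2 *; [exact: ep|exact: eq_].
Qed.

End regular.

(** * The output law of the stopping algorithm *)

Section output_law.
Context {R : realType} {T D : nat}.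
Hypothesis T_gt0 : (0 < T)%N.
Variables (g : forall t : 'I_T.+1, 'M[R]_(D, t) -> R)
  (kappa : forall t : 'I_T.+1, R.-pker 'M[R]_(D, t) ~> 'M[R]_(D, T)).
Hypothesis g_meas : forall t : 'I_T.+1, (0 < t)%N -> measurable_fun setT (@g t).
Local Notation prog A := (@prog R T D A).
Local Notation expect := (expect g kappa).
Local Notation regular := (regular g kappa).
Local Notation "x <- p ;; q" := (bind p (fun x => q))
  (at level 100, p at next level, q at level 200, right associativity).

Lemma regular_evaluate (t : 'I_T.+1) : (0 < t)%N ->
  regular id (fun gamma : 'M[R]_(D, t) => evaluate gamma).
Proof.
move=> t0; exact: (regular_eq _ (regular_ret g kappa id (g_meas t0))).
Qed.

(** Up to the deterministic steps, the algorithm is built from simulations, loops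
    and measurable functions of their answers. *)
Lemma regular_Balg k (t : 'I_T.+1) e delta : (0 < t)%N ->
  regular id (fun gamma : 'M[R]_(D, t) => Balg k gamma e delta).
Proof.
elim: k t e delta => [|k IH] t e delta t0; first exact: regular_evaluate.
have reg_est : regular id (fun gamma : 'M[R]_(D, t) => estimate_best k gamma e).
  apply: (@regular_eq _ _ _ _ _ _ _ _ _ _ _ _ (fun gamma : 'M[R]_(D, t) =>
      A1 <- simulate gamma ;;
      A2 <- foreach (@times T) (fun j => Balg k (first_cols j A1) (e / 4)
        (1 / (16 * ((samples e)%:R * T%:R)))) ;; Ret (maxl A2))).
    move=> gamma h; rewrite !expect_bind; apply: eq_expect => M.
    by rewrite !expect_bind; apply: eq_expect => l; rewrite expect_maxp.
  apply: (regular_bind (regular_simulate g kappa (@measurable_id _ _ setT))).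
  apply: (regular_map (emb' := id) (psi := fun x => maxl (tval x.2))
    (emb := fun l : (size (@times T)).-tuple R => tval l)) => //.
    apply: (regular_foreach (p := fun j (x : 'M[R]_(D, t) * 'M[R]_(D, T)) =>
      Balg k (first_cols j x.2) (e / 4) (1 / (16 * ((samples e)%:R * T%:R))))).
    move=> j /In_mem; rewrite mem_times => j0.
    apply: (regular_comp (v := fun x : 'M[R]_(D, t) * 'M[R]_(D, T) =>
      first_cols j x.2) _ (IH j _ _ j0)).
    have := measurableT_comp (@measurable_first_cols R T D j)
      (@measurable_snd _ _ 'M[R]_(D, t) 'M[R]_(D, T)).
    by apply.
  exact: (measurableT_comp (@measurable_maxl_tuple R _) measurable_snd).
have reg_trial : regular id (fun gamma : 'M[R]_(D, t) => trial k gamma e).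
  apply: (@regular_eq _ _ _ _ _ _ _ _ _ _ _ _ (fun gamma : 'M[R]_(D, t) =>
      A3 <- Balg k gamma (e / 2) (1 / 8) ;;
      A0 <- foreach (iota 0 (samples e)) (fun=> estimate_best k gamma e) ;;
      Ret (A3 - (\sum_(x <- A0) x) / (samples e)%:R))).
    move=> gamma h; rewrite !expect_bind; apply: eq_expect => A3.
    rewrite !expect_bind; apply: eq_expect => l.
    by rewrite expect_bind expect_sump.
  apply: (regular_bind (IH t _ _ t0)).
  apply: (regular_map (emb' := id)
    (psi := fun x : ('M[R]_(D, t) * R) * (size (iota 0 (samples e))).-tuple R =>
      x.1.2 - (\sum_(v <- tval x.2) v) / (samples e)%:R)
    (emb := fun l : (size (iota 0 (samples e))).-tuple R => tval l)) => //.
    apply: (regular_foreach (p := fun _ (x : 'M[R]_(D, t) * R) =>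
      estimate_best k x.1 e)) => _ _.
    exact: (regular_comp measurable_fst reg_est).
  apply: measurable_funB.
    exact: (measurableT_comp measurable_snd measurable_fst).
  apply: measurable_funM => //.
  exact: (measurableT_comp (@measurable_sum_tuple R _) measurable_snd).
apply: (@regular_eq _ _ _ _ _ _ _ _ _ _ _ _ (fun gamma : 'M[R]_(D, t) =>
    l <- foreach (iota 0 (trials delta)) (fun=> trial k gamma e) ;;
    Ret (median_val l))).
  by move=> gamma h; rewrite expect_BalgS expect_bind.
apply: (regular_map (emb' := id) (psi := fun x => median_val (tval x.2))
  (emb := fun l : (size (iota 0 (trials delta))).-tuple R => tval l)) => //.
  exact: (regular_foreach (p := fun _ (x : 'M[R]_(D, t)) => trial k x e)).
exact: (measurableT_comp (@measurable_median R _) measurable_snd).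
Qed.

Lemma regular_decision (t : 'I_T.+1) eps : (0 < t)%N ->
  regular id (fun gamma : 'M[R]_(D, t) => decision eps gamma).
Proof.
move=> t0; have [tT|tT] := boolP (t == ord_max).
  apply: (@regular_eq _ _ _ _ _ _ _ _ _ _ _ _ (fun=> Ret true)).
    by move=> gamma h; rewrite /decision tT.
  exact: (regular_ret g kappa id (@measurable_cst _ _ _ _ setT true)).
apply: (@regular_eq _ _ _ _ _ _ _ _ _ _ _ _ (fun gamma : 'M[R]_(D, t) =>
    v <- Balg (depth eps) gamma (eps / 4) (eps / (4 * T%:R)) ;;
    Ret (- (1 / 2) * eps <= v))).
  by move=> gamma h; rewrite expect_decision// expect_bind.
apply: (regular_map (emb' := id)
  (psi := fun x : 'M[R]_(D, t) * R => - (1 / 2) * eps <= x.2)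
  (regular_Balg _ _ _ t0)) => //.
exact: measurable_fun_ler.
Qed.

(** The finite set of times is given the measurable structure of [nat] by
    truncation. *)
Lemma regular_run eps (s : seq 'I_T.+1) : (forall t, t \in s -> (0 < t)%N) ->
  regular (fun n : nat => inord n : 'I_T.+1) (fun y => run eps s y).
Proof.
have reg_ret (t : 'I_T.+1) : regular (fun n : nat => inord n : 'I_T.+1)
    (fun _ : 'M[R]_(D, T) => Ret t).
  have := @regular_ret _ _ _ g kappa _ 'M[R]_(D, T) _ nat _
    (fun n : nat => inord n : 'I_T.+1) (cst (t : nat)) (measurable_cst _).
  by under [X in regular _ X]eq_fun do rewrite /= inord_val.
elim: s => [_|t s IH s0] /=; first exact: reg_ret.
have t0 : (0 < t)%N by rewrite s0// mem_head.
have rd : regular id (fun y : 'M[R]_(D, T) => decision eps (first_cols t y)).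
  have := regular_comp (@measurable_first_cols R T D t) (regular_decision eps t0).
  by apply.
apply: (regular_bind rd).
apply: (regular_if (reg_ret t) (IH _)) => j js.
by rewrite s0// inE js orbT.
Qed.

Lemma regular_stop_alg eps :
  regular (fun n : nat => inord n : 'I_T.+1) (fun y => stop_alg eps y).
Proof. by apply: regular_run => t; rewrite mem_times. Qed.

Definition law eps (t : 'I_T.+1) (y : 'M[R]_(D, T)) : \bar R :=
  out_prob g kappa (stop_alg eps y) t.

Lemma law_ge0 eps t y : (0 <= law eps t y)%E.
Proof. by apply: expect_ge0 => a; rewrite lee_fin. Qed.

Lemma measurable_law eps t : measurable_fun setT (law eps t).
Proof.
apply: (regular_meas (regular_stop_alg eps) (u := id)
  (h := fun _ b => (b == t)%:R%:E)) => [|_ a|].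
- exact: measurable_id.
- by rewrite lee_fin.
have mnat (f : nat -> \bar R) : measurable_fun setT f by [].
exact: (measurableT_comp (mnat (fun n => (inord n == t)%:R%:E)) measurable_snd).
Qed.

(** Total mass 1 needs additivity of the expectation, not just superadditivity;
    this is what regularity of the program provides. *)
Lemma sum_law eps y : (\sum_(t < T.+1) law eps t y = 1)%E.
Proof.
have mnat (f : nat -> \bar R) : measurable_fun setT f by [].
have expect_sum (I : Type) (s : seq I) (h : I -> 'I_T.+1 -> \bar R) :
    (forall i a, 0 <= h i a)%E ->
    (expect (stop_alg eps y) (fun a => \sum_(i <- s) h i a) =
     \sum_(i <- s) expect (stop_alg eps y) (h i))%E.
  move=> h0; elim: s => [|i s IH].
    rewrite big_nil; under eq_expect do rewrite big_nil.
    exact: expect_cst.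
  under eq_expect do rewrite big_cons.
  rewrite big_cons -IH (regular_add (regular_stop_alg eps))//.
  by move=> a; exact: sume_ge0.
rewrite /law /out_prob -expect_sum => [|t a]; last by rewrite lee_fin.
rewrite -[RHS](expect_cst g kappa (stop_alg eps y)); apply: eq_expect => a.
rewrite (bigD1 a)//= eqxx big1 ?adde0// => t ta.
by rewrite eq_sym (negbTE ta).
Qed.

Lemma run_eq0 eps s y (h : 'I_T.+1 -> \bar R) :
  (forall t, t \in s -> h t = 0%E) -> h ord_max = 0%E ->
  expect (run eps s y) h = 0%E.
Proof.
move=> + hT; elim: s => [//|t s IH] ht /=.
rewrite expect_bind -[RHS](expect_cst g kappa (decision eps (first_cols t y))).
apply: eq_expect => -[] /=; first by rewrite ht// mem_head.
by rewrite IH// => j js; rewrite ht// inE js orbT.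
Qed.

Lemma law0 eps y : law eps ord0 y = 0%E.
Proof.
apply: run_eq0 => [t|]; last by case: eqP T_gt0 => // /(congr1 val)/= ->.
by rewrite mem_times; case: eqP => // ->.
Qed.

(** The decision to stop at [s] only reads the path up to [s]. *)
Lemma law_first_cols eps (s t : 'I_T.+1) y y' : (s <= t)%N ->
  first_cols t y = first_cols t y' -> law eps s y = law eps s y'.
Proof.
move=> st yy'.
have yr (r : 'I_T.+1) : (r <= t)%N -> first_cols r y = first_cols r y'.
  by move=> rt; exact: first_cols_le rt yy'.
have stimes : sorted (fun a b : 'I_T.+1 => (a < b)%N) (@times T).
  apply: sorted_filter; first by move=> a b c; exact: ltn_trans.
  have := iota_ltn_sorted 0 T.+1; rewrite -val_enum_ord sorted_map.
  by [].
rewrite /law /out_prob /stop_alg; move: (@times T) stimes => l.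
elim: l => [//|r l IH] /= rl.
rewrite !expect_bind; have [rt|tr] := leqP r t.
  rewrite yr//; apply: eq_expect => -[]//; apply: IH.
  exact: path_sorted rl.
have gt_s : forall j, j \in r :: l -> (s < j)%N.
  move=> j; rewrite inE => /predU1P[->|jl]; first exact: leq_ltn_trans st tr.
  apply: leq_ltn_trans st (ltn_trans tr _).
  have := rl; rewrite path_sortedE; last by move=> a b c; exact: ltn_trans.
  by case/andP => /allP/(_ j jl).
have neq0 j : (s < j)%N -> ((j == s)%:R%:E : \bar R) = 0%E.
  by move=> sj; rewrite gt_eqF//.
have sT : (s < @ord_max T)%N.
  by apply: leq_ltn_trans st _; apply: leq_trans tr (leq_ord _).
by rewrite -![LHS]expect_bind -![RHS]expect_bind -/(run eps (r :: l) y)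
  -/(run eps (r :: l) y') !run_eq0 ?neq0// => j /gt_s/neq0.
Qed.

End output_law.

(** * Running time *)

Section running_time.
Context {R : realType} {T D : nat}.
Variables (g : forall t : 'I_T.+1, 'M[R]_(D, t) -> R) (C G : R).
Local Notation prog A := (@prog R T D A).
Local Notation time_le := (time_le g C G).

Lemma time_le_weaken A (p : prog A) (b b' : R) :
  b <= b' -> time_le p b -> time_le p b'.
Proof.
elim: p b b' => [a|o x y k IH|x k IH|x k IH|x y k IH|s k IH|t gamma k IH|
  t gamma k IH] b b' /= bb'; first by move=> b0; exact: le_trans bb'.
all: try (by apply: IH; lra).
- by move=> H M; apply: IH (H M); lra.
Qed.

Lemma time_le_bind A B (p : prog A) (f : A -> prog B) (b b' : R) :
  time_le p b -> (forall a, time_le (f a) b') -> time_le (bind p f) (b + b').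
Proof.
move=> + fb'; elim: p b => [a|o x y k IH|x k IH|x k IH|x y k IH|s k IH|
  t gamma k IH|t gamma k IH] b /=.
- by move=> b0; apply: time_le_weaken (fb' a); lra.
all: try (by move/IH; apply: time_le_weaken; lra).
- by move=> H M; apply: time_le_weaken (IH M _ (H M)); lra.
Qed.

Lemma bind_assoc A B A' (p : prog A) (f : A -> prog B) (k : B -> prog A') :
  bind (bind p f) k = bind p (fun a => bind (f a) k).
Proof.
elim: p => [//|o x y h IH|x h IH|x h IH|x y h IH|s h IH|t gamma h IH|
  t gamma h IH] /=; by congr (_ _); apply/funext => z; exact: IH.
Qed.

(** The time of a loop is stated together with its continuation, which may be
    charged for the length of the list of answers. *)
Lemma time_le_foreach I A B (s : seq I) (f : I -> prog A) (k : seq A -> prog B)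
    (b b' : R) : (forall i, time_le (f i) b) ->
  (forall l, size l = size s -> time_le (k l) b') ->
  time_le (bind (foreach s f) k) ((size s)%:R * b + b').
Proof.
move=> fb; elim: s k => [|i s IH] k kb'.
  by rewrite mul0r add0r; exact: kb'.
have -> : (size (i :: s))%:R * b + b' = b + ((size s)%:R * b + b').
  by rewrite /= -natr1 mulrDl mul1r addrAC addrC.
rewrite /= bind_assoc; apply: time_le_bind => // a.
by rewrite bind_assoc /=; apply: IH => l sl; apply: kb'; rewrite /= sl.
Qed.

Lemma time_le_fold_arith o x (s : seq R) : time_le (fold_arith o x s) (size s)%:R.
Proof.
elim: s x => [x|y s IH x]; first exact: lexx.
by apply: time_le_weaken (IH _); rewrite lerBrDr natr1.
Qed.

Lemma time_le_maxp (s : seq R) : time_le (maxp s) (size s)%:R.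
Proof.
apply: time_le_weaken (time_le_fold_arith _ _ _).
by rewrite ler_nat size_behead leq_pred.
Qed.

Lemma time_le_sump (s : seq R) : time_le (sump s) (size s)%:R.
Proof.
apply: time_le_weaken (time_le_fold_arith _ _ _).
by rewrite ler_nat size_behead leq_pred.
Qed.

Hypotheses (T_gt0 : (0 < T)%N) (C_ge0 : 0 <= C) (G_ge0 : 0 <= G).

(** The factor 736 covers the loops and the arithmetic of one level, and
    [33 / e ^+ 2] bounds the number of samples.  The product is locked so that it
    is never computed. *)
Definition level_factor : R := locked (736 * 33 ^+ 2).

Lemma level_factor_ge1 : 1 <= level_factor.
Proof. by rewrite /level_factor -lock; lra. Qed.

Fixpoint cost (k : nat) (e : R) : R :=
  if k is k'.+1 then level_factor * T%:R ^+ 2 / e ^+ 4 * cost k' (e / 4) else 1.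

Lemma ge1T : 1 <= T%:R :> R.
Proof. by rewrite ler1n. Qed.

Lemma cost_ge1 k e : 0 < e <= 1 -> 1 <= cost k e.
Proof.
elim: k e => [//|k IH] e /andP[e0 e1] /=.
have e4 : 0 < e / 4 <= 1 by apply/andP; split; lra.
apply: mulr_ege1 (IH _ e4); apply: mulr_ege1.
  by apply: mulr_ege1; [exact: level_factor_ge1|rewrite exprn_ege1// ge1T].
by rewrite invf_ge1 ?exprn_gt0// exprn_ile1// ltW.
Qed.

Lemma cost_antitone k e e' : 0 < e -> e <= e' -> cost k e' <= cost k e.
Proof.
elim: k e e' => [//|k IH] e e' e0 ee' /=.
have e'0 : 0 < e' by exact: lt_le_trans ee'.
have f0 : 0 <= level_factor := le_trans ler01 level_factor_ge1.
have cost0 j x : 0 < x -> 0 <= cost j x.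
  elim: j x => [//|j IHj] x x0 /=.
  by rewrite !mulr_ge0 ?invr_ge0 ?exprn_ge0 ?IHj ?divr_gt0// ltW.
apply: ler_pM.
- by rewrite !mulr_ge0 ?invr_ge0 ?exprn_ge0// ltW.
- by apply: cost0; rewrite divr_gt0.
- rewrite ler_wpM2l ?mulr_ge0 ?exprn_ge0// lef_pV2 ?posrE ?exprn_gt0//.
  by rewrite lerXn2r// nnegrE ltW.
- by apply: IH; lra.
Qed.

Lemma trials_le delta : 0 < delta <= 1 -> (trials delta)%:R <= 16 / delta :> R.
Proof.
move=> /andP[d0 d1].
have d2 : 2 <= 2 / delta by rewrite ler_pdivlMr//; lra.
have ln0 : 0 <= ln (2 / delta) by rewrite ln_ge0//; lra.
have lnle : ln (2 / delta) <= 2 / delta - 1.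
  have H : -1 < 2 / delta - 1 by lra.
  by have := le_ln1Dx H; rewrite [1 + _]addrC subrK.
apply: le_trans (ltW (ceil_val_lt _)) _; first by rewrite mulr_ge0.
have -> : 16 / delta = 8 * (2 / delta) by field; rewrite gt_eqF.
lra.
Qed.

Lemma e_ge : 13 / 5 <= expR 1 :> R.
Proof.
have -> : 1 = 1 / 16 * 16%:R :> R by lra.
rewrite expRM_natr.
apply: (@le_trans _ _ ((17 / 16) ^+ 16)); first by lra.
have le_e : 17 / 16 <= expR (1 / 16) :> R.
  by apply: le_trans (expR_ge1Dx _); lra.
by rewrite lerXn2r// nnegrE ?expR_ge0//; lra.
Qed.

Lemma expR_nat_ge n (c : R) : c <= (13 / 5) ^+ n -> c <= expR n%:R.
Proof.
move=> /le_trans; apply; rewrite -[n%:R]mul1r expRM_natr.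
by rewrite lerXn2r ?e_ge// nnegrE ?expR_ge0//; lra.
Qed.

Lemma ln32_le : ln 32 <= 4 :> R.
Proof.
rewrite -[leRHS]expRK ler_ln ?posrE ?expR_gt0//.
by apply: (@expR_nat_ge 4); lra.
Qed.

Lemma samples_le e : 0 < e <= 1 -> (samples e)%:R <= 33 / e ^+ 2 :> R.
Proof.
move=> /andP[e0 e1].
have e2 : 1 <= 1 / e ^+ 2.
  by rewrite div1r invf_ge1 ?exprn_gt0// exprn_ile1// ltW.
have -> : 33 / e ^+ 2 = 32 * (1 / e ^+ 2) + 1 / e ^+ 2 by ring.
have lnE : 2 / (1 / 16) = 32 :> R by field.
have ln0 : 0 <= ln (2 / (1 / 16)) :> R by rewrite lnE ltW// ln32_gt0.
have arg0 : 0 <= 1 / (2 * (e / 4 * (e / 4))) * ln (2 / (1 / 16)).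
  by rewrite mulr_ge0// divr_ge0// !mulr_ge0// ltW.
apply: le_trans (ltW (ceil_val_lt arg0)) _; apply: lerD => //.
rewrite lnE.
have -> : 1 / (2 * (e / 4 * (e / 4))) = 8 * (1 / e ^+ 2).
  by field; rewrite gt_eqF.
have := ln32_le; set z := 1 / e ^+ 2 in e2 *; nra.
Qed.

Lemma time_le_BalgS k (t : 'I_T.+1) (gamma : 'M[R]_(D, t)) e delta b :
  time_le (bind (foreach (iota 0 (trials delta)) (fun=> trial k gamma e))
    (fun l => medianp l)) b ->
  time_le (Balg k.+1 gamma e delta) (b + 16).
Proof.
by move=> H; rewrite /=; apply: time_le_weaken H; lra.
Qed.

Lemma time_le_estimate k (t : 'I_T.+1) (gamma : 'M[R]_(D, t)) e b :
  (forall (j : 'I_T.+1) (G : 'M[R]_(D, j)),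
    time_le (Balg k G (e / 4) (1 / (16 * ((samples e)%:R * T%:R)))) b) ->
  time_le (estimate_best k gamma e) (C + (T%:R * b + T%:R)).
Proof.
move=> kb; apply: (@time_le_bind _ _ (simulate gamma)) => [|M] /=.
  by move=> M; rewrite subrr.
rewrite -[in X in X * b](@size_times T); apply: time_le_foreach => // l sl.
by apply: time_le_weaken (time_le_maxp l); rewrite sl size_times.
Qed.

Lemma time_le_trial k (t : 'I_T.+1) (gamma : 'M[R]_(D, t)) e b b' :
  time_le (Balg k gamma (e / 2) (1 / 8)) b ->
  time_le (estimate_best k gamma e) b' ->
  time_le (trial k gamma e)
    (b + ((samples e)%:R * b' + ((samples e)%:R + 2))).
Proof.
move=> kb eb; apply: time_le_bind => // A3.
rewrite -[in X in X * b'](size_iota 0 (samples e)).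
apply: time_le_foreach => // l; rewrite size_iota => sl.
apply: time_le_bind; first by rewrite -sl; exact: time_le_sump.
by move=> s /=; lra.
Qed.

(** One level of recursion multiplies the time by at most the square of the
    number of samples (once for the loop, once for the precision of the calls)
    and of [T], up to a constant, and divides the accuracy by 4. *)
Lemma time_le_Balg k (t : 'I_T.+1) (gamma : 'M[R]_(D, t)) e delta :
  0 < e <= 1 -> 0 < delta <= 1 ->
  time_le (Balg k gamma e delta) ((C + G + 1) / delta * cost k e).
Proof.
have C0 := C_ge0; have G0 := G_ge0.
set c := C + G + 1; have c1 : 1 <= c by rewrite /c; lra.
have Cc : C <= c by rewrite /c; lra.
have Gc : G <= c by rewrite /c; lra.
elim: k t gamma e delta => [|k IH] t gamma e delta.
  move=> _ /andP[d0 d1] /=.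
  have : 1 <= delta^-1 by rewrite invf_ge1.
  rewrite mulr1 => d1'; have cd : c <= c / delta by nra.
  lra.
move=> /[dup] e01 /andP[e0 e1] /[dup] d01 /andP[d0 d1].
have e4 : 0 < e / 4 <= 1 by apply/andP; split; lra.
have e2 : 0 < e / 2 <= 1 by apply/andP; split; lra.
set F := cost k (e / 4); have F1 : 1 <= F by exact: cost_ge1.
have F2 : cost k (e / 2) <= F by apply: cost_antitone; lra.
have N0 := samples_gt0 e0.
pose N : R := (samples e)%:R; have N1 : 1 <= N by rewrite ler1n.
have T1 := ge1T.
have NT1 : 1 <= N * T%:R by rewrite mulr_ege1.
have dl01 : 0 < 1 / (16 * (N * T%:R)) <= 1.
  have p0 : 0 < 16 * (N * T%:R) by lra.
  by rewrite divr_gt0//= ler_pdivrMr// mul1r; lra.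
have tE : forall (j : 'I_T.+1) (G : 'M[R]_(D, j)),
    time_le (Balg k G (e / 4) (1 / (16 * (N * T%:R)))) (16 * c * N * T%:R * F).
  move=> j gam; have := IH j gam _ _ e4 dl01; rewrite -/F.
  congr (time_le _ _); field; rewrite !gt_eqF//; lra.
have tA : time_le (Balg k gamma (e / 2) (1 / 8)) (8 * c * F).
  have d8 : 0 < (1 / 8 : R) <= 1 by apply/andP; split; lra.
  by apply: time_le_weaken (IH t gamma _ _ e2 d8); nra.
have tT := time_le_trial tA (time_le_estimate gamma tE).
rewrite -/N in tT.
pose X := c * (N ^+ 2 * (T%:R ^+ 2 * F)).
have trialX : 8 * c * F + (N * (C + (T%:R * (16 * c * N * T%:R * F) + T%:R)) +
    (N + 2)) <= 29 * X.
  set a := N * T%:R in NT1; set b := c * F.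
  have XE : X = b * a ^+ 2 by rewrite /X /a /b; ring.
  have b1 : 1 <= b by rewrite /b mulr_ege1.
  have cb : c <= b by rewrite /b ler_peMr//; lra.
  have Na : N <= a by rewrite /a ler_peMr//; lra.
  have a0 : 0 <= a by lra.
  have b0 : 0 <= b by lra.
  have aX : b * a <= X by rewrite XE expr2 ler_wpM2l// ler_peMl.
  have bX : b <= b * a by rewrite ler_peMr.
  have NC : N * C <= b * a by rewrite mulrC; apply: ler_pM => //; lra.
  have aba : a <= b * a by rewrite ler_peMl.
  have -> : 8 * c * F + (N * (C + (T%:R * (16 * c * N * T%:R * F) + T%:R)) +
    (N + 2)) = 8 * b + N * C + 16 * X + a + N + 2 by rewrite XE /a /b; ring.
  lra.
have X1 : 1 <= X.
  by rewrite /X !mulr_ege1 ?exprn_ege1.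
set n := trials delta.
have tM : time_le (bind (foreach (iota 0 n) (fun=> trial k gamma e))
    (fun l => medianp l)) (n%:R * (29 * X) + n%:R).
  rewrite -[in X in X * _](size_iota 0 n); apply: time_le_foreach => [_|l].
    by apply: time_le_weaken tT.
  by rewrite size_iota /= => ->; rewrite subrr.
apply: time_le_weaken (time_le_BalgS tM).
have ndelta : n%:R <= 16 / delta by exact: trials_le.
have delta1 : 1 <= 1 / delta by rewrite div1r invf_ge1.
apply: (@le_trans _ _ (736 * (1 / delta) * X)).
  set z := 1 / delta in delta1 *; move: ndelta.
  have -> : 16 / delta = 16 * z by rewrite /z; ring.
  move=> nz; have : n%:R * X <= 16 * z * X by rewrite ler_wpM2r//; lra.
  have : z <= z * X by nra.
  lra.
have N2 : N ^+ 2 <= (33 / e ^+ 2) ^+ 2.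
  have N33 : N <= 33 / e ^+ 2 by exact: samples_le.
  by rewrite lerXn2r// nnegrE; lra.
have -> : c / delta * cost k.+1 e =
    736 * (1 / delta) * (c * ((33 / e ^+ 2) ^+ 2 * (T%:R ^+ 2 * F))).
  rewrite /= -/F /level_factor -lock; field.
  by rewrite !gt_eqF.
apply: ler_wpM2l; first by apply: mulr_ge0; lra.
apply: ler_wpM2l; first by lra.
by apply: ler_wpM2r => //; apply: mulr_ge0; [exact: exprn_ge0|lra].
Qed.

End running_time.

Section decision_time.
Context {R : realType} {T D : nat}.
Variables (g : forall t : 'I_T.+1, 'M[R]_(D, t) -> R).
Local Notation cost := (@cost R T).

(** Unfolding the recursion, with [a] an upper bound of [- ln e]: each level
    contributes the constant [exp 15], a factor [exp (4 a)] and [T ^ 2], and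
    increases [a] by 2, which is more than [ln 4]. *)
Lemma cost_le k (a e : R) : (0 < T)%N -> expR (- a) <= e ->
  cost k e <= T%:R ^+ (2 * k) *
    expR (15 * k%:R + 4 * a * k%:R + 4 * k%:R * (k%:R - 1)).
Proof.
move=> T0; elim: k a e => [|k IH] a e ea.
  by rewrite muln0 expr0 mul1r !(mulr0, mul0r) !addr0 expR0.
have e0 : 0 < e by apply: lt_le_trans ea; exact: expR_gt0.
rewrite /=; have -> : T%:R ^+ (2 * k.+1) *
    expR (15 * k.+1%:R + 4 * a * k.+1%:R + 4 * k.+1%:R * (k.+1%:R - 1)) =
    (expR 15%:R * T%:R ^+ 2 * expR (4 * a)) * (T%:R ^+ (2 * k) *
    expR (15 * k%:R + 4 * (a + 2) * k%:R + 4 * k%:R * (k%:R - 1))) :> R.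
  have -> : 15 * k.+1%:R + 4 * a * k.+1%:R + 4 * k.+1%:R * (k.+1%:R - 1) =
    15 + (4 * a + (15 * k%:R + 4 * (a + 2) * k%:R + 4 * k%:R * (k%:R - 1))) :> R.
    by rewrite -[k.+1]addn1 natrD; ring.
  by rewrite !expRD mulnS exprD; ring.
have f0 : 0 <= level_factor :> R := le_trans ler01 level_factor_ge1.
apply: ler_pM.
- by rewrite !mulr_ge0 ?invr_ge0 ?exprn_ge0// ltW.
- elim: k {IH} (e / 4) (divr_gt0 e0 (ltr0n _ 4)) => [//|k IHk] x x0 /=.
  by rewrite !mulr_ge0 ?invr_ge0 ?exprn_ge0 ?IHk ?divr_gt0// ltW.
- apply: ler_pM.
  + by rewrite mulr_ge0// exprn_ge0.
  + by rewrite invr_ge0 exprn_ge0// ltW.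
  + apply: ler_pM => //.
    rewrite /level_factor -lock; apply: (@expR_nat_ge _ 15); lra.
  + rewrite -[leRHS]invrK -expRN lef_pV2 ?posrE ?exprn_gt0 ?expR_gt0//.
    have -> : - (4 * a) = - a * 4%:R by ring.
    by rewrite expRM_natr lerXn2r// nnegrE ?expR_ge0 ?(ltW e0).
- apply: IH; rewrite opprD expRD.
  have e2 : expR (- 2%:R) <= 4^-1 :> R.
    by rewrite expRN lef_pV2 ?posrE ?expR_gt0//; apply: (@expR_nat_ge _ 2); lra.
  by apply: ler_pM => //; exact: expR_ge0.
Qed.

(** With [x = 1 / eps] the depth is at most [4 x + 1] and [- ln (eps / 4)] is at most
    [x + 1], so that [cost_le] yields the exponent
    [80 x ^ 2 + 96 x + 19 <= 195 x ^ 2] and at most [8 x + 2] factors [T].  The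
    confidence [eps / (4 T)] costs another [4 x T]. *)
Lemma time_le_decision (C G eps : R) (t : 'I_T.+1) (gamma : 'M[R]_(D, t)) :
  (0 < T)%N -> 0 <= C -> 0 <= G -> 0 < eps -> eps < 1 ->
  time_le g C G (decision eps gamma)
    ((C + G + 1) * expR (250 * eps ^- 2) * T%:R `^ (12 * eps^-1)).
Proof.
move=> T0 C0 G0 eps0 eps1; set c := C + G + 1.
have c1 : 1 <= c by rewrite /c; lra.
have T1 : 1 <= T%:R :> R by rewrite ler1n.
rewrite /decision; case: ifP => _ /=.
  by rewrite !mulr_ge0 ?expR_ge0 ?powR_ge0//; lra.
set K := ceil_val (4 / eps); set x := eps^-1.
have x1 : 1 < x by rewrite invf_gt1.
have Kx : K%:R <= 4 * x + 1.
  by apply/ltW; apply: ceil_val_lt; rewrite divr_ge0// ltW.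
have K1 : 1 <= K%:R :> R.
  by rewrite ler1n; apply: ceil_val_gt0; rewrite divr_gt0.
have e01 : 0 < eps / 4 <= 1 by apply/andP; split; lra.
have T4 : 0 < 4 * T%:R :> R by rewrite mulr_gt0 ?ltr0n.
have d01 : 0 < eps / (4 * T%:R) <= 1.
  rewrite divr_gt0//= ler_pdivrMr// mul1r.
  apply: le_trans (ltW eps1) (le_trans T1 _).
  by rewrite ler_peMl// ler1n.
have tB := time_le_Balg g T0 C0 G0 K gamma e01 d01; rewrite -/c in tB.
rewrite -/K; set B := c / (eps / (4 * T%:R)) * cost K (eps / 4) in tB.
have tD : time_le g C G (bind (Balg K gamma (eps / 4) (eps / (4 * T%:R)))
    (fun v => bind (arith Mul (- (1 / 2)) eps)
       (fun threshold => geqp v threshold))) (B + 2).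
  by apply: time_le_bind tB _ => v /=; lra.
apply: time_le_weaken tD; rewrite -!addrA -!opprD lerBrDr.
have -> : B + 2 + (1 + (1 + (1 + (1 + 1)))) = B + 7 by ring.
have xE : eps = x^-1 by rewrite invrK.
have ea : expR (- (x + 1)) <= eps / 4.
  have -> : - (x + 1) = - (x - 1) + - 2 by ring.
  rewrite expRD; apply: ler_pM; rewrite ?expR_ge0//.
    rewrite expRN xE lef_pV2 ?posrE ?expR_gt0//; last by lra.
    by apply: le_trans (expR_ge1Dx _); lra.
  rewrite expRN lef_pV2 ?posrE ?expR_gt0//.
  by apply: (@expR_nat_ge _ 2); lra.
have cK1 : 1 <= cost K (eps / 4) by exact: cost_ge1.
have cKle : cost K (eps / 4) <= T%:R ^+ (2 * K) * expR (195 * x ^+ 2).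
  apply: le_trans (cost_le _ T0 ea) _; rewrite ler_wpM2l ?exprn_ge0// ler_expR.
  have K0 : 0 <= 4 * x + 1 - K%:R by lra.
  have h1 : 4 * (x + 1) * K%:R <= 4 * (x + 1) * (4 * x + 1).
    by rewrite ler_wpM2l//; lra.
  have h2 : K%:R * (K%:R - 1) <= (4 * x + 1) * (4 * x).
    by apply: ler_pM; lra.
  have h3 : x <= x ^+ 2 by rewrite expr2 ler_peMl//; lra.
  have -> : 4 * K%:R * (K%:R - 1) = 4 * (K%:R * (K%:R - 1)) :> R by ring.
  have h4 : 4 * (x + 1) * (4 * x + 1) = 16 * x ^+ 2 + 20 * x + 4 by ring.
  have h5 : (4 * x + 1) * (4 * x) = 16 * x ^+ 2 + 4 * x by ring.
  lra.
have BE : B = c * (4 * x * T%:R * cost K (eps / 4)).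
  by rewrite /B xE; field; rewrite !gt_eqF ?ltr0n//; lra.
apply: (@le_trans _ _ (c * (11 * x * T%:R * cost K (eps / 4)))).
  set y := T%:R * cost K (eps / 4).
  have y1 : 1 <= y by rewrite /y mulr_ege1.
  have -> : c * (11 * x * T%:R * cost K (eps / 4)) = B + 7 * (c * (x * y)).
    by rewrite BE /y; ring.
  rewrite lerD2l; have : 1 <= c * (x * y) by rewrite !mulr_ege1//; lra.
  lra.
rewrite -/x -[leRHS]mulrA ler_wpM2l//; first by lra.
have TE : T%:R * T%:R ^+ (2 * K) <= T%:R `^ (12 * x) :> R.
  rewrite -exprS -powR_mulrn//; apply: ler_powR => //.
  by rewrite -addn1 natrD natrM; lra.
have xexp : 11 * x * expR (195 * x ^+ 2) <= expR (250 * x ^+ 2).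
  have h11 : 11 <= expR 3%:R :> R by apply: (@expR_nat_ge _ 3); lra.
  have hx : x <= expR x by apply: le_trans (expR_ge1Dx _); lra.
  apply: (@le_trans _ _ (expR 3%:R * expR x * expR (195 * x ^+ 2))).
    rewrite ler_wpM2r ?expR_ge0//; apply: ler_pM => //; lra.
  rewrite -!expRD ler_expR.
  have h3 : x <= x ^+ 2 by rewrite expr2 ler_peMl//; lra.
  lra.
rewrite -exprVn -/x.
apply: (@le_trans _ _ (11 * x * expR (195 * x ^+ 2) *
    (T%:R * T%:R ^+ (2 * K)))).
  have -> : 11 * x * expR (195 * x ^+ 2) * (T%:R * T%:R ^+ (2 * K)) =
    11 * x * T%:R * (T%:R ^+ (2 * K) * expR (195 * x ^+ 2)) by ring.
  by rewrite ler_wpM2l// !mulr_ge0//; lra.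
apply: ler_pM => //.
by rewrite !mulr_ge0 ?expR_ge0//; lra.
Qed.

End decision_time.

(** * Weighted laws *)

Section density.
Context {R : realType} {d : measure_display} {X : measurableType d}.
Variables (mu : {measure set X -> \bar R}) (h : X -> R).
Local Open Scope ereal_scope.

Definition density (mh : measurable_fun setT h) (h0 : forall x, (0 <= h x)%R)
  (A : set X) : \bar R := \int[mu]_(x in A) (h x)%:E.

Hypotheses (mh : measurable_fun setT h) (h0 : forall x, (0 <= h x)%R).

Let density0 : density mh h0 set0 = 0. Proof. by rewrite /density integral_set0. Qed.

Let density_ge0 A : 0 <= density mh h0 A.
Proof. by apply: integral_ge0 => x _; rewrite lee_fin. Qed.

Let density_sigma_additive : semi_sigma_additive (density mh h0).
Proof.
move=> /= F mF tF mUF; rewrite /density; apply: cvg_toP.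
  apply: ereal_nondecreasing_is_cvgn => m n mn.
  apply: lee_sum_nneg_natr => // k _ _; apply: integral_ge0 => /= x Fkx.
  by rewrite lee_fin.
rewrite ge0_integral_bigcup//=.
- by apply: measurable_funTS; exact/measurable_EFinP.
- by move=> x _; rewrite lee_fin.
Qed.

HB.instance Definition _ := isMeasure.Build _ _ _ (density mh h0)
  density0 density_ge0 density_sigma_additive.

Import HBNNSimple.

Let integral_density_nnsfun (s : {nnsfun X >-> R}) :
  \int[density mh h0]_x (s x)%:E = \int[mu]_x ((s x)%:E * (h x)%:E).
Proof.
under [in RHS]eq_integral => x _.
  rewrite fimfunE -fsumEFin// ge0_mule_fsuml; last first.
    by move=> r; rewrite EFinM nnfun_muleindic_ge0.
  over.
have mhE : measurable_fun setT (fun x => (h x)%:E) by exact/measurable_EFinP.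
rewrite ge0_integral_fsum//; last 2 first.
  - move=> r; apply: emeasurable_funM => //.
    by apply/measurable_EFinP; exact: measurable_funM.
  - move=> r x _; apply: mule_ge0; last by rewrite lee_fin.
    by rewrite EFinM nnfun_muleindic_ge0.
rewrite integralT_nnsfun sintegralE; apply: eq_fsbigr => r rs.
have r0 : (0 <= r)%R by move: rs; rewrite inE => -[x _ <-].
have ms : measurable (s @^-1` [set r]) by [].
rewrite /density -ge0_integralZl_EFin//; last 2 first.
- by move=> x _; rewrite lee_fin.
- exact: measurable_funTS.
rewrite [LHS]integral_mkcond; apply: eq_integral => x _.
rewrite patchE indicE EFinM -muleA.
by case: (x \in _); rewrite ?mul1e ?mul0e ?mule0.
Qed.

Lemma integral_density (f : X -> \bar R) : measurable_fun setT f ->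
  (forall x, 0 <= f x) ->
  \int[density mh h0]_x f x = \int[mu]_x (f x * (h x)%:E).
Proof.
move=> mf f0; pose f_ := nnsfun_approx measurableT mf.
have mhE : measurable_fun setT (fun x => (h x)%:E) by exact/measurable_EFinP.
have lim_f x : limn (fun n => (f_ n x)%:E) = f x.
  by apply/cvg_lim => //; exact: cvg_nnsfun_approx.
transitivity (limn (fun n => \int[density mh h0]_x (f_ n x)%:E)).
  rewrite -monotone_convergence//; last 3 first.
  - by move=> n; exact/measurable_EFinP.
  - by move=> n x _; rewrite lee_fin.
  - by move=> x _ a b ab; rewrite lee_fin; exact/lefP/nd_nnsfun_approx.
  by apply: eq_integral => x _; rewrite lim_f.
under eq_fun do rewrite integral_density_nnsfun.
rewrite -monotone_convergence//; last 3 first.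
- by move=> n; apply: emeasurable_funM => //; exact/measurable_EFinP.
- by move=> n x _; rewrite mule_ge0// lee_fin.
- move=> x _ a b ab; rewrite lee_wpmul2r// ?lee_fin//.
  exact/lefP/nd_nnsfun_approx.
apply: eq_integral => x _; apply/cvg_lim => //.
apply: cvgeZr => //; exact: cvg_nnsfun_approx.
Qed.

End density.

(** Equality of two weighted laws on measurable sets extends to integrals. *)
Lemma integral_weighted_law {R : realType} dX dY (X : measurableType dX)
    (Y : measurableType dY) (mu : {measure set X -> \bar R})
    (nu : {measure set Y -> \bar R}) (u : X -> Y) (h : X -> R) (k : Y -> R)
    (f : Y -> \bar R) :
  measurable_fun setT u ->
  measurable_fun setT h -> (forall x, 0 <= h x) ->
  measurable_fun setT k -> (forall y, 0 <= k y) ->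
  (forall A, measurable A -> (\int[mu]_(x in u @^-1` A) (h x)%:E =
     \int[nu]_(y in A) (k y)%:E)%E) ->
  measurable_fun setT f -> (forall y, 0 <= f y)%E ->
  (\int[mu]_x (f (u x) * (h x)%:E) = \int[nu]_y (f y * (k y)%:E))%E.
Proof.
move=> mu_ mh h0 mk k0 hk mf f0.
have mfu : measurable_fun setT (f \o u) by exact: measurableT_comp.
rewrite -(integral_density nu mk k0 mf f0).
rewrite -(integral_density mu mh h0 mfu) => [|x]; last exact: f0.
transitivity (\int[pushforward (density mu mh h0) u]_y f y)%E.
  by rewrite ge0_integral_pushforward// => y _; exact: f0.
by apply: eq_measure_integral => A mA _; exact: hk.
Qed.

Section weighted_stopping.
Context {R : realType} {T D : nat}.
Variable nu : probability 'M[R]_(D, T) R.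
Variables (g : forall t : 'I_T.+1, 'M[R]_(D, t) -> R)
  (kappa : forall t : 'I_T.+1, R.-pker 'M[R]_(D, t) ~> 'M[R]_(D, T)).
Hypothesis g_meas : forall t : 'I_T.+1, (0 < t)%N -> measurable_fun setT (@g t).
Hypothesis T_gt0 : (0 < T)%N.

Local Notation V := first_cols.

(** Summing over the possible values of [tau], each term only involves the law of
    the path and of the event [tau = s]; clipping the reward changes it on a null
    set. *)
Lemma expected_reward_weights d (Omega : measurableType d)
    (P : probability Omega R) (Y : Omega -> 'M[R]_(D, T))
    (tau : Omega -> 'I_T.+1) (o : 'I_T.+1 -> 'M[R]_(D, T) -> R) :
  measurable_fun setT Y -> stopping_weights nu o ->
  (forall w, 0 < tau w)%N -> (forall s, measurable [set w | tau w = s]) ->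
  (forall A s, measurable A -> P (Y @^-1` A `&` [set w | tau w = s]) =
     \int[nu]_(y in A) (o s y)%:E)%E ->
  (forall t : 'I_T.+1, (0 < t)%N ->
     {ae P, forall w, 0 <= reward g t (Y w) <= 1}) ->
  expected_reward g P Y tau = mean_reward nu g kappa o.
Proof.
move=> mY wo tau0 mtau Po Z01; have [mo o0 _ _] := wo.
pose I (i : 'I_T) (w : Omega) : R := \1_[set w | tau w = time i] w.
have mI i : measurable_fun setT (I i) by exact: measurable_indic.
have I0 i w : 0 <= I i w by rewrite /I indicE.
have sumI (f : 'I_T.+1 -> R) w : f (tau w) = \sum_(i < T) I i w * f (time i).
  have [i wi] : exists i, tau w = time i.
    by case: (unliftP ord0 (tau w)) (tau0 w) => [i ->|-> //]; exists i.
  rewrite (bigD1 i)//= {1}/I indicE mem_set//= mul1r big1 ?addr0 ?wi// => j ji.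
  rewrite /I indicE memNset ?mul0r//= wi => /lift_inj ij.
  by rewrite ij eqxx in ji.
have mgY (F : forall t : 'I_T.+1, 'M[R]_(D, t) -> R) i :
    measurable_fun setT (F (time i)) ->
    measurable_fun setT (fun w => F (time i) (V (time i) (Y w))).
  move=> mF; have := measurableT_comp mF (measurableT_comp
    (@measurable_first_cols R T D (time i)) mY).
  by apply.
pose v := @value R T D g kappa 0.
have mv i : measurable_fun setT (v (time i)) by exact: measurable_value.
have v0 i y : 0 <= v (time i) y.
  by have /andP[] := value_bounds g kappa 0 y.
rewrite /expected_reward unlock.
transitivity (\int[P]_w (\sum_(i < T) I i w * v (time i) (V (time i) (Y w)))%:E)%E.
  apply: ae_eq_integral => //.
  - apply/measurable_EFinP.
    rewrite (_ : (fun w => _) = fun w => \sum_(i < T)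
      I i w * g (V (time i) (Y w))); last first.
      by apply/funext => w; rewrite (sumI (fun t => reward g t (Y w))).
    apply: measurable_sum => i; apply: measurable_funM => //.
    by apply: mgY; exact: g_meas.
  - apply/measurable_EFinP; apply: measurable_sum => i.
    by apply: measurable_funM => //; exact: mgY.
  have : {ae P, forall w, forall t : 'I_T.+1, (0 < t)%N ->
      0 <= reward g t (Y w) <= 1}.
    apply: ae_forall_count => t; have [t0|t0] := boolP (0 < t)%N.
      by apply: ae_imply (Z01 t t0).
    exact: aeW.
  apply: ae_imply => w Zw _; rewrite (sumI (fun t => reward g t (Y w))).
  congr EFin; apply: eq_bigr => i _; congr (_ * _).
  by rewrite /v /= clip_id// Zw.
under eq_integral do rewrite -sumEFin.
rewrite ge0_integral_sum//; last 2 first.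
- by move=> i; apply/measurable_EFinP; apply: measurable_funM => //; exact: mgY.
- by move=> i w _; rewrite lee_fin mulr_ge0.
rewrite /mean_reward ge0_integral_sum//; last 2 first.
- by move=> i; exact: measurable_path_term.
- by move=> i y _; rewrite lee_fin mulr_ge0.
apply: eq_bigr => i _.
under eq_integral do rewrite mulrC EFinM.
under [in RHS]eq_integral do rewrite mulrC EFinM.
apply: (@integral_weighted_law _ _ _ _ _ P nu Y (I i) (o (time i))
  (fun y => (v (time i) (V (time i) y))%:E)) => //.
- move=> A mA; rewrite -Po// /I integral_indic//; first by rewrite setIC.
  by rewrite -[X in measurable X]setTI; exact: mY.
- apply/measurable_EFinP.
  by have := measurableT_comp (mv i) (@measurable_first_cols R T D (time i)); apply.
- by move=> y; rewrite lee_fin.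
Qed.

End weighted_stopping.

(** * Randomized stopping times from stopping weights *)

Section randomization.
Context {R : realType} {T D : nat}.
Variable nu : probability 'M[R]_(D, T) R.
Variable kappa : forall t : 'I_T.+1, R.-pker 'M[R]_(D, t) ~> 'M[R]_(D, T).
Hypothesis nu_kappa : forall t A B, measurable A -> measurable B ->
  nu (A `&` first_cols t @^-1` B) =
  (\int[nu]_(y in first_cols t @^-1` B) kappa t (first_cols t y) A)%E.
Variable o : 'I_T.+1 -> 'M[R]_(D, T) -> R.
Hypothesis wo : stopping_weights nu o.
Context {d : measure_display} {Omega : measurableType d}.
Variables (P : probability Omega R) (Y : Omega -> 'M[R]_(D, T)).
Variable tau : Omega -> 'I_T.+1.
Hypothesis mY : measurable_fun setT Y.
Hypothesis tau_gt0 : forall w, (0 < tau w)%N.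
Hypothesis mtau : forall s, measurable [set w | tau w = s].
Hypothesis P_nu : forall A, measurable A -> P (Y @^-1` A) = nu A.
Hypothesis P_o : forall A s, measurable A ->
  (P (Y @^-1` A `&` [set w | tau w = s]) = \int[nu]_(y in A) (o s y)%:E)%E.

Local Notation V := first_cols.

Lemma measurable_preimage_path A : measurable A -> measurable (Y @^-1` A).
Proof. by move=> mA; rewrite -[X in measurable X]setTI; exact: mY. Qed.

Lemma measurable_tau (A : set 'I_T.+1) : measurable (tau @^-1` A).
Proof.
have -> : tau @^-1` A = \bigcup_(s in A) [set w | tau w = s].
  by apply/seteqP; split=> [w Aw|w [s As /= ws]];
    [exists (tau w)|rewrite /= ws].
apply: fin_bigcup_measurable => // s _; exact: mtau.
Qed.

(** The events about [tau] that are decided by time [t]: they do not distinguish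
    between the later times.  This filtration serves as the auxiliary
    randomness. *)
Definition decision_events (t : 'I_T.+1) : set_system Omega :=
  [set E | exists A : set 'I_T.+1,
    (forall s s' : 'I_T.+1, (t < s)%N -> (t < s')%N -> A s -> A s') /\
    E = tau @^-1` A].

Lemma decision_events_sigma_algebra t : sigma_algebra setT (decision_events t).
Proof.
split.
- by exists set0; split => //; rewrite preimage_set0.
- move=> _ [A [At ->]]; exists (~` A); split; last by rewrite setTD preimage_setC.
  by move=> s s' ts ts' /= nAs As'; apply: nAs; exact: At As'.
- move=> F HF; have [A AF] := choice HF.
  exists (\bigcup_n A n); split; last first.
    by rewrite preimage_bigcup; apply: eq_bigcup => // n _; have [] := AF n.
  move=> s s' ts ts' [n _ An]; exists n => //.
  by have [At _] := AF n; exact: At An.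
Qed.

Lemma integral_path (t : 'I_T.+1) (f : 'M[R]_(D, t) -> \bar R) (C : set 'M[R]_(D, t)) :
  measurable C -> measurable_fun setT f -> (forall gamma, 0 <= f gamma)%E ->
  (\int[P]_(w in (V t \o Y) @^-1` C) f (V t (Y w)) =
   \int[nu]_(y in V t @^-1` C) f (V t y))%E.
Proof.
move=> mC mf f0; have mVC := measurable_preimage_first_cols mC.
have mfV : measurable_fun setT (fun y : 'M[R]_(D, T) => f (V t y)).
  by have := measurableT_comp mf (@measurable_first_cols R T D t); apply.
transitivity (\int[pushforward P Y]_(y in V t @^-1` C) f (V t y))%E.
  rewrite ge0_integral_pushforward//; first exact: measurable_funTS.
by apply: eq_measure_integral => A mA _; exact: P_nu.
Qed.

(** Conditional probability of [tau] lying in [A], given the first [t]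
    columns, for a set [A] that contains either all or none of the later
    times. *)
Definition decision_prob (t : 'I_T.+1) (A : set 'I_T.+1)
    (gamma : 'M[R]_(D, t)) : R :=
  \sum_(i < T | (time i <= t)%N && (time i \in A)) o (time i) (pad gamma) +
  (if [exists i : 'I_T, (t < time i)%N && (time i \in A)] then
     Num.max 0 (1 - \sum_(i < T | (time i <= t)%N) o (time i) (pad gamma))
   else 0).

Lemma decision_prob_ge0 t A gamma : 0 <= @decision_prob t A gamma.
Proof.
apply: addr_ge0; first by apply: sumr_ge0 => i _; exact: (weights_ge0 wo).
by case: ifP => // _; rewrite le_max lexx.
Qed.

Lemma measurable_decision_prob t A : measurable_fun setT (@decision_prob t A).
Proof.
have mo i : measurable_fun setT (fun gamma : 'M[R]_(D, t) => o (time i) (pad gamma)).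
  have := measurableT_comp (weights_meas wo (time i)) (@measurable_pad R T D t).
  by apply.
have msum (p : pred 'I_T) : measurable_fun setT
    (fun gamma : 'M[R]_(D, t) => \sum_(i < T | p i) o (time i) (pad gamma)).
  under eq_fun do rewrite big_mkcond.
  by apply: measurable_sum => i; case: (p i).
apply: measurable_funD; first exact: msum.
case: [exists i : 'I_T, _] => //.
by apply: measurable_maxr => //; apply: measurable_funB => //; exact: msum.
Qed.

(** The total weight of the times after [t] is what the first [t] columns leave
    over, by adaptedness and since the weights sum to 1. *)
Lemma decision_probE (t : 'I_T.+1) (A : set 'I_T.+1) :
  (forall s s' : 'I_T.+1, (t < s)%N -> (t < s')%N -> A s -> A s') ->
  {ae nu, forall y, \sum_(i < T | time i \in A) o (time i) y =
    decision_prob A (V t y)}.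
Proof.
move=> At; apply: ae_imply (weights_sum1 wo) => y oy.
have opad i : (time i <= t)%N -> o (time i) (pad (V t y)) = o (time i) y.
  move=> it; apply: (weights_adapted wo).
  exact: first_cols_le it (first_cols_pad (V t y)).
have split_sum (p : pred 'I_T) : \sum_(i < T | p i) o (time i) y =
    \sum_(i < T | (time i <= t)%N && p i) o (time i) y +
    \sum_(i < T | (t < time i)%N && p i) o (time i) y.
  rewrite (bigID (fun i => (time i <= t)%N))/=; congr (_ + _).
    by apply: eq_bigl => i; rewrite andbC.
  by apply: eq_bigl => i; rewrite andbC -ltnNge.
rewrite split_sum /decision_prob; congr (_ + _).
  by apply: eq_bigr => i /andP[it _]; rewrite opad.
case: ifPn => [/existsP[i /andP[ti Ai]]|/existsPn noA]; last first.
  by apply: big1 => i iA; have := noA i; rewrite iA.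
have allA j : (t < time j)%N -> time j \in A.
  by move=> tj; rewrite inE; apply: (At (time i)) => //; rewrite -inE.
have late : \sum_(j < T | (t < time j)%N && (time j \in A)) o (time j) y =
    1 - \sum_(j < T | (time j <= t)%N) o (time j) (pad (V t y)).
  rewrite -oy (split_sum predT); apply/esym/eqP.
  rewrite subr_eq addrC; apply/eqP; congr (_ + _).
    apply: eq_bigl => j; rewrite /= andbT.
    by case: (boolP (t < time j)%N) => //= tj; rewrite allA.
  rewrite (eq_bigl (fun j => (time j <= t)%N)); last by move=> j; rewrite /= andbT.
  by apply: eq_bigr => j jt; rewrite opad.
rewrite late max_r// -late; apply: sumr_ge0 => j _; exact: (weights_ge0 wo).
Qed.

Lemma decision_event_prob (t : 'I_T.+1) (A : set 'I_T.+1) A0 :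
  (forall s s' : 'I_T.+1, (t < s)%N -> (t < s')%N -> A s -> A s') ->
  measurable A0 ->
  (P (tau @^-1` A `&` Y @^-1` A0) =
   \int[nu]_(y in A0) (decision_prob A (V t y))%:E)%E.
Proof.
move=> At mA0; have mYA := measurable_preimage_path mA0.
have moE i : measurable_fun A0 (fun y => (o (time i) y)%:E).
  by apply: measurable_funTS; apply/measurable_EFinP; exact: (weights_meas wo).
transitivity (\sum_(i < T | time i \in A) \int[nu]_(y in A0) (o (time i) y)%:E)%E.
  have mE i : measurable (Y @^-1` A0 `&` [set w | tau w = time i]).
    by apply: measurableI => //; exact: mtau.
  have mEA : measurable (tau @^-1` A `&` Y @^-1` A0).
    by apply: measurableI => //; exact: measurable_tau.
  rewrite -[X in P X]setIT -integral_indic//.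
  under eq_bigr => i _ do rewrite -P_o// -[X in P X]setIT -integral_indic//.
  rewrite -[RHS]big_filter -ge0_integral_sum//; last first.
    by move=> i; apply/measurable_EFinP; exact: measurable_indic.
  apply: eq_integral => w _; rewrite big_filter sumEFin; congr EFin.
  have [i wi] : exists i, tau w = time i.
    by case: (unliftP ord0 (tau w)) (tau_gt0 w) => [i ->|-> //]; exists i.
  have neq j : j != i -> \1_(Y @^-1` A0 `&` [set w | tau w = time j]) w = 0 :> R.
    move=> ji; rewrite indicE memNset//= => -[_]; rewrite wi => /lift_inj ij.
    by rewrite ij eqxx in ji.
  have [iA|iA] := boolP (time i \in A).
    rewrite (bigD1 i)//= [X in _ + X]big1 ?addr0 => [|j /andP[_ ji]]; last exact: neq.
    rewrite !indicE; congr (_%:R); congr nat_of_bool.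
    apply/idP/idP; rewrite !inE/= wi => -[]; first by move=> _ ?; split.
    by move=> ? _; split => //; rewrite -inE.
  rewrite big1 => [|j jA]; last by apply: neq; apply: contraNneq iA => <-.
  by rewrite indicE memNset//= wi => -[Ai _]; exact: (negP iA (mem_set Ai)).
rewrite -[LHS]big_filter -ge0_integral_sum//; last first.
  by move=> i y _; rewrite lee_fin (weights_ge0 wo).
under eq_integral do rewrite big_filter.
have mdp : measurable_fun setT (fun y : 'M[R]_(D, T) => (decision_prob A (V t y))%:E).
  apply/measurable_EFinP.
  by have := measurableT_comp (@measurable_decision_prob t A)
    (@measurable_first_cols R T D t); apply.
apply: ge0_ae_eq_integral => //.
- under eq_fun do rewrite big_mkcond.
  by apply: emeasurable_sum => i; case: (time i \in A).
- exact: measurable_funTS.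
- by move=> y _; apply: sume_ge0 => i _; rewrite lee_fin (weights_ge0 wo).
- by move=> y _; rewrite lee_fin decision_prob_ge0.
by apply: ae_imply (decision_probE At) => y yE _; rewrite sumEFin yE.
Qed.

(** An event of [decision_events t] has a conditional probability given the path
    that depends on the first [t] columns only, namely [decision_prob].  A second
    event about the later columns can hence be integrated against the kernel
    first, and the conditional probabilities multiply. *)
Lemma cond_indep_decision t :
  cond_indep P (V t \o Y) (decision_events t)
    (preimage_set_system setT (@last_cols R T D t \o Y) measurable).
Proof.
move=> _ _ [A [At ->]] [B mB <-]; rewrite setTI.
set L : set 'M[R]_(D, T) := @last_cols R T D t @^-1` B.
have mL : measurable L.
  rewrite -[X in measurable X]setTI.
  by apply: (@measurable_last_cols R T D t).
pose f (gamma : 'M[R]_(D, t)) := (decision_prob A gamma)%:E.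
pose h (gamma : 'M[R]_(D, t)) := kappa t gamma L.
have mf : measurable_fun setT f.
  by apply/measurable_EFinP; exact: measurable_decision_prob.
have mh : measurable_fun setT h by exact: measurable_kernel.
have f0 gamma : (0 <= f gamma)%E by rewrite lee_fin decision_prob_ge0.
have h0 gamma : (0 <= h gamma)%E by [].
have VY C : (V t \o Y) @^-1` C = Y @^-1` (V t @^-1` C) by [].
have LY : (@last_cols R T D t \o Y) @^-1` B = Y @^-1` L by [].
exists f, h; split; split => //.
- move=> C mC; rewrite (integral_path mC mf f0).
  by rewrite VY (decision_event_prob At)//; exact: measurable_preimage_first_cols.
- move=> C mC; rewrite (integral_path mC mh h0) -nu_kappa//.
  rewrite LY VY -preimage_setI P_nu//.
  by apply: measurableI => //; exact: measurable_preimage_first_cols.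
- exact: emeasurable_funM.
move=> C mC.
have mfh : measurable_fun setT (fun gamma => f gamma * h gamma)%E.
  exact: emeasurable_funM.
have fh0 gamma : (0 <= f gamma * h gamma)%E by rewrite mule_ge0.
rewrite (integral_path mC mfh fh0).
have mVC := measurable_preimage_first_cols mC.
rewrite -setIA LY VY -preimage_setI.
rewrite (decision_event_prob At)//; last exact: measurableI.
pose q gamma := decision_prob A gamma * \1_C gamma.
have mq : measurable_fun setT q.
  apply: measurable_funM; first exact: measurable_decision_prob.
  exact: measurable_indic.
have q0 gamma : 0 <= q gamma.
  by rewrite mulr_ge0 ?decision_prob_ge0// indicE.
have mL1 : measurable_fun setT (\1_L : 'M[R]_(D, T) -> R) by exact: measurable_indic.
have L0 M : 0 <= \1_L M :> R by rewrite indicE.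
have tower := integral_tower nu_kappa mq q0 mL1 L0.
rewrite integral_mkcond [RHS]integral_mkcond.
transitivity (\int[nu]_y (q (V t y) * \1_L y)%:E)%E.
  apply: eq_integral => y _; rewrite patchE in_setI /q !indicE.
  have -> : (V t y \in C) = (y \in V t @^-1` C) by apply/idP/idP; rewrite !inE.
  by case: (y \in L); case: (y \in _); rewrite /= ?mulr1 ?mulr0 ?mul0r.
rewrite tower; apply: eq_integral => y _; rewrite patchE /q indicE.
have -> : (V t y \in C) = (y \in V t @^-1` C) by apply/idP/idP; rewrite !inE.
rewrite integral_indic// setIT.
by case: (y \in _); rewrite ?mulr1 ?mulr0 ?mul0e.
Qed.

Theorem randomized_of_weights : randomized_stopping_time P Y tau.
Proof.
split=> //; exists decision_events; split.
- move=> t; split; first exact: decision_events_sigma_algebra.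
  by move=> _ [A [_ ->]]; exact: measurable_tau.
- move=> s t st _ [A [As ->]]; exists A; split => // r r' tr tr'.
  by apply: As; exact: leq_ltn_trans st _.
- move=> t; apply: sub_sigma_algebra; right.
  exists [set s : 'I_T.+1 | (s <= t)%N]; split => // s s' ts ts' /= st.
  by move: ts; rewrite ltnNge st.
- exact: cond_indep_decision.
Qed.

End randomization.

(** * Drawing a time given the sample point *)

Section marking.
Context {R : realType} {d : measure_display} {Omega : measurableType d} {n : nat}.
Variable P : probability Omega R.
Variable h : 'I_n.+1 -> Omega -> R.
Hypothesis mh : forall s, measurable_fun setT (h s).
Hypothesis h0 : forall s w, 0 <= h s w.
Hypothesis h1 : forall w, \sum_s h s w = 1.

Definition marked_with (s : 'I_n.+1) (w : Omega) : Omega * nat := (w, val s).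

Let measurable_marked_with s : measurable_fun setT (marked_with s).
Proof. exact: measurable_pair2. Qed.

(** The law of the sample point and the mark, on the event that the mark is
    [k]. *)
Definition mark_measure (k : nat) : {measure set (Omega * nat) -> \bar R} :=
  measure_function_pushforward__canonical__measure_function_Measure
    (density P (mh (inord k)) (h0 (inord k))) (measurable_marked_with (inord k)).

Definition marked : set (Omega * nat) -> \bar R := msum mark_measure n.+1.

Lemma markedE A : marked A =
  (\sum_(s < n.+1) \int[P]_(w in marked_with s @^-1` A) (h s w)%:E)%E.
Proof. by apply: eq_bigr => s _ /=; rewrite /pushforward/= /density !inord_val. Qed.

HB.instance Definition _ := Measure.on marked.

(** The sample space is enlarged by a mark whose conditional law, given the sample
    point [w], is [h ^~ w]. *)
Lemma marking_ex : exists P' : probability (Omega * nat)%type R,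
  (forall A, measurable A -> P' (fst @^-1` A) = P A) /\
  forall A (p : pred nat), measurable A ->
    P' (fst @^-1` A `&` [set w | p w.2]) =
    (\sum_(s < n.+1 | p s) \int[P]_(w in A) (h s w)%:E)%E.
Proof.
have marginal A : measurable A -> marked (fst @^-1` A) = P A.
  move=> mA; rewrite markedE.
  under eq_bigr => s _ do rewrite (_ : marked_with s @^-1` _ = A)//.
  rewrite -ge0_integral_sum//; last 2 first.
  - by move=> s; apply: measurable_funTS; exact/measurable_EFinP.
  - by move=> s w _; rewrite lee_fin.
  rewrite -[RHS]mul1e -integral_cst//.
  by apply: eq_integral => w _; rewrite sumEFin h1.
have total : marked setT = 1%E.
  by rewrite -(preimage_setT fst) marginal// probability_setT.
pose P' : probability (Omega * nat)%type R :=
  HB.pack marked (Measure_isProbability.Build _ _ _ marked total).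
exists P'.
split=> // A p mA /=; rewrite markedE [RHS]big_mkcond; apply: eq_bigr => s _.
case: ifPn => ps.
  rewrite (_ : _ @^-1` _ = A)//.
  by apply/seteqP; split=> w /=; [case|].
rewrite (_ : _ @^-1` _ = set0) ?integral_set0//.
by apply/seteqP; split=> w //= -[_]; rewrite (negbTE ps).
Qed.

End marking.

(** * The stopping weights of the algorithm *)

Section law_weights.
Context {R : realType} {T D : nat}.
Hypothesis T_gt0 : (0 < T)%N.
Variables (g : forall t : 'I_T.+1, 'M[R]_(D, t) -> R)
  (kappa : forall t : 'I_T.+1, R.-pker 'M[R]_(D, t) ~> 'M[R]_(D, T)).
Hypothesis g_meas : forall t : 'I_T.+1, (0 < t)%N -> measurable_fun setT (@g t).
Variable eps : R.

Local Notation V := first_cols.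
Local Notation law := (law g kappa eps).

Definition law_weights (t : 'I_T.+1) (y : 'M[R]_(D, T)) : R := fine (law t y).

Lemma law_weightsE t y : (law_weights t y)%:E = law t y.
Proof.
rewrite fineK// ge0_fin_numE ?law_ge0//.
apply: (@le_lt_trans _ _ 1%E); last exact: ltry.
rewrite -(sum_law kappa g_meas eps y) (bigD1 t)//= leeDl// sume_ge0// => s _.
exact: law_ge0.
Qed.

Lemma law_weights_ge0 t y : 0 <= law_weights t y.
Proof. by rewrite fine_ge0// law_ge0. Qed.

Lemma measurable_law_weights t : measurable_fun setT (law_weights t).
Proof. by apply: measurableT_comp => //; exact: measurable_law. Qed.

Lemma sum_law_weights y : \sum_(t < T.+1) law_weights t y = 1.
Proof.
apply: EFin_inj; rewrite -sumEFin -[RHS](sum_law kappa g_meas eps y).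
by apply: eq_bigr => t _; exact: law_weightsE.
Qed.

Lemma law_stopping_weights nu : stopping_weights nu law_weights.
Proof.
split; [exact: measurable_law_weights|exact: law_weights_ge0| |].
- apply: aeW => y; rewrite -[RHS](sum_law_weights y) big_ord_recl.
  have -> : law_weights ord0 y = 0 by rewrite /law_weights law0.
  by rewrite add0r.
- by move=> t y y' yy'; rewrite /law_weights (law_first_cols _ _ _ (leqnn t) yy').
Qed.

(** The weights sum the probabilities of the separate outcomes, while
    [expected_loss_le] bounds an expectation; superadditivity is the direction
    that is needed. *)
Lemma law_loss (nu : probability 'M[R]_(D, T) R) :
  (forall t A B, measurable A -> measurable B ->
    nu (A `&` first_cols t @^-1` B) =
    (\int[nu]_(y in first_cols t @^-1` B) kappa t (first_cols t y) A)%E) ->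
  (forall t : 'I_T.+1, (0 < t)%N ->
    {ae nu, forall y, 0 <= g (first_cols t y) <= 1}) ->
  0 < eps -> eps < 1 ->
  {ae nu, forall y, \sum_(i < T) law_weights (time i) y *
    - value g kappa (depth eps) (V (time i) y) <= eps}.
Proof.
move=> nu_kappa g01 e0 e1.
have [k Kd] : exists k, depth eps = k.+1.
  by exists (depth eps).-1; rewrite prednK// depth_gt0.
apply: ae_imply (ae_and (extends_along_ae nu_kappa)
  (good_path_ae nu_kappa g01 (depth eps))) => y [ey gy].
have loss := expected_loss_le T_gt0 g_meas e0 e1 ey gy.
rewrite -lee_fin -sumEFin; apply: le_trans loss.
set W := fun t : 'I_T.+1 => - value g kappa (depth eps) (V t y).
have W0 t : 0 <= W t.
  rewrite /W Kd; have /andP[_] := value_bounds g kappa k.+1 (V t y).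
  by rewrite addNr oppr_ge0.
have term0 t a : (0 <= (W t)%:E * (a == t)%:R%:E)%E.
  by rewrite mule_ge0// lee_fin.
have le_expect (s : seq 'I_T) :
    (\sum_(i <- s) (law_weights (time i) y * W (time i))%:E <=
     expect g kappa (stop_alg eps y) (fun a : 'I_T.+1 =>
       \sum_(i <- s) ((W (time i))%:E * (a == time i)%:R%:E)))%E.
  elim: s => [|i s IH].
    rewrite big_nil; apply: expect_ge0 => a; exact: sume_ge0.
  rewrite big_cons; under eq_expect do rewrite big_cons.
  apply: le_trans (expect_super _ _ _ _ _) => [|a|a]; last 2 first.
  - exact: term0.
  - by apply: sume_ge0 => j _; exact: term0.
  apply: leeD => //; rewrite EFinM law_weightsE muleC; exact: expectZl.
apply: le_trans (le_expect _) _; apply: expect_mono => a.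
  by apply: sume_ge0 => i _; exact: term0.
rewrite (eq_bigr (fun i => (W (time i) * (a == time i)%:R)%:E)); last first.
  by move=> i _; rewrite EFinM.
rewrite sumEFin lee_fin; have [i ai|a0] := unliftP ord0 a.
  rewrite (bigD1 i)//= ai eqxx mulr1 big1 ?addr0// => j ji.
  by rewrite (inj_eq (@lift_inj _ ord0)) eq_sym (negbTE ji) mulr0.
rewrite big1; first exact: W0.
by move=> i _; rewrite a0 -(inj_eq val_inj) mulr0.
Qed.

End law_weights.

(** * The stopping weights of a stopping time *)

Section stopping_time_weights.
Context {R : realType} {T D : nat} {d : measure_display} {Omega : measurableType d}.
Variables (P : probability Omega R) (Y : Omega -> 'M[R]_(D, T)).
Variable tau : Omega -> 'I_T.+1.
Hypothesis mY : measurable_fun setT Y.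
Hypothesis tau_stop : stopping_time Y tau.
Variable nu : probability 'M[R]_(D, T) R.
Hypothesis P_nu : forall A, measurable A -> P (Y @^-1` A) = nu A.

Local Notation V := first_cols.

Lemma stopping_time_sets : exists B : forall t : 'I_T.+1, set 'M[R]_(D, t),
  forall t : 'I_T.+1, measurable (B t) /\
    [set w | (tau w <= t)%N] = (V t \o Y) @^-1` B t.
Proof.
have [_ tauF] := tau_stop.
have HB (t : 'I_T.+1) : exists C : set 'M[R]_(D, t), measurable C /\
    [set w | (tau w <= t)%N] = (V t \o Y) @^-1` C.
  by have [C mC <-] := tauF t; exists C; rewrite setTI.
by exists (fun t => projT1 (cid (HB t))) => t; case: (cid (HB t)).
Qed.

(** The weight of [t] is the indicator of [tau = t], as a function of the path:
    the event is that [tau <= t] but not [tau <= s] for an earlier [s]. *)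
Lemma stopping_time_weights : exists2 o, stopping_weights nu o &
  forall t w, o t (Y w) = (tau w == t)%:R.
Proof.
have [tau0 _] := tau_stop; have [B BP] := stopping_time_sets.
have mVB (t : 'I_T.+1) : measurable (V t @^-1` B t : set 'M[R]_(D, T)).
  by apply: measurable_preimage_first_cols; have [] := BP t.
pose E (t : 'I_T.+1) : set 'M[R]_(D, T) :=
  V t @^-1` B t `\` \bigcup_(s in [set s : 'I_T.+1 | (s < t)%N]) V s @^-1` B s.
have mE t : measurable (E t).
  apply: measurableD => //; apply: fin_bigcup_measurable => //.
have BY t w : B t (V t (Y w)) <-> (tau w <= t)%N.
  by have [_ /seteqP[h1 h2]] := BP t; split=> [/h2|/h1].
have EY t w : E t (Y w) <-> tau w = t.
  split=> [[/= /BY taut nB]|<-].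
    apply/val_inj/eqP; rewrite eqn_leq taut leqNgt; apply/negP => tt.
    by apply: nB; exists (tau w) => //=; apply/BY.
  split=> /=; first exact/BY.
  by move=> [s /= st /BY]; rewrite leqNgt st.
have oY t w : \1_(E t) (Y w) = (tau w == t)%:R :> R.
  rewrite indicE; congr (_%:R); congr nat_of_bool; apply/idP/eqP.
    by rewrite inE => /EY.
  by move=> tw; rewrite inE; apply/EY.
exists (fun t => \1_(E t)); last exact: oY.
split.
- by move=> t; exact: measurable_indic.
- by move=> t y; rewrite indicE.
- pose S : set 'M[R]_(D, T) := [set y | \sum_(i < T) \1_(E (time i)) y = 1 :> R].
  have mS : measurable S.
    have mf : measurable_fun setT (fun y => \sum_(i < T) \1_(E (time i)) y : R).
      by apply: measurable_sum => i; exact: measurable_indic.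
    by have := mf measurableT _ (measurable_set1 1); rewrite setTI.
  exists (~` S); split => //; first exact: measurableC.
  rewrite -P_nu; last exact: measurableC.
  rewrite (_ : _ @^-1` _ = set0) ?measure0//; apply/seteqP; split=> // w /=.
  apply; rewrite /S /=; under eq_bigr do rewrite oY.
  have [i wi] : exists i, tau w = time i.
    by case: (unliftP ord0 (tau w)) (tau0 w) => [i ->|-> //]; exists i.
  rewrite (bigD1 i)//= wi eqxx big1 ?addr0// => j ji.
  by rewrite (inj_eq (@lift_inj _ ord0)) eq_sym (negbTE ji).
- move=> t y y' yy'; rewrite !indicE; congr (_%:R); congr nat_of_bool.
  have yr (r : 'I_T.+1) : (r <= t)%N -> V r y = V r y'.
    by move=> rt; exact: first_cols_le rt yy'.
  have sub z z' : (forall r : 'I_T.+1, (r <= t)%N -> V r z = V r z') -> E t z -> E t z'.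
    move=> zz' [/= Bz nBz]; split; first by rewrite /= -zz'.
    by move=> [s st Bs]; apply: nBz; exists s; rewrite //= zz'// ltnW.
  by apply/idP/idP; rewrite !inE; apply: sub => // r rt; rewrite yr.
Qed.

Lemma measurable_stopping_time s : measurable [set w | tau w = s].
Proof.
have [a wo oY] := stopping_time_weights.
have -> : [set w | tau w = s] = (a s \o Y) @^-1` [set 1].
  apply/seteqP; split=> w /=; rewrite oY; first by move=> ->; rewrite eqxx.
  by case: eqP => // _ /esym/eqP; rewrite oner_eq0.
have mo := measurableT_comp (weights_meas wo s) mY.
by rewrite -[X in measurable X]setTI; apply: mo.
Qed.

End stopping_time_weights.

(** * The stopping time of the algorithm *)

Section law_of_paths.
Context {R : realType} {T D : nat} {d : measure_display} {Omega : measurableType d}.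
Variables (P : probability Omega R) (Y : Omega -> 'M[R]_(D, T)).
Variables (nu : probability 'M[R]_(D, T) R).
Hypothesis mY : measurable_fun setT Y.
Hypothesis nuE : forall A, nu A = P (Y @^-1` A).

Lemma integral_law_of_paths (f : 'M[R]_(D, T) -> \bar R) A :
  measurable A -> measurable_fun setT f -> (forall y, 0 <= f y)%E ->
  (\int[nu]_(y in A) f y = \int[P]_(w in Y @^-1` A) f (Y w))%E.
Proof.
move=> mA mf f0; transitivity (\int[pushforward P Y]_(y in A) f y)%E.
  by apply: eq_measure_integral => B mB _; exact: nuE.
by rewrite ge0_integral_pushforward//; exact: measurable_funTS.
Qed.

Lemma law_of_paths_kappa
    (kappa : forall t : 'I_T.+1, R.-pker 'M[R]_(D, t) ~> 'M[R]_(D, T)) :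
  (forall t : 'I_T.+1, conditional_law P Y (kappa t)) ->
  forall t A B, measurable A -> measurable B ->
    nu (A `&` first_cols t @^-1` B) =
    (\int[nu]_(y in first_cols t @^-1` B) kappa t (first_cols t y) A)%E.
Proof.
move=> kappaP t A B mA mB; have [_ /(_ B mB) PE] := kappaP t A mA.
rewrite nuE preimage_setI -[LHS]/(P (Y @^-1` A `&` (first_cols t \o Y) @^-1` B)) PE.
rewrite integral_law_of_paths//; first exact: measurable_preimage_first_cols.
exact: measurable_kappa_first_cols.
Qed.

Lemma law_of_paths_ae (Q : 'M[R]_(D, T) -> Prop) : measurable [set y | Q y] ->
  {ae P, forall w, Q (Y w)} -> {ae nu, forall y, Q y}.
Proof.
move=> mQ PQ; exists (~` [set y | Q y]); split => //; first exact: measurableC.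
rewrite nuE; apply: measure_negligible => //.
by rewrite -[X in measurable X]setTI; apply: mY => //; exact: measurableC.
Qed.

End law_of_paths.

Lemma law_of_paths_ex (R : realType) (T D : nat) d (Omega : measurableType d)
    (P : probability Omega R) (Y : Omega -> 'M[R]_(D, T)) :
  measurable_fun setT Y ->
  exists nu : probability 'M[R]_(D, T) R, forall A, nu A = P (Y @^-1` A).
Proof.
move=> mY; pose Ym : {mfun Omega >-> 'M[R]_(D, T)} :=
  HB.pack Y (isMeasurableFun.Build _ _ _ _ _ mY).
by exists (distribution P Ym).
Qed.

Lemma measurable_reward01 (R : realType) (T D : nat)
    (g : forall t : 'I_T.+1, 'M[R]_(D, t) -> R) (t : 'I_T.+1) :
  measurable_fun setT (g t) ->
  measurable [set y : 'M[R]_(D, T) | 0 <= reward g t y <= 1].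
Proof.
move=> mg; have mr : measurable_fun setT (fun y : 'M[R]_(D, T) => reward g t y).
  by have := measurableT_comp mg (@measurable_first_cols R T D t); apply.
rewrite (_ : [set y | _] = (fun y => reward g t y) @^-1` `[0, 1]).
  by rewrite -[X in measurable X]setTI; apply: mr.
by apply/seteqP; split=> y /=; rewrite in_itv.
Qed.

Section stopping_algorithm.
Context {R : realType} {T D : nat}.
Hypothesis T_gt0 : (0 < T)%N.
Context {d : measure_display} {Omega : measurableType d}.
Variables (P : probability Omega R) (Y : Omega -> 'M[R]_(D, T)).
Hypothesis Y_meas : measurable_fun setT Y.
Variable g : forall t : 'I_T.+1, 'M[R]_(D, t) -> R.
Hypothesis g_meas : forall t : 'I_T.+1, (0 < t)%N -> measurable_fun setT (@g t).
Variable kappa : forall t : 'I_T.+1, R.-pker 'M[R]_(D, t) ~> 'M[R]_(D, T).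
Variable eps : R.
Local Notation V := first_cols.

Lemma implements_ex : exists (d' : measure_display) (Omega' : measurableType d')
    (P' : probability Omega' R) (pi : Omega' -> Omega) (tau : Omega' -> 'I_T.+1),
  implements g kappa eps P Y P' pi tau.
Proof.
pose h (s : 'I_T.+1) w := law_weights g kappa eps s (Y w).
have mh s : measurable_fun setT (h s).
  have := measurableT_comp (measurable_law_weights kappa g_meas eps s) Y_meas.
  by apply.
have h0 s w : 0 <= h s w by exact: law_weights_ge0.
have h1 w : \sum_s h s w = 1 by exact: sum_law_weights.
have [P' [P'P P'h]] := marking_ex P mh h0 h1.
(* Time 0 is never drawn; replacing it by T keeps the mark a valid time. *)
pose mark (n : nat) : 'I_T.+1 :=
  if (inord n : 'I_T.+1) == ord0 then ord_max else inord n.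
have mark0 n : (0 < mark n)%N.
  by rewrite /mark; case: ifPn => //= n0; rewrite lt0n.
have markE (s : 'I_T.+1) : s != ord0 -> mark s = s.
  by rewrite /mark inord_val => /negbTE ->.
exists _, (Omega * nat)%type, P', fst, (mark \o snd); split.
- exact: measurable_fst.
- by move=> w; exact: mark0.
- move=> s.
  rewrite (_ : [set w | _] = snd @^-1` [set n | mark n = s])//.
  by rewrite -[X in measurable X]setTI; exact: measurable_snd.
- exact: P'P.
move=> A s mA.
rewrite (_ : [set w | _] = [set w : Omega * nat | mark w.2 == s]); last first.
  by apply/seteqP; split=> w /= /eqP.
rewrite (P'h A (fun n => mark n == s))//.
rewrite (eq_integral (fun w => (h s w)%:E)); last first.
  by move=> w _; rewrite /h law_weightsE.
have I0 : (\int[P]_(w in A) (h ord0 w)%:E = 0)%E.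
  by apply: integral0_eq => w _; rewrite /h /law_weights law0.
have [->|s0] := eqVneq s ord0.
  by rewrite I0 big_pred0// => r; rewrite -(inj_eq val_inj)/= gtn_eqF.
rewrite (bigD1 s)/=; last by rewrite markE.
rewrite big1 ?adde0// => r /andP[rs r_s].
have [->|r0] := eqVneq r ord0; first exact: I0.
by rewrite markE// (negbTE r_s) in rs.
Qed.

Section implementation.
Context {d' : measure_display} {Omega' : measurableType d'}.
Variables (P' : probability Omega' R) (pi : Omega' -> Omega).
Variable tau : Omega' -> 'I_T.+1.
Hypothesis tauP : implements g kappa eps P Y P' pi tau.
Variable nu : probability 'M[R]_(D, T) R.
Hypothesis nuE : forall A, nu A = P (Y @^-1` A).

Lemma implements_law A : measurable A -> P' ((Y \o pi) @^-1` A) = nu A.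
Proof.
by move=> mA; have [_ _ _ piP _] := tauP; rewrite nuE; exact: piP (measurable_preimage_path Y_meas mA).
Qed.

Lemma implements_weights A s : measurable A ->
  P' ((Y \o pi) @^-1` A `&` [set w | tau w = s]) =
  (\int[nu]_(y in A) (law_weights g kappa eps s y)%:E)%E.
Proof.
move=> mA; have [_ _ _ _ /(_ _ s (measurable_preimage_path Y_meas mA))] := tauP; rewrite -comp_preimage => ->.
under [RHS]eq_integral do rewrite law_weightsE//.
rewrite (integral_law_of_paths Y_meas nuE)//; first exact: measurable_law.
by move=> y; exact: law_ge0.
Qed.

Lemma implements_ae (Q : Omega -> Prop) :
  {ae P, forall w, Q w} -> {ae P', forall w, Q (pi w)}.
Proof.
have [mpi _ _ piP _] := tauP; case=> N [mN N0 QN]; exists (pi @^-1` N).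
split; [|by rewrite piP|by move=> w /QN].
by rewrite -[X in measurable X]setTI; exact: mpi.
Qed.

End implementation.

End stopping_algorithm.

Theorem theorem4 (R : realType) (T D : nat) (T_gt0 : (0 < T)%N)
    (D_gt0 : (0 < D)%N)
    (d : measure_display) (Omega : measurableType d) (P : probability Omega R)
    (Y : Omega -> 'M[R]_(D, T)) (Y_meas : measurable_fun setT Y)
    (g : forall t : 'I_T.+1, 'M[R]_(D, t) -> R)
    (g_meas : forall t : 'I_T.+1, (0 < t)%N -> measurable_fun setT (g t))
    (kappa : forall t : 'I_T.+1, R.-pker 'M[R]_(D, t) ~> 'M[R]_(D, T))
    (kappaP : forall t : 'I_T.+1, conditional_law P Y (kappa t))
    (C G : R) (C_ge0 : 0 <= C) (G_ge0 : 0 <= G)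
    (OPT_gt0 : (0 < OPT g P Y)%E)
    (Z01 : forall t : 'I_T.+1, (0 < t)%N ->
      {ae P, forall w, 0 <= reward g t (Y w) <= 1})
    (eps : R) (eps_gt0 : 0 < eps) (eps_lt1 : eps < 1) :
  [/\ exists (d' : measure_display) (Omega' : measurableType d')
        (P' : probability Omega' R) (pi : Omega' -> Omega)
        (tau : Omega' -> 'I_T.+1),
        implements g kappa eps P Y P' pi tau,
      forall (d' : measure_display) (Omega' : measurableType d')
        (P' : probability Omega' R) (pi : Omega' -> Omega)
        (tau : Omega' -> 'I_T.+1),
        implements g kappa eps P Y P' pi tau ->
        randomized_stopping_time P' (Y \o pi) tau /\
        (OPT g P Y - eps%:E <= expected_reward g P' (Y \o pi) tau)%E
    & forall (t : 'I_T.+1) (gamma : 'M[R]_(D, t)), (0 < t)%N ->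
        time_le g C G (decision eps gamma)
          ((C + G + 1) * expR (250 * eps ^- 2) * T%:R `^ (12 * eps^-1))].
Proof.
split; first exact: implements_ex.
- move=> d' Omega' P' pi tau tauP.
  have [mpi tau0 mtau _ _] := tauP.
  have [nu nuE] := law_of_paths_ex P Y_meas.
  have nu_kappa := law_of_paths_kappa Y_meas nuE kappaP.
  have g01 (t : 'I_T.+1) : (0 < t)%N -> {ae nu, forall y, 0 <= g t (first_cols t y) <= 1}.
    move=> t0; apply: (law_of_paths_ae Y_meas nuE); last exact: Z01.
    exact: measurable_reward01 (g_meas t t0).
  have mYpi : measurable_fun setT (Y \o pi) by exact: measurableT_comp.
  have wt := law_stopping_weights T_gt0 kappa g_meas eps nu.
  have P'nu := implements_law Y_meas tauP nuE.
  have P'o := implements_weights Y_meas g_meas tauP nuE.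
  split; first exact: (randomized_of_weights nu_kappa wt mYpi tau0 mtau P'nu P'o).
  have -> : expected_reward g P' (Y \o pi) tau =
      mean_reward nu g kappa (law_weights g kappa eps).
    apply: expected_reward_weights => // t t0.
    exact: (implements_ae tauP (Z01 t t0)).
  rewrite leeBlDr//; apply: ge_ereal_sup => _ [sigma sigma_stop <-].
  have [a wa aY] := stopping_time_weights sigma_stop (fun A _ => esym (nuE A)).
  have -> : expected_reward g P Y sigma = mean_reward nu g kappa a.
    apply: expected_reward_weights => //.
    + by have [] := sigma_stop.
    + exact: (measurable_stopping_time Y_meas sigma_stop (fun A _ => esym (nuE A))).
    move=> A s mA; rewrite (integral_law_of_paths Y_meas nuE)//; last 2 first.
    + by apply/measurable_EFinP; exact: (weights_meas wa).
    + by move=> y; rewrite lee_fin (weights_ge0 wa).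
    under eq_integral do rewrite aY.
    have ms : measurable [set w | sigma w = s].
      exact: (measurable_stopping_time Y_meas sigma_stop (fun A _ => esym (nuE A))).
    rewrite setIC -integral_indic//; last first.
      by rewrite -[X in measurable X]setTI; exact: Y_meas.
    apply: eq_integral => w _; rewrite indicE; congr (_%:R%:E).
    by congr nat_of_bool; apply/idP/eqP; rewrite inE.
  have [k Kd] : exists k, depth eps = k.+1.
    by exists (depth eps).-1; rewrite prednK// depth_gt0.
  have loss := law_loss T_gt0 g_meas nu_kappa g01 eps_gt0 eps_lt1.
  rewrite Kd in loss.
  exact: (nearly_optimal T_gt0 g_meas nu_kappa wa wt (ltW eps_gt0) loss).
- move=> t gamma _; exact: time_le_decision.
Qed.
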